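(* Let $K$ be a finite set with more than one element, let $\kappa$ be the uniform probability measure on $K$, and let $\mathbb F_2=\langle a,b\rangle$ be the free group of rank 2. Then the shift action $\mathbb F_2\curvearrowright\big((K\times K)^{\mathbb F_2},\kappa^{\mathbb F_2/\langle b\rangle}\times\kappa^{\mathbb F_2}\big)$ is stably orbit equivalent to a nontrivial Bernoulli shift over the free group of rank $|K|+1$.
   Context: For a set $L$ and a countable group $G$, $G$ acts on $L^G$ by the shift action $(g\cdot x)(f)=x(g^{-1}f)$. For a standard probability space $(L,\lambda)$, the Bernoulli shift over $G$ with base space $(L,\lambda)$ is the shift action $G\curvearrowright(L^G,\lambda^G)$, with $\lambda^G$ the product measure. It is nontrivial if $\lambda$ is not supported on a single point. Measure $\kappa^{\mathbb F_2/\langle b\rangle}\times\kappa^{\mathbb F_2}$ on $(K\times K)^{\mathbb F_2}$: let $\mathbb F_2/\langle b\rangle$ be the set of left cosets $g\langle b\rangle$ and define the injection $\Phi:K^{\mathbb F_2/\langle b\rangle}\times K^{\mathbb F_2}\to(K\times K)^{\mathbb F_2}$ by $\Phi(x,y)(g)=\big(x(g\langle b\rangle),y(g)\big)$. The notation $\kappa^{\mathbb F_2/\langle b\rangle}\times\kappa^{\mathbb F_2}$ denotes the push-forward under $\Phi$ of the product measure, so the complement of the image has measure $0$. Stable orbit equivalence: two p.m.p. actions $G_1\curvearrowright^T(X_1,\mu_1)$, $G_2\curvearrowright^S(X_2,\mu_2)$ of countable groups on standard probability spaces are stably orbit equivalent if there exist positive measure sets $A_i\subset X_i$ and a map $\phi:A_1\to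 A_2$ inducing a measure-space isomorphism (mod null sets) between $(A_1,\mu_1(\cdot|A_1))$ and $(A_2,\mu_2(\cdot|A_2))$ such that for a.e. $x\in A_1$, $\phi(\{T_gx:g\in G_1\}\cap A_1)=\{S_g\phi(x):g\in G_2\}\cap A_2$ (up to discarding null sets). Here $\mu(E|A)=\mu(E\cap A)/\mu(A)$. *)

(* Defs.v *)
From HB Require Import structures.
From mathcomp Require Import all_boot all_order all_algebra finmap.
From mathcomp Require Import all_classical all_reals all_analysis.

Set Implicit Arguments.
Unset Strict Implicit.
Unset Printing Implicit Defensive.

Local Open Scope classical_set_scope.
Local Open Scope ring_scope.

(** * Free groups *)

(* The letter [(i, b)] is the generator [x_i] if [b] is true, and [x_i^-1]
   otherwise; [free_group n] is the set of reduced words on the [x_i], [i < n]. *)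
Notation letter n := ('I_n * bool)%type (only parsing).

Definition letter_inv n (l : letter n) : letter n := (l.1, ~~ l.2).

Definition reduced n (w : seq (letter n)) : bool :=
  sorted (fun l m => m != letter_inv l) w.

Record free_group (n : nat) : Type := FreeGroup {
  word :> seq (letter n);
  word_reduced : reduced word }.

HB.instance Definition _ n := [isSub for @word n].
HB.instance Definition _ n := [Countable of free_group n by <:].

Section FreeGroup.
Variable n : nat.
Implicit Types (l : letter n) (v w : seq (letter n)).

Definition push l w : seq (letter n) :=
  if w is m :: w' then if m == letter_inv l then w' else l :: w else [:: l].

Definition word_mul v w := foldr push w v.
Definition word_inv w := rev (map (@letter_inv n) w).

Lemma letter_invK : involutive (@letter_inv n).
Proof. by case=> i b; rewrite /letter_inv negbK. Qed.

Lemma push_reduced l w : reduced w -> reduced (push l w).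
Proof.
case: w => //= m w; case: ifP => [_|]; first exact: path_sorted.
by rewrite /reduced /= => -> ->.
Qed.

Lemma push_id l w : reduced (l :: w) -> push l w = l :: w.
Proof. by case: w => //= m w /andP[/negbTE->]. Qed.

Lemma pushK l w : reduced w -> push (letter_inv l) (push l w) = w.
Proof.
case: w => [|m w] rw /=; first by rewrite letter_invK eqxx.
case: ifP => [/eqP mE|_]; last by rewrite /= letter_invK eqxx.
by rewrite -mE push_id.
Qed.

Lemma word_mul_reduced v w : reduced w -> reduced (word_mul v w).
Proof. by move=> rw; elim: v => //= l v; exact: push_reduced. Qed.

Lemma word_mul1 w : reduced w -> word_mul w [::] = w.
Proof.
elim: w => //= l w IH rw; rewrite IH ?push_id //; exact: path_sorted rw.
Qed.

Lemma word_mul_push l v w : reduced v -> reduced w ->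
  word_mul (push l v) w = push l (word_mul v w).
Proof.
case: v => //= m v rv rw; case: ifP => [/eqP->|//] /=.
by rewrite -{1}(letter_invK l) pushK // word_mul_reduced.
Qed.

Lemma word_mulA u v w : reduced v -> reduced w ->
  word_mul u (word_mul v w) = word_mul (word_mul u v) w.
Proof.
move=> rv rw; elim: u => //= l u ->.
by rewrite word_mul_push // word_mul_reduced.
Qed.

Lemma word_inv_reduced w : reduced w -> reduced (word_inv w).
Proof.
rewrite /reduced /word_inv rev_sorted sorted_map.
apply: sub_sorted => l m; apply: contra => /eqP /= lE.
by rewrite lE letter_invK.
Qed.

Lemma word_mulV w : word_mul (word_inv w) w = [::].
Proof.
have H u v : word_mul (word_inv u) (u ++ v) = v.
  elim: u v => //= l u IH v; rewrite /word_inv /= rev_cons -cats1.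
  by rewrite /word_mul foldr_cat /= letter_invK eqxx; exact: IH.
by rewrite -{2}[w]cats0 H.
Qed.

Lemma word_invK : involutive word_inv.
Proof.
move=> w; rewrite /word_inv map_rev revK -map_comp -[RHS]map_id.
by apply: eq_map => l; exact: letter_invK.
Qed.

Let one : free_group n := @FreeGroup n [::] isT.
Let mul (g h : free_group n) : free_group n :=
  FreeGroup (word_mul_reduced g (word_reduced h)).
Let inv (g : free_group n) : free_group n :=
  FreeGroup (word_inv_reduced (word_reduced g)).

Let mulA : associative mul.
Proof. by move=> f g h; apply/val_inj/word_mulA; exact: word_reduced. Qed.
Let mul1g : left_id one mul. Proof. by move=> g; exact: val_inj. Qed.
Let mulg1 : right_id one mul.
Proof. by move=> g; apply/val_inj/word_mul1; exact: word_reduced. Qed.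
Let mulVg : left_inverse one inv mul.
Proof. by move=> g; apply/val_inj/word_mulV. Qed.
Let mulgV : right_inverse one inv mul.
Proof.
by move=> g; apply/val_inj; rewrite /= -{1}[word g]word_invK word_mulV.
Qed.

HB.instance Definition _ :=
  isGroup.Build (free_group n) mulA mul1g mulg1 mulVg mulgV.

Definition free_gen (i : 'I_n) : free_group n := @FreeGroup n [:: (i, true)] isT.

End FreeGroup.

(** * Cosets of a cyclic subgroup *)

Definition cyclic_subgroup (G : groupType) (b : G) : set G :=
  [set h | exists k : nat, h = (b ^+ k)%g \/ h = (b ^- k)%g].

Definition lcoset_cyclic (G : groupType) (b g : G) : set G :=
  [set (g * h)%g | h in cyclic_subgroup b].

Definition lcosets_cyclic (G : groupType) (b : G) : set (set G) :=
  range (lcoset_cyclic b).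

Definition to_lcoset (G : groupType) (b g : G) : lcosets_cyclic b :=
  SigSub (mem_set (imageT (lcoset_cyclic b) g)).

(** * Product spaces and product measures *)

(* [pow_space I L] is [L^I] with the product sigma-algebra. *)
Definition pow_space (I L : Type) : Type := I -> L.

Definition pow_display : measure_display -> measure_display.
Proof. exact. Qed.

Definition pow_cylinders (I : Type) d (L : measurableType d) :
    set (set (pow_space I L)) :=
  \bigcup_(i in [set: I])
    preimage_set_system setT (fun x : pow_space I L => x i) measurable.

Section PowSpace.
Context (I : Type) d (L : measurableType d).

HB.instance Definition _ := Pointed.on (pow_space I L).

Let pow0 : <<s @pow_cylinders I d L >> set0.
Proof. exact: sigma_algebra0. Qed.
Let powC A : <<s @pow_cylinders I d L >> A -> <<s @pow_cylinders I d L >> (~` A).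
Proof. exact: sigma_algebraC. Qed.
Let powU (F : (set (pow_space I L))^nat) :
  (forall i, <<s @pow_cylinders I d L >> (F i)) ->
  <<s @pow_cylinders I d L >> (\bigcup_i F i).
Proof. exact: sigma_algebra_bigcup. Qed.

HB.instance Definition _ := @isMeasurable.Build (pow_display d)
  (pow_space I L) <<s @pow_cylinders I d L >> pow0 powC powU.

Lemma measurable_pow_proj (i : I) :
  measurable_fun setT (fun x : pow_space I L => x i).
Proof. by move=> _ A mA; apply: sub_sigma_algebra; exists i => //; exists A. Qed.

End PowSpace.

Definition is_pow_measure (R : realType) (I : choiceType) d
    (L : measurableType d) (lambda : probability L R)
    (P : probability (pow_space I L) R) : Prop :=
  forall (J : {fset I}) (B : I -> set L), (forall i, measurable (B i)) ->
    P [set x | forall i, i \in J -> B i (x i)]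
    = (\prod_(i <- J) lambda (B i))%E.

(* [lambda^I], the unique probability measure on [L^I] with the above values on
   cylinder sets; it exists by Kolmogorov's theorem, so that the default value of
   [get] is irrelevant. *)
Definition pow_measure (R : realType) (I : choiceType) d (L : measurableType d)
    (lambda : probability L R) : probability (pow_space I L) R :=
  get (is_pow_measure lambda).
Arguments pow_measure {R} I {d L} lambda.

(** * Group actions on measure spaces *)

Definition shift_action (G : groupType) (L : Type) (g : G) (x : pow_space G L) :
  pow_space G L := fun f => x (g^-1 * f)%g.
Arguments shift_action : clear implicits.

Definition action_orbit (G : groupType) (X : Type) (T : G -> X -> X) (x : X) :
  set X := [set T g x | g in setT].

Definition cond_measure (R : realType) d (X : measurableType d)
    (mu : probability X R) (A E : set X) : \bar R :=
  (mu (E `&` A) * ((fine (mu A))^-1)%:E)%E.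

Definition conull_in (R : realType) d (X : measurableType d)
    (mu : probability X R) (A B : set X) : Prop :=
  [/\ measurable B, B `<=` A & mu (A `\` B) = 0%E].

(* [phi] restricts to an isomorphism of measure spaces from [B1], with the
   measure [mu1(.|A1)], onto [B2], with the measure [mu2(.|A2)]. *)
Definition measure_iso_on (R : realType) d1 (X1 : measurableType d1)
    d2 (X2 : measurableType d2) (mu1 : probability X1 R)
    (mu2 : probability X2 R) (A1 : set X1) (A2 : set X2)
    (phi : X1 -> X2) (B1 : set X1) (B2 : set X2) : Prop :=
  [/\ set_bij B1 B2 phi,
      forall E, measurable E -> measurable (B1 `&` phi @^-1` E),
      forall E, measurable E -> E `<=` B1 -> measurable (phi @` E) &
      forall E, measurable E -> E `<=` B1 ->
        cond_measure mu2 A2 (phi @` E) = cond_measure mu1 A1 E].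

(* [B1] and [B2] are what remains of [A1] and [A2] after discarding null sets.
   The relation is meant for p.m.p. actions of countable groups on standard
   probability spaces, but its statement does not depend on these properties. *)
Definition stably_orbit_equivalent (R : realType) (G1 G2 : groupType)
    d1 (X1 : measurableType d1) d2 (X2 : measurableType d2)
    (T : G1 -> X1 -> X1) (mu1 : probability X1 R)
    (S : G2 -> X2 -> X2) (mu2 : probability X2 R) : Prop :=
  exists (A1 : set X1) (A2 : set X2) (phi : X1 -> X2)
         (B1 : set X1) (B2 : set X2),
    [/\ [/\ measurable A1, measurable A2, (0 < mu1 A1)%E & (0 < mu2 A2)%E],
        set_fun A1 A2 phi,
        conull_in mu1 A1 B1 /\ conull_in mu2 A2 B2,
        measure_iso_on mu1 mu2 A1 A2 phi B1 B2 &
        {ae mu1, forall x, B1 x ->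
          phi @` (action_orbit T x `&` B1) = action_orbit S (phi x) `&` B2}].

(** * Base spaces *)

(* A Hausdorff [completePseudoMetricType] is a complete metric space. *)
Definition standard_borel (R : realType) d (L : measurableType d) : Prop :=
  exists X : completePseudoMetricType R,
    [/\ hausdorff_space X,
        exists2 D : set X, countable D & dense D &
        exists2 f : L -> X, bijective f &
          forall A : set L,
            measurable A <-> exists2 B, <<s @open X >> B & A = f @^-1` B].

Definition nontrivial_probability (R : realType) d (L : measurableType d)
    (lambda : probability L R) : Prop :=
  forall l : L, lambda [set l] != 1%E.

(* The finite set [K] with the sigma-algebra of all its subsets.  A measurable
   type needs a distinguished point; it plays no role. *)
Definition discrete_space (K : finType) (K_gt1 : (1 < #|K|)%N) : Type := K.

Section DiscreteSpace.
Context (K : finType) (K_gt1 : (1 < #|K|)%N).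
Local Notation T := (discrete_space K_gt1).

HB.instance Definition _ := Finite.copy T K.
HB.instance Definition _ := isPointed.Build T (enum_val (Ordinal (ltnW K_gt1))).
HB.instance Definition _ := @isMeasurable.Build default_measure_display T
  discrete_measurable discrete_measurable0
  discrete_measurableC discrete_measurableU.

(* The normalised counting measure: as [0 < #|K|], the default value of
   [mnormalize] is not used. *)
Definition uniform_measure (R : realType) : probability T R :=
  mnormalize (@counting T R) (dirac point).

End DiscreteSpace.

(** * The measure [kappa^(G/<b>) x kappa^G] on [(K x K)^G] *)

Section CosetMeasure.
Context (R : realType) (G : groupType) (b : G) d (K : measurableType d).

Definition coset_pair
    (xy : pow_space (lcosets_cyclic b) K * pow_space G K) :
  pow_space G (K * K)%type := fun g => (xy.1 (to_lcoset b g), xy.2 g).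

Lemma measurable_coset_pair : measurable_fun setT coset_pair.
Proof.
apply: (measurability (@pow_cylinders G _ (K * K)%type)) => //.
move=> _ [_ [g _ [A mA <-]] <-]; rewrite !setTI.
have mg : measurable_fun setT (fun xy => coset_pair xy g).
  apply/measurable_fun_pairP; split.
    exact: (measurableT_comp (measurable_pow_proj (to_lcoset b g)) measurable_fst).
  exact: (measurableT_comp (measurable_pow_proj g) measurable_snd).
by rewrite -[X in measurable X]setTI; exact: mg.
Qed.

HB.instance Definition _ :=
  isMeasurableFun.Build _ _ _ _ coset_pair measurable_coset_pair.

Definition coset_measure (kappa : probability K R) :
    probability (pow_space G (K * K)%type) R :=
  distribution
    (pow_measure (lcosets_cyclic b) kappa \x pow_measure G kappa)%E coset_pair.

End CosetMeasure.

(* Main.v *)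
(* Put q = |K|, fix k0 in K, and write F2 = <a, b> and F = <alpha, beta_k : k in K>,
   a free group of rank q + 1.  Cut an iid sequence with values in K x K before each
   letter with first coordinate k0: the resulting blocks are iid on a countable set
   L, so that a point w of L^F carries on each coset g<alpha> a bi-infinite sequence
   of letters.  On such a line, for each k, read k0 as an opening and k as a closing
   parenthesis: almost surely this matches the block starts bijectively with the
   letters of first coordinate k, because the simple random walk on Z is recurrent
   and, by mass transport, because the mean length of a block is q.  Hence the pairs
   (block start, k) are in bijection with all the letters of the line, and the
   successor of letters becomes a shift-equivariant bijection T of Z x K.

   Let F2 act on L^F x K: a moves along the line by T, and b sends (w, k) to
   (beta_k w, k).  Recording at each g the letter matched with the current state
   gives an equivariant map Theta to (K x K)^F2, and the first coordinate of
   Theta(w, k) is constant on the cosets g<b>.  Exploring F2 line by line, where a line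
   is a coset g<a>, shows that Theta maps lambda^F x (counting measure on K) to q times
   the measure mu1 = kappa^(F2/<b>) x kappa^F2: each new line is entered through an edge
   labelled b, behind which lies a part of w that is independent of what has been seen.
   So w |-> Theta(w, k0) maps lambda^F to the normalised restriction of mu1 to
   the set A1 of those z with first coordinate k0 at the identity.  It is invertible:
   each generator of F acts like an element of F2 that can be read off from
   Theta(w, k0).  The inverse is the required stable orbit equivalence. *)

From HB Require Import structures.
Require Import Defs.
From mathcomp Require Import all_boot all_order all_algebra finmap.
From mathcomp Require Import all_classical all_reals all_analysis.
From mathcomp Require Import ring lra zify.
Set Implicit Arguments.
Unset Strict Implicit.
Unset Printing Implicit Defensive.
Import Order.TTheory GRing.Theory Num.Theory.
Import numFieldNormedType.Exports.
Local Open Scope classical_set_scope.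
Local Open Scope ring_scope.

(** * Measurability of predicates *)

(** Cost predicts the rank: an essentially free action of F2 has cost 2, so its restriction to a set
    of measure 1/q has cost 1 + q(2 - 1) = q + 1. The generators reflect this: alpha moves along a
    line, and each of the q states sharing a block start gets its own beta_k.

    The obstacle is the law of the letters around a state. From a block start it is explicit, but a
    state (w, k) with k other than k0 sits at a closing letter whose distance from the block start
    depends on the letters read on the way. The law is obtained indirectly. The product of lambda^F
    and counting measure on K is invariant under F2, so a word can be extended to the left until a
    letter with k0 appears. This bounds the measure of the word from below, and the bounds already
    add up to the total mass q, so none of them is strict.

    The exploration of F2 is made finite by windows, built from segments of lines of a common
    radius; each new segment multiplies both laws by the same factor.

    That Theta(., k0) covers almost all of A1 needs no argument of its own: the part of A1 that is
    not decoded correctly pulls back to a null set, and the equality of laws does the rest. *)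

Section MeasurablePredicates.
Context d (T : measurableType d).
Implicit Types P Q : T -> Prop.

Lemma measurable_set_exists (I : countType) (P : I -> T -> Prop) :
  (forall i, measurable [set x | P i x]) -> measurable [set x | exists i, P i x].
Proof.
move=> mP; rewrite (_ : [set x | _] = \bigcup_i [set x | P i x]).
  exact: countable_bigcupT_measurable.
by apply/seteqP; split=> x /= [i]; [exists i|move=> _; exists i].
Qed.

Lemma measurable_set_not P : measurable [set x | P x] -> measurable [set x | ~ P x].
Proof. by move=> mP; rewrite (_ : [set x | ~ P x] = ~` [set x | P x]) //; exact: measurableC. Qed.

Lemma measurable_set_forall (I : countType) (P : I -> T -> Prop) :
  (forall i, measurable [set x | P i x]) -> measurable [set x | forall i, P i x].
Proof.
move=> mP; rewrite (_ : [set x | _] = [set x | ~ exists i, ~ P i x]).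
  by apply/measurable_set_not/measurable_set_exists => i; exact: measurable_set_not.
by apply/seteqP; split=> x /= h; [move=> -[i]; apply|move=> i; apply: contrapT => hi; apply: h; exists i].
Qed.

Lemma measurable_set_and P Q : measurable [set x | P x] -> measurable [set x | Q x] ->
  measurable [set x | P x /\ Q x].
Proof. by move=> mP mQ; rewrite (_ : [set x | _] = [set x | P x] `&` [set x | Q x]) //; exact: measurableI. Qed.

Lemma measurable_set_or P Q : measurable [set x | P x] -> measurable [set x | Q x] ->
  measurable [set x | P x \/ Q x].
Proof. by move=> mP mQ; rewrite (_ : [set x | _] = [set x | P x] `|` [set x | Q x]) //; exact: measurableU. Qed.

Lemma measurable_set_prop (p : Prop) : measurable [set _ : T | p].
Proof.
have [h|h] := pselect p.
  by rewrite (_ : [set _ | _] = setT) //; apply/seteqP; split.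
by rewrite (_ : [set _ | _] = set0) //; apply/seteqP; split.
Qed.

Lemma measurable_set_imp (p : Prop) Q : (p -> measurable [set x | Q x]) ->
  measurable [set x | p -> Q x].
Proof.
move=> mQ; have [h|h] := pselect p.
  rewrite (_ : [set x | p -> Q x] = [set x | Q x]); first exact: mQ.
  by apply/seteqP; split=> x //= /(_ h).
by rewrite (_ : [set x | p -> Q x] = setT) //; apply/seteqP; split=> x //= _ /h.
Qed.

Lemma measurable_set_ext P Q : (forall x, P x <-> Q x) ->
  measurable [set x | P x] -> measurable [set x | Q x].
Proof. by move=> h; rewrite (_ : [set x | P x] = [set x | Q x]) //; apply/seteqP; split=> x /h. Qed.

(* For functions with countable range; the codomain carries no sigma-algebra. *)
Definition cmeasurable (C : Type) (f : T -> C) := forall c, measurable [set x | f x = c].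

Lemma cmeasurable_pre (C : countType) (f : T -> C) (P : C -> Prop) :
  cmeasurable f -> measurable [set x | P (f x)].
Proof.
move=> mf; apply: (@measurable_set_ext (fun x => exists c, P c /\ f x = c)).
  by move=> x; split=> [[c [h ->]]//|h]; exists (f x).
by apply: measurable_set_exists => c; apply: measurable_set_and => //; exact: measurable_set_prop.
Qed.

Lemma cmeasurable_select (C : countType) (P : C -> T -> Prop) (f : T -> C) :
  cmeasurable f -> (forall c, measurable [set x | P c x]) -> measurable [set x | P (f x) x].
Proof.
move=> mf mP; apply: (@measurable_set_ext (fun x => exists c, f x = c /\ P c x)).
  by move=> x; split=> [[c [<-]]//|h]; exists (f x).
by apply: measurable_set_exists => c; exact: measurable_set_and.
Qed.

Lemma cmeasurable_comp (C : countType) (D : Type) (g : C -> D) (f : T -> C) :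
  cmeasurable f -> cmeasurable (g \o f).
Proof. by move=> mf c; exact: (cmeasurable_pre (fun x => g x = c) mf). Qed.

Lemma cmeasurable_cst (C : Type) (c : C) : cmeasurable (fun=> c).
Proof. by move=> c'; exact: measurable_set_prop. Qed.

Lemma cmeasurable_bind (C : countType) (D : Type) (g : C -> T -> D) (f : T -> C) :
  cmeasurable f -> (forall c, cmeasurable (g c)) -> cmeasurable (fun x => g (f x) x).
Proof. by move=> mf mg c; apply: (@cmeasurable_select _ (fun y x => g y x = c) f mf) => y; exact: mg. Qed.

End MeasurablePredicates.

Lemma prob_unique d (T : measurableType d) (R : realType) (G : set (set T)) (m1 m2 : probability T R) :
  measurable = <<s G >> -> setI_closed G -> (forall A, G A -> m1 A = m2 A) ->
  forall A, measurable A -> m1 A = m2 A.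
Proof.
(* Uniqueness asks for a countable cover by generating sets; adjoining [setT] provides one and keeps
   stability under intersections. *)
move=> mG GI m12; apply: (@measure_unique _ _ _ (G `|` [set setT]) (fun=> setT)).
- apply/seteqP; split; rewrite mG.
    apply: smallest_sub; first exact: smallest_sigma_algebra.
    by move=> A GA; apply: sub_sigma_algebra; left.
  apply: smallest_sub; first exact: smallest_sigma_algebra.
  move=> A [GA|->]; first exact: sub_sigma_algebra.
  by rewrite -mG; exact: measurableT.
- move=> A B [GA|->] [GB|->]; rewrite ?setIT ?setTI; [left|left|left|right] => //.
  exact: GI.
- by move=> _; right.
- by apply/seteqP; split => // x _; exists 0%N.
- move=> A [/m12//|->].
  exact: (eq_trans (probability_setT m1) (esym (probability_setT m2))).
- by move=> _; apply: (le_lt_trans (probability_le1 m1 measurableT)); rewrite ltry.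
Qed.

(** * Product measures *)

Section Push.
Context d d' (T : measurableType d) (U : measurableType d') (R : realType).
Variables (P : probability T R) (f : T -> U) (mf : measurable_fun setT f).

Let mfun : {mfun T >-> U} := HB.pack f (isMeasurableFun.Build _ _ _ _ f mf).
Definition prob_image : probability U R := distribution P mfun.

Lemma prob_imageE A : prob_image A = P (f @^-1` A). Proof. by []. Qed.
End Push.

Section PowMeasure.
Context (I : choiceType) d (L : measurableType d).

Definition cyl (J : {fset I}) (B : I -> set L) : set (pow_space I L) :=
  [set x | forall i, i \in J -> B i (x i)].

Lemma measurable_cyl J B : (forall i, measurable (B i)) -> measurable (cyl J B).
Proof.
move=> mB; rewrite (_ : cyl J B = \bigcap_(i in [set` J]) [set x | B i (x i)]); last first.
  by apply/seteqP; split.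
apply: fin_bigcap_measurable => // i _.
by have := measurable_pow_proj i measurableT (mB i); rewrite setTI.
Qed.

Definition cylinders : set (set (pow_space I L)) :=
  [set A | exists J B, (forall i, measurable (B i)) /\ A = cyl J B].

Lemma cylinders_setI : setI_closed cylinders.
Proof.
move=> _ _ [J [B [mB ->]]] [J' [B' [mB' ->]]].
exists (J `|` J')%fset,
  (fun i => (if i \in J then B i else setT) `&` (if i \in J' then B' i else setT)).
split; first by move=> i; apply: measurableI; case: ifP.
apply/seteqP; split=> x.
  by move=> [h h'] i _; split; case: ifP => //; [move/h|move/h'].
move=> h; split=> i iJ; have := h i.
  by rewrite inE iJ => /(_ isT)[].
by rewrite inE iJ orbT => /(_ isT)[].
Qed.

Lemma cylinders_gen : measurable = <<s cylinders >>.
Proof.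
apply/seteqP; split.
  rewrite -[measurable]/(<<s @pow_cylinders I _ L >>).
  apply: smallest_sub; first exact: smallest_sigma_algebra.
  move=> _ [i _ [A mA <-]]; apply: sub_sigma_algebra.
  exists [fset i]%fset, (fun=> A); split => //.
  apply/seteqP; split=> x; first by move=> [_ h] j /fset1P ->.
  by move=> h; split=> //; apply: h; rewrite inE.
apply: smallest_sub; first exact: sigma_algebra_measurable.
by move=> _ [J [B [mB ->]]]; exact: measurable_cyl.
Qed.

End PowMeasure.

Section PowMeasure2.
Context (R : realType) d (L : measurableType d) (lam : probability L R).

Lemma pow_measure_unique (I : choiceType) (P Q : probability (pow_space I L) R) :
  is_pow_measure lam P -> is_pow_measure lam Q ->
  forall A, measurable A -> P A = Q A.
Proof.
move=> hP hQ; apply: (prob_unique (@cylinders_gen I _ L) (@cylinders_setI I _ L)).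
by move=> _ [J [B [mB ->]]]; rewrite /cyl hP // hQ.
Qed.

Lemma measurable_fun_pow (I : choiceType) d' (T : measurableType d') (f : T -> pow_space I L) :
  (forall i, measurable_fun setT (fun x => f x i)) -> measurable_fun setT f.
Proof.
move=> mf; apply: (measurability (@pow_cylinders I _ L)) => //.
move=> _ [_ [i _ [A mA <-]] <-]; rewrite setTI.
have := mf i measurableT A mA; rewrite !setTI.
by congr measurable; apply/seteqP; split => x; rewrite /preimage /= => [h|[]]//; split.
Qed.

(** Serves both for translations of the index group and for extracting a row from a sequence indexed
    by pairs. *)
Lemma pow_reindex (I I' : choiceType) (h : I -> I')
    (P' : probability (pow_space I' L) R) (P : probability (pow_space I L) R) :
  injective h -> is_pow_measure lam P' -> is_pow_measure lam P ->
  forall A : set (pow_space I L), measurable A ->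
  P' [set x : pow_space I' L | A (fun i => x (h i))] = P A.
Proof.
move=> hi hP' hP A mA.
pose f0 (x : pow_space I' L) : pow_space I L := fun i => x (h i).
have mh : measurable_fun setT f0.
  by apply: measurable_fun_pow => i; exact: measurable_pow_proj.
have : is_pow_measure lam (prob_image P' mh).
  move=> J B mB; rewrite prob_imageE.
  have := hP' (h @` J)%fset (fun i' => if pselect (exists2 i, i \in J & h i = i') is left e
     then B (sval (cid2 e)) else setT).
  rewrite big_imfset /=; last by move=> ? ? _ _; exact: hi.
  have E i : i \in J -> (if pselect (exists2 i0, i0 \in J & h i0 = h i) is left e
     then B (sval (cid2 e)) else setT) = B i.
    move=> iJ; case: pselect => [e|[]]; last by exists i.
    by case: cid2 => j /= _ /hi ->.
  move=> h1; transitivity (\prod_(i <- J) lam (if pselect (exists2 i0, i0 \in J & h i0 = h i) is left e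
     then B (sval (cid2 e)) else setT))%E; last first.
    by rewrite big_seq [RHS]big_seq; apply: eq_bigr => i iJ; rewrite E.
  rewrite -h1; last by move=> i; case: pselect.
  congr (P' _); apply/seteqP; split=> x /= hx i.
    by move=> /imfsetP[j /= jJ ->]; rewrite E //; exact: hx.
  by move=> iJ; have := hx (h i); rewrite E //; apply; exact: in_imfset.
by move=> hd; have := pow_measure_unique hd hP mA.
Qed.

Section Mix.
Context (I : choiceType) (P : probability (pow_space I L) R).
Hypothesis hP : is_pow_measure lam P.
Variable S : set I.

(* Replacing the coordinates outside [S] by an independent copy preserves the
   product measure, which makes events on [S] and off [S] independent. *)
Definition mix (xy : pow_space I L * pow_space I L) : pow_space I L :=
  fun i => if `[< S i >] then xy.1 i else xy.2 i.

Lemma measurable_mix : measurable_fun setT mix.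
Proof.
apply: measurable_fun_pow => i; rewrite /mix; case: asboolP => _.
  exact: (measurableT_comp (measurable_pow_proj i) measurable_fst).
exact: (measurableT_comp (measurable_pow_proj i) measurable_snd).
Qed.

HB.instance Definition _ := isMeasurableFun.Build _ _ _ _ mix measurable_mix.

Lemma mix_law : is_pow_measure lam (distribution (P \x P)%E mix).
Proof.
move=> J B mB; rewrite /distribution /pushforward /=.
rewrite (_ : _ @^-1` _ = cyl J (fun i => if `[< S i >] then B i else setT) `*`
   cyl J (fun i => if `[< S i >] then setT else B i)); last first.
  apply/seteqP; split=> -[x y] /=.
    by move=> h; split=> i iJ /=; have := h i iJ; rewrite /mix; case: asboolP.
  by move=> [h h'] i iJ; have := h i iJ; have := h' i iJ; rewrite /mix; case: asboolP.
rewrite product_measure1E; try by apply: measurable_cyl => i; case: asboolP.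
rewrite /cyl; have /= -> := hP J (B := fun i => if `[< S i >] then B i else setT) _; last first.
  by move=> i; case: asboolP.
have /= -> := hP J (B := fun i => if `[< S i >] then setT else B i) _; last first.
  by move=> i; case: asboolP.
rewrite -big_split /=; apply: eq_bigr => i _.
by case: asboolP => _; rewrite probability_setT ?mule1 ?mul1e.
Qed.

Lemma pow_indep (A B : set (pow_space I L)) : measurable A -> measurable B ->
  (forall x y, (forall i, S i -> x i = y i) -> A x -> A y) ->
  (forall x y, (forall i, ~ S i -> x i = y i) -> B x -> B y) ->
  P (A `&` B) = (P A * P B)%E.
Proof.
move=> mA mB lA lB.
rewrite (pow_measure_unique hP mix_law (measurableI _ _ mA mB)).
rewrite /distribution /pushforward /= (_ : _ @^-1` _ = A `*` B) ?product_measure1E //.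
apply/seteqP; split=> -[x y] [Ax By]; split.
- by apply: lA Ax => i Si; rewrite /mix asboolT.
- by apply: lB By => i Si; rewrite /mix asboolF.
- by apply: lA Ax => i Si; rewrite /mix asboolT.
- by apply: lB By => i Si; rewrite /mix asboolF.
Qed.

End Mix.
End PowMeasure2.

(** * Countable and finite partitions *)

Section Partition.
Context d (T : measurableType d) (R : realType) (mu : {measure set T -> \bar R}).

Lemma measure_countable_bigcup (I : countType) (F : I -> set T) :
  (forall i, measurable (F i)) -> trivIset setT F ->
  mu (\bigcup_i F i) = \esum_(i in [set: I]) mu (F i).
Proof.
move=> mF tF; pose G n := oapp F set0 (pickle_inv n : option I).
have GE i : G (choice.pickle i) = F i by rewrite /G pickleK_inv.
have Gn n : ~ range (@choice.pickle I) n -> G n = set0.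
  rewrite /G; have := @pickle_invK I n; case: pickle_inv => //= i <- [].
  by exists i.
have mG n : measurable (G n) by rewrite /G; case: pickle_inv => //=.
have -> : \bigcup_i F i = \bigcup_n G n.
  apply/seteqP; split=> x [i _ Fx]; first by exists (choice.pickle i); rewrite ?GE.
  by move: Fx; rewrite /G; case: pickle_inv => //= j Fx; exists j.
rewrite measure_bigcup //; last first.
  move=> m n _ _ [x [Gm Gn']]; move: Gm Gn'; rewrite /G.
  have := @pickle_invK I m; have := @pickle_invK I n.
  case: pickle_inv => //= i <-; case: pickle_inv => //= j <- Fx Fy.
  by congr choice.pickle; apply: (tF j i) => //; exists x.
rewrite (@eq_eseriesl _ _ xpredT); last by move=> n; rewrite in_setT.
rewrite nneseries_esumT // esum_mkcond.
transitivity (\esum_(n in range (@choice.pickle I)) mu (G n)).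
  rewrite [RHS]esum_mkcond; apply: eq_esum => n _; rewrite in_setT.
  by case: ifPn => //; rewrite notin_setE => /Gn ->; rewrite measure0.
rewrite esum_image; last by move=> i j _ _; exact: (pcan_inj pickleK_inv).
by apply: eq_esum => i _; rewrite GE.
Qed.

Lemma esum_fintype (I : finType) (a : I -> \bar R) : (forall i, 0 <= a i)%E ->
  \esum_(i in [set: I]) a i = (\sum_i a i)%E.
Proof.
move=> a0; rewrite esum_fset //; last exact: finite_finset.
rewrite [RHS](fsbig_seq _ _ (index_enum_uniq I)); apply: eq_fsbigl.
by apply/seteqP; split=> // i _ /=; rewrite mem_index_enum.
Qed.

Lemma measure_partition (C : countType) (f : T -> C) (A : set T) :
  cmeasurable f -> measurable A ->
  mu A = \esum_(c in [set: C]) mu (A `&` [set x | f x = c]).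
Proof.
move=> mf mA; rewrite -measure_countable_bigcup; last first.
- by move=> c c' _ _ [x [[_ <-] [_ <-]]].
- by move=> c; exact: measurableI.
by congr (mu _); apply/seteqP; split=> x; [move=> Ax; exists (f x)|case=> c _ []].
Qed.

Lemma measure_fin_partition (C : finType) (f : T -> C) (A : set T) :
  cmeasurable f -> measurable A ->
  mu A = (\sum_c mu (A `&` [set x | f x = c]))%E.
Proof. by move=> mf mA; rewrite (measure_partition mf mA) esum_fintype. Qed.

End Partition.

(** * Existence of an iid uniform sequence *)

Section Uniform.
Context (R : realType) (K : finType) (K_gt1 : (1 < #|K|)%N).
Local Notation kap := (uniform_measure K_gt1 R).
Local Notation D := (discrete_space K_gt1).
Local Notation q := (#|K|%:R : R).

Lemma qgt0 : 0 < q. Proof. by rewrite ltr0n; apply: leq_trans K_gt1. Qed.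

Lemma card_discrete_space : #|{: D}| = #|K|.
Proof. by apply: (@bij_eq_card D K (fun x => x)); exists (fun x => x). Qed.

Lemma uniformE (A : set D) : kap A = (\sum_(c : D) (if `[< A c >] then q^-1 else 0)%:E)%E.
Proof.
have fs (B : set D) : (counting B : \bar R) = (\sum_(c : D) (if `[< B c >] then 1 else 0)%:E)%E.
  rewrite /counting asboolT; last exact: finite_finset.
  rewrite sumEFin -big_mkcond /= sumr_const; congr (_%:R%:E).
  rewrite -(card_uniqP (fset_uniq (fset_set B))); apply: eq_card => x.
  rewrite [LHS]in_fset_set; last exact: finite_finset.
  by apply/idP/asboolP => [/set_mem|/mem_set].
have B1 : (counting (setT : set D) : \bar R) = q%:E.
  rewrite fs (eq_bigr (fun=> 1%:E)); last by move=> c _; rewrite asboolT.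
  by rewrite sumEFin sumr_const card_discrete_space.
have -> : kap A = (if ((counting (setT : set D) : \bar R) == 0%E) || ((counting (setT : set D) : \bar R) == +oo%E)
    then (\d_(point : D) A : \bar R)
    else (counting A * (fine (counting (setT : set D) : \bar R))^-1%:E)%E).
  by rewrite /uniform_measure/= /mnormalize; case: ifP.
rewrite B1 /= !eqe (gt_eqF qgt0) /= fs.
rewrite ge0_sume_distrl; last by move=> c _; rewrite lee_fin; case: ifP.
by apply: eq_bigr => c _; rewrite -EFinM; case: ifP; rewrite ?mul1r ?mul0r.
Qed.

Lemma uniform1 (c : D) : kap [set c] = (q^-1)%:E.
Proof.
rewrite uniformE (bigD1 c) //= asboolT // big1 ?adde0 // => c' /eqP h.
by rewrite asboolF.
Qed.

Lemma cmeasurableD d (T : measurableType d) (f : T -> D) : measurable_fun setT f <-> cmeasurable f.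
Proof.
split=> [mf c|mf _ A mA].
  by have := mf measurableT [set c] I; rewrite setTI.
by rewrite setTI; exact: (cmeasurable_pre (fun c => A c) mf).
Qed.

(* The digits in base [#|K|] of a uniform point of [0, 1[ are iid and uniform. *)
Definition cell n (x : R) : nat := Num.trunc (x * q ^+ n).
Definition digit (x : R) : pow_space nat D :=
  fun n => nth point (enum {: D}) (cell n.+1 x %% #|K|).

Lemma cellS n (x : R) : 0 <= x -> (cell n.+1 x %/ #|K|)%N = cell n x.
Proof.
move=> x0; have q0 := qgt0; have K0 : (0 < #|K|)%N by apply: leq_trans K_gt1.
have xq m : 0 <= x * q ^+ m by rewrite mulr_ge0 // exprn_ge0 // ltW.
have /andP[h1 h2] := truncn_itv (xq n).
apply/eqP; rewrite eqn_leq -ltnS ltn_divLR // leq_divRL //.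
rewrite /cell truncn_lt_nat // truncn_ge_nat // !natrM exprSr mulrA.
by rewrite ltr_pM2r // ler_pM2r // h1 h2.
Qed.

Lemma measurable_cell n m : measurable [set x : R | cell n x = m].
Proof.
have H j : measurable [set x : R | (j < cell n x)%N].
  rewrite (_ : [set x : R | _] = [set` `[j.+1%:R / q ^+ n, +oo[%R]); first exact: measurable_itv.
  apply/seteqP; split=> x /=; rewrite /cell truncn_gt_nat in_itv /= andbT ler_pdivrMr //;
  by rewrite exprn_gt0 // qgt0.
case: m => [|m].
  rewrite (_ : [set x | _] = ~` [set x : R | (0 < cell n x)%N]); first exact: measurableC.
  by apply/seteqP; split=> x /=; [move=> ->|move/negP; rewrite -leqNgt leqn0 => /eqP].
rewrite (_ : [set x | _] = [set x : R | (m < cell n x)%N] `\` [set x : R | (m.+1 < cell n x)%N]).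
  exact: measurableD.
apply/seteqP; split=> x /=; first by move=> ->; rewrite !ltnn ltnSn.
by move=> [h /negP]; rewrite -leqNgt => h'; apply/eqP; rewrite eqn_leq h h'.
Qed.

Lemma cmeasurable_digit n : cmeasurable (fun x => digit x n).
Proof.
exact: (cmeasurable_comp (fun m => nth point (enum {: D}) (m %% #|K|)%N)
  (@measurable_cell n.+1)).
Qed.

Lemma measurable_digit : measurable_fun setT digit.
Proof.
apply: measurable_fun_pow => n; apply: (cmeasurableD _).2; exact: cmeasurable_digit.
Qed.

Definition cell_event n m (Bs : seq (set D)) : set R :=
  [set x | `[0, 1[%classic x /\ cell n x = m /\
     forall i, (i < size Bs)%N -> nth setT Bs i (digit x (n + i)%N)].

Lemma measurable_cell_event n m Bs : measurable (cell_event n m Bs).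
Proof.
apply: measurable_set_and; first exact: measurable_itv.
apply: measurable_set_and; first exact: measurable_cell.
apply: measurable_set_forall; move=> i; apply: measurable_set_imp => _.
exact: (cmeasurable_pre (nth setT Bs i) (cmeasurable_digit (n + i))).
Qed.

(** Fixing one more digit passes to one of the [#|K|] subcells, so the induction on [Bs] needs all
    [n] and [m]; the bound on [m] keeps the cell inside the unit interval. *)
Lemma lebesgue_cell n m Bs : (m < #|K| ^ n)%N ->
  lebesgue_measure (cell_event n m Bs) = ((q ^- n)%:E * \prod_(B <- Bs) kap B)%E.
Proof.
have q0 := qgt0; have K0 : (0 < #|K|)%N by apply: leq_trans K_gt1.
elim: Bs n m => [|B Bs IH] n m mn.
  have qn : 0 < q ^+ n by rewrite exprn_gt0.
  rewrite big_nil mule1 (_ : cell_event n m [::] =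
      [set` `[m%:R / q ^+ n, m.+1%:R / q ^+ n[%R]); last first.
    apply/seteqP; split=> x; rewrite /cell_event /cell /= !in_itv /=.
      move=> [/andP[x0 x1] [xm _]]; have := truncn_itv (mulr_ge0 x0 (ltW qn)).
      by rewrite xm ler_pdivrMr // ltr_pdivlMr.
    rewrite ler_pdivrMr // ltr_pdivlMr // => /andP[h1 h2].
    have x0 : 0 <= x by rewrite -(pmulr_lge0 _ qn) (le_trans _ h1).
    split; last by split => //; apply: truncn_def; rewrite h1 h2.
    rewrite x0 /= -(ltr_pM2r qn) mul1r (lt_le_trans h2) //.
    by rewrite -natrX ler_nat.
  rewrite lebesgue_measure_itv /= lte_fin ltr_pM2r ?invr_gt0 // ltr_nat ltnSn.
  by rewrite -EFinD -mulrBl -natrB // subSnn mul1r.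
rewrite (measure_fin_partition (@lebesgue_measure R) (cmeasurable_digit n) (measurable_cell_event _ _ _)).
rewrite big_cons uniformE muleA ge0_sume_distrr; last first.
  by move=> c _; rewrite lee_fin; case: ifP => // _; rewrite invr_ge0 ltW.
rewrite ge0_sume_distrl; last first.
  move=> c _; apply: mule_ge0; rewrite lee_fin; first by rewrite invr_ge0 exprn_ge0 // ltW.
  by case: ifP => // _; rewrite invr_ge0 ltW.
apply: eq_bigr => c _; case: asboolP => Bc; last first.
  rewrite mule0 mul0e (_ : _ `&` _ = set0) ?measure0 //.
  apply/seteqP; split => // x [[_ [_ /(_ 0%N isT)]]] /=; rewrite addn0 => Bd dc.
  by apply: Bc; rewrite -dc.
have rk : (index c (enum {: D}) < #|K|)%N.
  by rewrite -card_discrete_space cardE index_mem mem_enum.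
have lt' : (m * #|K| + index c (enum {: D}) < #|K| ^ n.+1)%N.
  rewrite expnSr (@leq_trans (m.+1 * #|K|)%N) // ?leq_mul2r ?mn ?orbT //.
  by rewrite mulSnr ltn_add2l.
rewrite -EFinM -invfM -exprSr -(IH _ _ lt').
congr (lebesgue_measure _); apply/seteqP; split=> x.
  move=> [[x01 [xm h]] /= dc]; split=> //; split.
    have := x01; rewrite /= in_itv /= => /andP[x0 _].
    rewrite (divn_eq (cell n.+1 x) #|K|) cellS // xm; congr addn.
    rewrite -dc /digit index_uniq ?enum_uniq // -cardE card_discrete_space.
    by rewrite ltn_mod.
  by move=> i iB; have := h i.+1 iB; rewrite /= addnS.
move=> [x01 [xm h]]; have := x01; rewrite /= in_itv /= => /andP[x0 _].
have dc : digit x n = c.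
  by rewrite /digit xm modnMDl modn_small // nth_index // mem_enum.
split=> //; split=> //; split.
  by rewrite -cellS // xm divnMDl // divn_small // addn0.
case=> [_|i iB] /=; first by rewrite addn0 dc.
by rewrite addnS -addSn; exact: h.
Qed.

Lemma pow_nat_exists : exists P : probability (pow_space nat D) R, is_pow_measure kap P.
Proof.
have m01 : measurable (`[0, 1[%classic : set R) by exact: measurable_itv.
pose mu0 : {measure set (g_sigma_algebraType R.-ocitv.-measurable) -> \bar R} := mrestr lebesgue_measure m01.
have mu0T : mu0 setT = 1%E.
  rewrite /mu0 /= /mrestr setTI lebesgue_measure_itv /= lte_fin ltr01.
  by rewrite oppr0 adde0.
(* The restriction has mass 1, so [mnormalize] only packages it as a probability. *)
pose P0 : probability (g_sigma_algebraType R.-ocitv.-measurable) R := mnormalize mu0 (dirac ((0 : R) : g_sigma_algebraType R.-ocitv.-measurable)).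
have P0E A : P0 A = lebesgue_measure (A `&` `[0, 1[%classic).
  have -> : P0 A = if (mu0 setT == 0%E) || (mu0 setT == +oo%E) then (\d_((0 : R) : g_sigma_algebraType R.-ocitv.-measurable) A : \bar R)
     else (mu0 A * (fine (mu0 setT))^-1%:E)%E.
    by rewrite /P0 /= /mnormalize; case: ifP.
  by rewrite mu0T /= onee_eq0 /= invr1 mule1.
exists (prob_image P0 measurable_digit) => J B mB.
pose n := (\max_(i <- J) i.+1)%N.
pose B' i := if i \in J then B i else setT.
have Jn i : i \in J -> (i < n)%N.
  by move=> iJ; rewrite /n (big_rem i) //= leq_max ltnSn.
rewrite prob_imageE P0E (_ : _ `&` _ = cell_event 0 0 [seq B' i | i <- iota 0 n]); last first.
  apply/seteqP; split=> x.
    move=> [/= h x01]; split=> //; split.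
      by move: x01; rewrite in_itv /= /cell expr0 mulr1 => /andP[x0 x1]; apply: truncn_def; rewrite x0.
    move=> i; rewrite size_map size_iota => iN.
    rewrite (nth_map 0%N) ?size_iota // nth_iota // add0n /B'.
    by case: ifP => // /h.
  move=> [x01 [_ h]]; split=> // i iJ.
  have := h i; rewrite size_map size_iota (nth_map 0%N) ?size_iota ?nth_iota ?Jn //.
  by rewrite add0n /B' iJ; apply.
rewrite lebesgue_cell // expr0 invr1 mul1e big_map.
transitivity (\prod_(i <- iota 0 n | i \in J) kap (B i))%E.
  rewrite [RHS]big_mkcond; apply: eq_bigr => i _; rewrite /B'; case: ifP => //.
  by rewrite probability_setT.
rewrite -big_filter; apply: perm_big; apply: uniq_perm; last 2 first.
- exact: fset_uniq.
- by move=> i; rewrite mem_filter mem_iota /=; case: (boolP (i \in J)) => // /Jn ->.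
- by rewrite filter_uniq // iota_uniq.
Qed.

End Uniform.

(** * Product measures over countable index sets *)

Section Exists.
Context (R : realType) d0 (D : measurableType d0) (kap : probability D R).
Context (P0 : probability (pow_space nat D) R) (hP0 : is_pow_measure kap P0).
Context d (L : measurableType d) (lam : probability L R).
Context (f : pow_space nat D -> L) (mf : measurable_fun setT f).
Hypothesis lamE : forall B, measurable B -> lam B = P0 (f @^-1` B).

(* An injection of [I * nat] into [nat] splits an iid sequence into independent iid
   sequences indexed by [I]; apply [f] to each of them. *)
Lemma pow_exists (I : choiceType) : countable [set: I] ->
  exists P : probability (pow_space I L) R, is_pow_measure lam P.
Proof.
move=> /pcard_injP[iota iota_inj].
pose code (i : I) (n : nat) : nat := choice.pickle (iota i, n).
have codeI i n i' n' : code i n = code i' n' -> i = i' /\ n = n'.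
  by move=> /(pcan_inj choice.pickleK)[/iota_inj + ->] => -> //; exact: in_setT.
pose row i (x : pow_space nat D) : pow_space nat D := fun n => x (code i n).
have mrow i : measurable_fun setT (row i).
  by apply: measurable_fun_pow => n; exact: measurable_pow_proj.
pose g (x : pow_space nat D) : pow_space I L := fun i => f (row i x).
have mfrow i : measurable_fun setT (f \o row i) by exact: measurableT_comp.
have mg : measurable_fun setT g by exact: measurable_fun_pow.
exists (prob_image P0 mg) => J B mB; rewrite prob_imageE.
have mfB i : measurable [set x | B i (f (row i x))].
  by have := mfrow i measurableT (B i) (mB i); rewrite setTI.
have mev (s : seq I) : measurable [set x | forall i, i \in s -> B i (f (row i x))].
  elim: s => [|i s IH].
    by rewrite (_ : [set x | _] = setT) //; apply/seteqP; split.
  rewrite (_ : [set x | _] = [set x | B i (f (row i x))] `&`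
     [set x | forall i, i \in s -> B i (f (row i x))]); first exact: measurableI.
  apply/seteqP; split=> x.
    move=> h; split=> [|j js]; first by apply: h; rewrite inE eqxx.
    by apply: h; rewrite inE js orbT.
  by move=> [h h'] j; rewrite inE => /orP[/eqP ->|/h'].
suff H (s : seq I) : uniq s -> P0 [set x | forall i, i \in s -> B i (f (row i x))] =
    (\prod_(i <- s) lam (B i))%E by exact: H.
elim: s => [_|i s IH /= /andP[iNs us]].
  rewrite big_nil (_ : [set x | _] = setT) ?probability_setT //.
  by apply/seteqP; split.
rewrite big_cons -IH // lamE //.
have mpre : measurable (f @^-1` B i) by have := mf measurableT (mB i); rewrite setTI.
have <- : P0 [set x | (f @^-1` B i) (row i x)] = P0 (f @^-1` B i).
  by apply: (pow_reindex _ hP0 hP0 mpre) => n n' /codeI[].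
have -> : [set x | forall j, j \in i :: s -> B j (f (row j x))] =
    [set x | B i (f (row i x))] `&` [set x | forall j, j \in s -> B j (f (row j x))].
  apply/seteqP; split=> x.
    move=> h; split=> [|j js]; first by apply: h; rewrite inE eqxx.
    by apply: h; rewrite inE js orbT.
  by move=> [h h'] j; rewrite inE => /orP[/eqP ->|/h'].
(* [S] is the set of terms used by row [i]; [code] being injective, no other row uses them. *)
apply: (pow_indep hP0 (S := [set m | exists n, m = code i n])) => //.
- move=> x y h; rewrite /= (_ : row i x = row i y) //.
  by apply/funext => n; apply: h; exists n.
- move=> x y h + j js => /(_ j js); rewrite (_ : row j x = row j y) //.
  apply/funext => n; apply: h => -[m /codeI[ji _]].
  by rewrite -ji js in iNs.
Qed.
End Exists.

Lemma pow_measureP (R : realType) (I : choiceType) d (L : measurableType d)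
    (lam : probability L R) :
  (exists P : probability (pow_space I L) R, is_pow_measure lam P) ->
  is_pow_measure lam (pow_measure I lam).
Proof. by move=> [P hP]; exact: (getPex (ex_intro _ P hP)). Qed.

(** * Matching parentheses along a line *)

Section Line.
Variables (K : finType) (k0 : K).
Local Notation block := (K * seq (K * K))%type.
Implicit Types (w : int -> block) (p : int * nat) (X : nat -> K) (k : K).

(* [k0] opens and [k] closes a parenthesis; [matched k n X] says that the one opened
   at [X 0] is closed at [X n], where [n = 0] if [k = k0]. *)
Definition sgn k (c : K) : int := (c == k0)%:R - (c == k)%:R.
Definition psum k X n := \sum_(i < n) sgn k (X i).
Definition matched k n X :=
  psum k X n.+1 = 0 /\ forall j, (j < n)%N -> 0 < psum k X j.+1.

Lemma psumS k X n : psum k X n.+1 = psum k X n + sgn k (X n).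
Proof. by rewrite /psum big_ord_recr. Qed.

Lemma psumD k X m n : psum k X (m + n)%N = psum k X m + psum k (fun i => X (m + i)%N) n.
Proof. by rewrite /psum big_split_ord. Qed.

Lemma sgnk0 k : sgn k k0 = (k != k0)%:R.
Proof. by rewrite /sgn eqxx (eq_sym k); case: eqP. Qed.

Lemma sgnk0r c : sgn k0 c = 0. Proof. by rewrite /sgn subrr. Qed.

Lemma matched_uniq k n n' X : matched k n X -> matched k n' X -> n = n'.
Proof.
move=> [s0 sp] [s0' sp']; case: (ltngtP n n') => // h.
  by have := sp' _ h; rewrite s0 ltxx.
by have := sp _ h; rewrite s0' ltxx.
Qed.

Lemma matched0 k X : X 0%N = k0 -> matched k 0 X -> k = k0.
Proof.
by move=> X0 [+ _]; rewrite psumS /psum big_ord0 add0r X0 sgnk0; case: eqP.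
Qed.

Lemma matchedk0 n X : matched k0 n X -> n = 0%N.
Proof.
case: n => // n [_ /(_ 0%N isT)].
by rewrite psumS /psum big_ord0 add0r sgnk0r ltxx.
Qed.

(** The last step brings a positive sum down to 0, and only the letter [k] decreases the sum. *)
Lemma matched_last k n X : X 0%N = k0 -> matched k n X -> X n = k.
Proof.
case: n => [|n] X0 h; first by rewrite (matched0 X0 h).
have [s0 /(_ n (leqnn _)) sn] := h; move: s0; rewrite psumS /sgn.
by case: (X n.+1 =P k) => // _; case: (_ == k0); lia.
Qed.

(** The sums over the whole and over the tail both vanish, hence so does the sum of the first [m]
    terms, which has to be positive if [m] is. *)
Lemma matched_overlap k m n X : matched k (m + n)%N X ->
  matched k n (fun i => X (m + i)%N) -> m = 0%N.
Proof.
case: m => // m [s0 sp] [t0 _].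
have := sp m (leq_addr _ _).
move: s0; rewrite -addnS psumD t0 addr0 => -> ; by rewrite ltxx.
Qed.

(* A block [(y, [:: c1; ..; cn])] stands for the letters [(k0, y), c1, .., cn], where
   the [ci] should have a first coordinate different from [k0].  A line [w] is the
   concatenation of the blocks [w m], and [(m, j)] is the position of the letter number
   [j] of [w m]. *)
Definition sz (l : block) := (size l.2).+1.
Definition lab (l : block) j := nth (k0, l.1) ((k0, l.1) :: l.2) j.
Definition valid w p := (p.2 < sz (w p.1))%N.
Definition succ w p :=
  if (p.2.+1 < sz (w p.1))%N then (p.1, p.2.+1) else (p.1 + 1, 0%N).
Definition pred w p :=
  if p.2 is j.+1 then (p.1, j) else (p.1 - 1, size (w (p.1 - 1)).2).
Definition lbl w p := lab (w p.1) p.2.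
Definition rd w p i := lbl w (iter i (succ w) p).
Definition tr (A : Type) (m : int) (x : int * A) := (m + x.1, x.2).
Definition sh m w : int -> block := fun n => w (m + n).

Lemma valid0 w m : valid w (m, 0%N). Proof. by []. Qed.

Lemma succ_valid w p : valid w (succ w p).
Proof. by rewrite /succ /valid; case: ifP. Qed.

Lemma iter_succ_valid w p n : valid w p -> valid w (iter n (succ w) p).
Proof. by case: n => //= n _; exact: succ_valid. Qed.

Lemma pred_valid w p : valid w p -> valid w (pred w p).
Proof. by case: p => m [|j]; rewrite /valid /pred //= => /ltnW. Qed.

Lemma succK w p : valid w p -> pred w (succ w p) = p.
Proof.
case: p => m j; rewrite /valid /succ /sz => h2; case: ifP => [//|/negbT]; rewrite -leqNgt => h1.
rewrite /pred [(_, _).1]/= [(_, _).2]/= addrK.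
congr pair; by apply/eqP; rewrite eqn_leq -ltnS h1 -ltnS h2.
Qed.

Lemma predK w p : valid w p -> succ w (pred w p) = p.
Proof.
case: p => m [|j]; rewrite /valid /succ /pred /sz /= ?ltnn ?subrK //.
by move=> ->.
Qed.

Lemma succ_inj w p p' : valid w p -> valid w p' -> succ w p = succ w p' -> p = p'.
Proof. by move=> v v' e; rewrite -(succK v) e succK. Qed.

Lemma iter_succ_inj w p p' n : valid w p -> valid w p' ->
  iter n (succ w) p = iter n (succ w) p' -> p = p'.
Proof.
move=> v v'; elim: n => //= n IH /succ_inj h; apply: IH; apply: h;
exact: iter_succ_valid.
Qed.

(** [succ] increases for this order and so has no periodic point. *)
Definition plt p p' := (p.1 < p'.1) || ((p.1 == p'.1) && (p.2 < p'.2)%N).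

Lemma plt_trans a b c : plt a b -> plt b c -> plt a c.
Proof.
rewrite /plt => /orP[h|/andP[/eqP h1 h2]] /orP[h'|/andP[/eqP h1' h2']].
- by rewrite (lt_trans h h').
- by rewrite -h1' h.
- by rewrite h1 h'.
- by rewrite h1 h1' eqxx (ltn_trans h2 h2') orbT.
Qed.

Lemma plt_succ w p : plt p (succ w p).
Proof.
by rewrite /plt /succ; case: ifP => _ /=; rewrite ?eqxx ?ltnSn ?orbT // ltrDl ltr01.
Qed.

Lemma plt_iter w p n : plt p (iter n.+1 (succ w) p).
Proof.
elim: n => [|n IH]; first exact: plt_succ.
by apply: plt_trans IH _; rewrite [iter n.+2 _ _]iterS; exact: plt_succ.
Qed.

Lemma iter_succ_neq w p n : iter n.+1 (succ w) p <> p.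
Proof.
by move=> e; have := plt_iter w p n; rewrite e /plt ltxx ltnn andbF.
Qed.

Lemma iter_succ_block w m j : (j < sz (w m))%N -> iter j (succ w) (m, 0%N) = (m, j).
Proof.
elim: j => //= j IH jlt; rewrite IH; first by rewrite /succ /= jlt.
exact: ltnW.
Qed.

Lemma iter_succ_sz w m : iter (sz (w m)) (succ w) (m, 0%N) = (m + 1, 0%N).
Proof. by rewrite /sz iterS iter_succ_block // /succ /= ltnn. Qed.

Lemma succ_tr w m p : succ w (tr m p) = tr m (succ (sh m w) p).
Proof. by rewrite /succ /tr /sh /=; case: ifP => _ //=; rewrite addrA. Qed.

Lemma iter_succ_tr w m p n :
  iter n (succ w) (tr m p) = tr m (iter n (succ (sh m w)) p).
Proof. by elim: n => //= n ->; rewrite succ_tr. Qed.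

Lemma lbl_tr w m p : lbl w (tr m p) = lbl (sh m w) p. Proof. by []. Qed.

Lemma rd_tr w m p : rd w (tr m p) = rd (sh m w) p.
Proof. by apply/funext => i; rewrite /rd iter_succ_tr lbl_tr. Qed.

Lemma rdD w p m : rd w (iter m (succ w) p) = fun i => rd w p (m + i)%N.
Proof. by apply/funext => i; rewrite /rd -iterD addnC. Qed.

Definition match_at w k n p := matched k n (fun i => (rd w p i).1).

(* [p] closes the parenthesis [x.2] opened at the start of block [x.1]. *)
Definition closes w (x : int * K) p :=
  exists2 n, p = iter n (succ w) (x.1, 0%N) & match_at w x.2 n (x.1, 0%N).

Lemma rd0 w m : (rd w (m, 0%N) 0).1 = k0. Proof. by []. Qed.

Lemma closes_valid w x p : closes w x p -> valid w p.
Proof. by move=> [n -> _]; exact: iter_succ_valid. Qed.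

Lemma closes_fun w x p p' : closes w x p -> closes w x p' -> p = p'.
Proof. by move=> [n -> h] [n' -> h']; rewrite (matched_uniq h h'). Qed.

Lemma closes_lbl w x p : closes w x p -> (lbl w p).1 = x.2.
Proof.
move=> [n -> h]; exact: (matched_last (X := fun i => (rd w (x.1, 0%N) i).1) _ h).
Qed.

(** The letter at [p] gives the kind of the parenthesis, and two of the same kind cannot close
    together by [matched_overlap]. *)
Lemma closes_inj w x x' p : closes w x p -> closes w x' p -> x = x'.
Proof.
move=> h h'; have := closes_lbl h; rewrite (closes_lbl h') => e2.
case: h h' => n -> h [n' e h'].
(* Having fewer steps to go, the opening of [x] lies on the way from that of [x'] to [p]. *)
wlog nn : x x' n n' h h' e e2 / (n <= n')%N.
  move=> H; case: (leqP n n') => nn; first exact: (H _ _ _ _ h h').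
  by apply/esym/(H _ _ _ _ h' h) => //; exact: ltnW.
move: e; rewrite -{1}(subnKC nn) iterD => /iter_succ_inj.
move=> /(_ (valid0 _ _) (iter_succ_valid _ (valid0 _ _))) e.
have : (n' - n)%N = 0%N.
  apply: (@matched_overlap x'.2 _ n (fun i => (rd w (x'.1, 0%N) i).1)).
    by rewrite subnK.
  by move: h; rewrite /match_at e rdD e2.
by move: e => /[swap] -> /= [e1]; rewrite [x]surjective_pairing [x']surjective_pairing e1 e2.
Qed.

Lemma closes_tr w m x p : closes w (tr m x) (tr m p) <-> closes (sh m w) x p.
Proof.
rewrite /closes /match_at; have -> : ((tr m x).1, 0%N) = tr m (x.1, 0%N) by [].
rewrite rd_tr; split=> -[n e h]; exists n => //.
  move: e; rewrite iter_succ_tr => -[/addrI e1 e2].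
  by rewrite [p]surjective_pairing e1 e2 -surjective_pairing.
by rewrite e iter_succ_tr.
Qed.

Definition good w := (forall x, exists p, closes w x p) /\
  (forall p, valid w p -> exists x, closes w x p).

Lemma trK A m : cancel (@tr A m) (@tr A (- m)).
Proof. by case=> n j; rewrite /tr /= addKr. Qed.
Lemma trNK A m : cancel (@tr A (- m)) (@tr A m).
Proof. by case=> n j; rewrite /tr /= addrA subrr add0r. Qed.

Lemma shD m n w : sh m (sh n w) = sh (n + m) w.
Proof. by apply/funext => i; rewrite /sh addrA. Qed.

Lemma sh0 w : sh 0 w = w. Proof. by apply/funext => i; rewrite /sh add0r. Qed.

Lemma good_shW w m : good w -> good (sh m w).
Proof.
move=> [g1 g2]; split => [x|p v].
  have [p] := g1 (tr m x); rewrite -(trNK m p) => /closes_tr; by exists (tr (- m) p).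
have [x] := g2 (tr m p) v; rewrite -(trNK m x) => /closes_tr; by exists (tr (- m) x).
Qed.

Lemma good_sh w m : good (sh m w) <-> good w.
Proof.
split; last exact: good_shW.
by move=> /(good_shW (- m)); rewrite shD subrr sh0.
Qed.

(* The successor of positions, transported by [closes].  On the null set of bad lines
   any bijection that commutes with the shift and has no periodic point would do. *)
Definition T w (x : int * K) : int * K :=
  if `[< good w >] then xget x [set y | exists2 p, closes w x p & closes w y (succ w p)]
  else (x.1 + 1, x.2).
Definition Tinv w (x : int * K) : int * K :=
  if `[< good w >] then xget x [set y | exists2 p, closes w y p & closes w x (succ w p)]
  else (x.1 - 1, x.2).

Lemma T_good w x y p : good w -> closes w x p -> closes w y (succ w p) -> T w x = y.
Proof.
move=> g hx hy; rewrite /T asboolT //; case: xgetP => [z _ [p' hx' hz]|h].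
  by apply: (closes_inj hz); rewrite (closes_fun hx' hx).
by case: (h y); exists p.
Qed.

Lemma Tinv_good w x y p : good w -> closes w y p -> closes w x (succ w p) -> Tinv w x = y.
Proof.
move=> g hx hy; rewrite /Tinv asboolT //; case: xgetP => [z _ [p' hx' hz]|h].
  apply: (closes_inj hx'); suff -> : p' = p by [].
  by apply: (succ_inj (closes_valid hx') (closes_valid hx)); exact: closes_fun hz hy.
by case: (h y); exists p.
Qed.

Lemma T_bad w x : ~ good w -> T w x = (x.1 + 1, x.2).
Proof. by move=> g; rewrite /T asboolF. Qed.
Lemma Tinv_bad w x : ~ good w -> Tinv w x = (x.1 - 1, x.2).
Proof. by move=> g; rewrite /Tinv asboolF. Qed.

Lemma TK w : cancel (T w) (Tinv w).
Proof.
move=> x; have [g|g] := pselect (good w).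
  have [p hx] := g.1 x; have [y hy] := g.2 _ (succ_valid w p).
  by rewrite (T_good g hx hy) (Tinv_good g hx hy).
by rewrite T_bad // Tinv_bad // addrK -surjective_pairing.
Qed.

Lemma TinvK w : cancel (Tinv w) (T w).
Proof.
move=> x; have [g|g] := pselect (good w).
  have [p hx] := g.1 x; have [y hy] := g.2 _ (pred_valid (closes_valid hx)).
  have hx' := hx; rewrite -(predK (closes_valid hx)) in hx'.
  by rewrite (Tinv_good g hy hx') (T_good g hy hx').
by rewrite Tinv_bad // T_bad // subrK -surjective_pairing.
Qed.

Lemma T_tr w m x : T w (tr m x) = tr m (T (sh m w) x).
Proof.
have [g|g] := pselect (good w); last first.
  rewrite T_bad // T_bad; last by move/good_sh.
  by rewrite /tr /= addrA.
have g' : good (sh m w) by apply/good_sh.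
have [p hx] := g'.1 x; have [y hy] := g'.2 _ (succ_valid (sh m w) p).
rewrite (T_good g' hx hy).
by apply: (T_good g (p := tr m p)); rewrite ?succ_tr; exact/closes_tr.
Qed.

Lemma iterT_good w x p n y : good w -> closes w x p -> closes w y (iter n (succ w) p) ->
  iter n (T w) x = y.
Proof.
move=> g; elim: n y => [|n IH] y hx; first exact: closes_inj hx.
have [z hz] := g.2 _ (iter_succ_valid n (closes_valid hx)).
by move=> hy; rewrite iterS (IH _ hx hz); exact: T_good hy.
Qed.

Lemma iterT_closes w x p n : good w -> closes w x p -> closes w (iter n (T w) x) (iter n (succ w) p).
Proof.
move=> g hx; have [z hz] := g.2 _ (iter_succ_valid n (closes_valid hx)).
by rewrite (iterT_good g hx hz).
Qed.

(** On good lines [T] is conjugate to [succ], and on bad ones it increases the block index. Both are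
    needed because [locality] is stated for every [w]. *)
Lemma iterT_neq w x n : iter n.+1 (T w) x <> x.
Proof.
have [g|g] := pselect (good w) => e.
  have [p hx] := g.1 x; have := iterT_closes n.+1 g hx; rewrite e => h.
  exact: (iter_succ_neq (closes_fun h hx)).
have H m : iter m (T w) x = (x.1 + m%:Z, x.2).
  elim: m => [|m IH]; first by rewrite addr0 -surjective_pairing.
  by rewrite iterS IH T_bad //= -addrA -PoszD addn1.
by move: e; rewrite H => /(congr1 fst) /= /eqP; rewrite -subr_eq0 addrC addKr.
Qed.

(** The walk of kind [k0] never moves, so a block start closes its own parenthesis of kind [k0].
    States [(w, k0)] therefore read from a block start. *)
Lemma closes00 w m : closes w (m, k0) (m, 0%N).
Proof.
exists 0%N => //; split => //.
by rewrite psumS /psum big_ord0 add0r sgnk0r.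
Qed.

(** A letter with [k0] inside a block would close a parenthesis of kind [k0], but those close at
    block starts. *)
Lemma good_rest w m : good w -> all (fun c => c.1 != k0) (w m).2.
Proof.
move=> g; apply/(all_nthP (k0, (w m).1)) => j jlt; apply/eqP => e.
have [x hx] := g.2 (m, j.+1) jlt.
have := closes_lbl hx; rewrite /lbl /lab /= e => xk0.
case: hx => n + h; move: h; rewrite /match_at -xk0 => /matchedk0 -> //.
Qed.

End Line.

(** * Measurability of the matching *)

Section MeasurableMatching.
Context d (T : measurableType d) (K : finType) (k0 k : K) (X : T -> nat -> K).
Hypothesis mX : forall i, cmeasurable (fun t => X t i).

Lemma cmeasurable_psum i : cmeasurable (fun t => psum k0 k (X t) i).
Proof.
elim: i => [|i IH].
  rewrite (_ : (fun t => _) = fun=> 0); first exact: cmeasurable_cst.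
  by apply/funext => t; rewrite /psum big_ord0.
rewrite (_ : (fun t => _) = fun t => psum k0 k (X t) i + sgn k0 k (X t i)); last first.
  by apply/funext => t; rewrite psumS.
apply: (cmeasurable_bind (g := fun s t => s + sgn k0 k (X t i)) IH) => s.
exact: (cmeasurable_comp (fun c => s + sgn k0 k c) (mX i)).
Qed.

Lemma measurable_matched n : measurable [set t | matched k0 k n (X t)].
Proof.
apply: measurable_set_and; first exact: cmeasurable_psum.
apply: measurable_set_forall => i; apply: measurable_set_imp => _.
exact: (cmeasurable_pre (fun s : int => 0 < s) (cmeasurable_psum i.+1)).
Qed.

End MeasurableMatching.

(** * The states and the map Theta *)

Section Free.
Variable n : nat.
Implicit Types (l m : letter n) (g h : free_group n).

Lemma letter_inv_neq l : letter_inv l != l.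
Proof. by case: l => i []; rewrite /letter_inv xpair_eqE andbF. Qed.

Lemma word_mul_cat (v w : seq (letter n)) : reduced (v ++ w) -> word_mul v w = v ++ w.
Proof.
elim: v => //= l v IH rw; rewrite IH ?push_id //; exact: path_sorted rw.
Qed.

Lemma wordM g h : word (g * h)%g = word_mul (word g) (word h). Proof. by []. Qed.

Definition gl l : free_group n := @FreeGroup n [:: l] isT.

Lemma word_glM l g : word (gl l * g)%g = push l (word g). Proof. by []. Qed.

Lemma gl_inv l : gl (letter_inv l) = (gl l)^-1%g.
Proof.
by rewrite -[LHS]mulg1 -(mulgV (gl l)) mulgA (_ : (gl _ * gl l)%g = 1%g) ?mul1g //;
  apply/val_inj; rewrite /= letter_invK eqxx.
Qed.

Definition starts l g := ohead (word g) == Some l.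

(** The ping-pong rule used for all statements about what lies behind an edge: either [l] cancels,
    and then by reducedness the next letter is not [l], or it is put in front. *)
Lemma starts_gl l g : starts l (gl l * g)%g = ~~ starts (letter_inv l) g.
Proof.
rewrite /starts word_glM; case: g => -[|m w] rw /=; first exact: eqxx.
rewrite [Some m == _](_ : _ = (m == letter_inv l)) //; case: (m =P letter_inv l) => [e|_]; last exact: eqxx.
case: w rw => //= m' w /andP[+ _]; rewrite e letter_invK.
by rewrite [Some _ == _](_ : _ = (m' == l)) // => /negbTE ->.
Qed.

Lemma starts_uniq l l' g : starts l g -> starts l' g -> l = l'.
Proof. by rewrite /starts => /eqP -> /eqP[]. Qed.

Section Act.
Variables (V : Type) (a : letter n -> V -> V).
Hypothesis aK : forall l, cancel (a l) (a (letter_inv l)).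

(* The letters of a word act from left to right: this is a right action. *)
Definition act_seq (u : seq (letter n)) v := foldl (fun v l => a l v) v u.
Definition act g := act_seq (word g).

Lemma act_push l u v : act_seq (push l u) v = act_seq u (a l v).
Proof. by case: u => //= m u; case: eqP => //= ->; rewrite aK. Qed.

Lemma actM g h v : act (g * h)%g v = act h (act g v).
Proof.
rewrite /act wordM; elim: (word g) v => //= l u IH v.
by rewrite act_push IH.
Qed.

Lemma act1 v : act 1%g v = v. Proof. by []. Qed.
Lemma act_gl l v : act (gl l) v = a l v. Proof. by []. Qed.
Lemma actX l i v : act (gl l ^+ i)%g v = iter i (a l) v.
Proof. by elim: i => // i IH; rewrite expgSr actM IH. Qed.
Lemma actK g v : act g^-1%g (act g v) = v.
Proof. by rewrite -actM mulgV. Qed.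

End Act.

End Free.

Section State.
Variables (K : finType) (k0 : K).
Local Notation block := (K * seq (K * K))%type.
Local Notation F := (free_group #|K|.+1).
Local Notation W := (pow_space F block).
Local Notation V := (W * K)%type.
Implicit Types (w : W) (v : V) (k : K).

(** The inverse makes the shift a right action, in step with [act]: the origin of [w] moves to
    [g]. *)
Definition rmove (g : F) w : W := shift_action F block g^-1%g w.

Lemma rmoveE g w f : rmove g w f = w (g * f)%g.
Proof. by rewrite /rmove /shift_action invgK. Qed.
Lemma rmoveM g h w : rmove (g * h)%g w = rmove h (rmove g w).
Proof. by apply/funext => f; rewrite !rmoveE mulgA. Qed.
Lemma rmove1 w : rmove 1%g w = w.
Proof. by apply/funext => f; rewrite rmoveE mul1g. Qed.

(* [al] and [bl k] are the letters alpha and beta_k of [F], and [la] and [lb] below are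
   the letters of [F2]; the boolean is the sign of the exponent. *)
Definition al (e : bool) : letter #|K|.+1 := (ord0, e).
Definition bl k (e : bool) : letter #|K|.+1 := (lift ord0 (enum_rank k), e).

Lemma bl_inv k e : letter_inv (bl k e) = bl k (~~ e). Proof. by []. Qed.
Lemma bl_inj k e k' e' : bl k e = bl k' e' -> k = k' /\ e = e'.
Proof.
move=> h; split; last exact: (congr1 snd h).
by apply/enum_rank_inj/(@lift_inj _ ord0); exact: (congr1 fst h).
Qed.

Definition az (m : int) : F :=
  match m with Posz n => (gl (al true) ^+ n)%g | Negz n => (gl (al false) ^+ n.+1)%g end.

Lemma azS (m : int) : az (m + 1) = (az m * gl (al true))%g.
Proof.
case: m => n; first by rewrite -PoszD addn1 /= expgSr.
rewrite NegzE; have -> : - n.+1%:Z + 1 = - n%:Z by lia.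
rewrite -NegzE [az (Negz n)]/= expgSr -mulgA (_ : (gl (al false) * _)%g = 1%g) ?mulg1; last exact: val_inj.
by case: n => // n; rewrite -NegzE.
Qed.

Lemma azD (m n : int) : az (m + n) = (az m * az n)%g.
Proof.
elim/int_rec: n => [|n IH|n IH]; first by rewrite addr0 mulg1.
  have [-> ->] : m + n.+1%:Z = m + n%:Z + 1 /\ n.+1%:Z = n%:Z + 1 by lia.
  by rewrite !azS IH mulgA.
apply: (mulIg (gl (al true))); rewrite -azS -mulgA -azS.
have [-> ->] : m - n.+1%:Z + 1 = m - n%:Z /\ - n.+1%:Z + 1 = - n%:Z by lia.
by [].
Qed.

Lemma starts_az (m : int) g : m != 0 -> (forall e, ~~ starts (al e) g) ->
  exists e, starts (al e) (az m * g)%g.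
Proof.
move=> m0 hg; have H e' n : starts (al e') (gl (al e') ^+ n.+1 * g)%g.
  elim: n => [|n IH]; first by rewrite expg1 starts_gl hg.
  rewrite expgS -mulgA starts_gl; apply: contraL IH => h.
  by apply/negP => /(starts_uniq h)/eqP; apply/negP; exact: letter_inv_neq.
by case: m m0 => [[//|n]|n] _; [exists true|exists false]; exact: H.
Qed.

Lemma az_nostart (m : int) k e : ~~ starts (bl k e) (az m).
Proof.
have [->//|m0] := eqVneq m 0.
have [|e' h] := starts_az (g := 1%g) m0; first by [].
by rewrite mulg1 in h; apply/negP => /(starts_uniq h).
Qed.

Definition line w : int -> block := fun m => w (az m).

Lemma line_rmove w m : line (rmove (az m) w) = sh m (line w).
Proof. by apply/funext => i; rewrite /line rmoveE -azD. Qed.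

Definition Tl (e : bool) := if e then T k0 else Tinv k0.

Lemma Tl_cancel e l : cancel (Tl e l) (Tl (~~ e) l).
Proof. by case: e; [exact: TK|exact: TinvK]. Qed.

Lemma Tl_tr e l m x : Tl e l (tr m x) = tr m (Tl e (sh m l) x).
Proof.
case: e; first exact: T_tr.
by apply: (can_inj (@TK _ k0 l)); rewrite /= TinvK T_tr TinvK.
Qed.

Lemma iter_Tl_neq e l n x : iter n.+1 (Tl e l) x <> x.
Proof.
case: e; first exact: iterT_neq.
move=> h; apply: (@iterT_neq _ k0 l x n); rewrite -{1}h /=.
have : forall j y, iter j (T k0 l) (iter j (Tinv k0 l) y) = y.
  by elim=> // j IH y; rewrite iterSr iterS TinvK IH.
move=> H; have := H n.+1 x; by rewrite !iterS.
Qed.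

(** The state [(w, k)] is the pair formed by block start 0 of the line of [w] and [k]. Once it is
    moved to [(m, k')], the origin is brought to alpha^m. *)
Definition stp_a e v : V :=
  let y := Tl e (line v.1) (0, v.2) in (rmove (az y.1) v.1, y.2).

Lemma stp_aE e w m k :
  stp_a e (rmove (az m) w, k) = let y := Tl e (line w) (m, k) in (rmove (az y.1) w, y.2).
Proof.
rewrite /stp_a line_rmove /=; have -> : (m, k) = tr m (0, k) by rewrite /tr /= addr0.
by rewrite Tl_tr /= azD rmoveM.
Qed.

Lemma iter_stp_a e n w k :
  iter n (stp_a e) (w, k) =
  let y := iter n (Tl e (line w)) (0, k) in (rmove (az y.1) w, y.2).
Proof.
elim: n => [|n IH]; first by rewrite /= rmove1.
by rewrite iterS IH /= stp_aE -surjective_pairing.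
Qed.

Definition stp (l : letter 2) v : V :=
  if l.1 == ord0 then stp_a l.2 v else (rmove (gl (bl v.2 l.2)) v.1, v.2).

Lemma stpK l : cancel (stp l) (stp (letter_inv l)).
Proof.
case: l => i e [w k]; rewrite /stp /=; case: (i == ord0).
  by rewrite [stp_a e _]/stp_a /= stp_aE /= -surjective_pairing Tl_cancel /= rmove1.
by rewrite /= -rmoveM -bl_inv gl_inv mulgV rmove1.
Qed.

(* By [closes_lbl] the letter closing [(0, v.2)] has first coordinate [v.2]; the default
   [(0, 0)] only matters on bad lines. *)
Definition obs v : K * K :=
  (v.2, (lbl k0 (line v.1) (xget (0, 0%N) [set p | closes k0 (line v.1) (0, v.2) p])).2).

Definition Theta v : pow_space (free_group 2) (K * K) := fun g => obs (act stp g v).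

Lemma Theta_act h v :
  Theta (act stp h v) = shift_action (free_group 2) (K * K) h^-1%g (Theta v).
Proof.
by apply/funext => g; rewrite /shift_action invgK /Theta (actM stpK).
Qed.

Lemma iter_stp_aK m v : iter m (stp_a true) (iter m (stp_a false) v) = v.
Proof.
elim: m v => // m IH v; rewrite iterSr iterS -[RHS]IH; congr (iter m _ _).
exact: (stpK (ord0, false)).
Qed.

Lemma obs_line w w' k : line w = line w' -> obs (w, k) = obs (w', k).
Proof. by move=> e; rewrite /obs /= e. Qed.

Definition la e : letter 2 := (ord0, e).
Definition lb e : letter 2 := (ord_max, e).

Lemma letter2P (l : letter 2) : (exists e, l = la e) \/ (exists e, l = lb e).
Proof.
case: l => i e; case: (unliftP ord0 i) => [j|] ->; [right|left]; exists e => //.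
by rewrite (ord1 j); congr pair; exact: val_inj.
Qed.

(* The state from which [u] is read is reached from [(w, k)] by [c] steps along its line.
   The orbit of a state of the line never returns to it, so that [u] does not cross the
   edge beta_k^e at the origin, and sees nothing of [w] behind it. *)
Lemma locality (u : seq (letter 2)) : reduced u ->
  forall w w' k e x c d,
    (forall f, ~~ starts (bl k e) f -> w f = w' f) ->
    x = iter c (Tl d (line w)) (0, k) ->
    (c = 0%N -> ohead u != Some (lb e)) ->
    (c <> 0%N -> ohead u != Some (la (~~ d))) ->
    obs (act_seq stp u (rmove (az x.1) w, x.2)) = obs (act_seq stp u (rmove (az x.1) w', x.2)).
Proof.
elim: u => [_|l u IH ru] w w' k e x c d ww' xE c0 c1.
  apply: obs_line; rewrite !line_rmove; congr sh.
  by apply/funext => m; apply: ww'; exact: az_nostart.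
have ll' : line w = line w' by apply/funext => m; apply: ww'; exact: az_nostart.
have ru' : reduced u by exact: path_sorted ru.
have hu : ohead u != Some (letter_inv l).
  by move: ru; case: (u) => //= m u' /andP[].
case: (letter2P l) => -[e' lE]; subst l.
  rewrite /= /stp /= !stp_aE -ll' /=.
  have e'd : c <> 0%N -> e' = d.
    by move=> /c1; case: (e') (d) => -[].
  apply: (IH ru' _ _ _ _ _ c.+1 e' ww') => //.
  rewrite -surjective_pairing iterS xE; case: (c =P 0%N) => [->//|/e'd -> //].
rewrite /= /stp /= -!rmoveM.
(* The edge just crossed becomes the forbidden one, with c = 0: the word is reduced, so [u] does not
   begin by crossing it back. *)
have := IH ru' (rmove (az x.1 * gl (bl x.2 e'))%g w) (rmove (az x.1 * gl (bl x.2 e'))%g w')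
  x.2 (~~ e') (0, x.2) 0%N true _ erefl.
rewrite /= !rmove1; apply => //.
move=> f; rewrite -bl_inv -starts_gl !rmoveE -mulgA => hf; apply: ww'.
move: hf; set h := (gl _ * f)%g => hf.
(* What lies behind the new edge is not behind the forbidden one. Away from the origin it starts
   with a power of alpha; at the origin the edges could coincide only if x = (0, k), which
   [iter_Tl_neq] excludes for c > 0 and the hypothesis on the first letter excludes for c = 0. *)
have [x0|x0] := eqVneq x.1 0.
  rewrite x0 mul1g; apply/negP => /(starts_uniq hf)/bl_inj[kk ee].
  case: (c =P 0%N) => [/c0|cn0]; first by rewrite ee eqxx.
  have : x = (0, k) by rewrite [x]surjective_pairing x0 kk.
  by rewrite xE; case: (c) cn0 => // c' _; exact: iter_Tl_neq.
have [|d' hd] := starts_az (g := h) x0.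
  by move=> d'; apply/negP => /(starts_uniq hf).
by apply/negP => /(starts_uniq hd).
Qed.

Lemma Theta_local g w w' k e : ~~ starts (lb e) g ->
  (forall f, ~~ starts (bl k e) f -> w f = w' f) ->
  Theta (w, k) g = Theta (w', k) g.
Proof.
move=> hg ww'; have := @locality (word g) (word_reduced g) w w' k e (0, k) 0%N true ww'.
by rewrite /= !rmove1; apply.
Qed.

End State.

(** * Events that agree outside a null set *)

Section Null.
Context d (T : measurableType d) (R : realType) (mu : probability T R).

Lemma measure_eq_mod_null (N A B : set T) : measurable N -> measurable A -> measurable B ->
  mu N = 0%E -> (forall x, ~ N x -> A x <-> B x) -> mu A = mu B.
Proof.
move=> mN mA mB N0 AB.
have H (C : set T) : measurable C -> mu C = mu (C `\` N).
  move=> mC; apply/eqP; rewrite eq_le; apply/andP; split; last first.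
    by apply: le_measure; rewrite ?inE; [exact: measurableD|exact: mC|exact: subDsetl].
  rewrite -[X in (X <= _)%E](_ : mu (C `&` N `|` C `\` N) = _); last first.
    by rewrite setUIDK.
  apply: (le_trans (measureU2 _ _ _)); [exact: measurableI|exact: measurableD|].
  have CN0 : mu (C `&` N) = 0%E.
    apply: (subset_measure0 (measurableI _ _ mC mN) mN _ N0); exact: subIsetr.
  by rewrite -[leRHS]add0e; apply: leeD => //; rewrite le_eqVlt; apply/orP; left; apply/eqP.
rewrite (H _ mA) (H _ mB); congr (mu _).
by apply/seteqP; split=> x [+ Nx]; move=> /(AB x Nx).
Qed.

End Null.

(** * The law of a block *)

Definition block (K : finType) (K_gt1 : (1 < #|K|)%N) : Type := (K * seq (K * K))%type.

Section BlockType.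
Context (K : finType) (K_gt1 : (1 < #|K|)%N).
Local Notation block := (block K_gt1).

HB.instance Definition _ := Countable.copy block (K * seq (K * K))%type.
HB.instance Definition _ := isPointed.Build block
  (enum_val (Ordinal (ltnW K_gt1)), [::]).
HB.instance Definition _ := @isMeasurable.Build default_measure_display block
  discrete_measurable discrete_measurable0
  discrete_measurableC discrete_measurableU.
End BlockType.

Section BlockLaw.
Context (R : realType) (K : finType) (K_gt1 : (1 < #|K|)%N) (k0 : K).
Local Notation kap := (uniform_measure K_gt1 R).
Local Notation D := (discrete_space K_gt1).
Local Notation q := (#|K|%:R : R).
Local Notation L := (block K_gt1).
Local Notation e := (#|K|%:R^-1 : R).

Definition kap2 : probability (D * D)%type R := (kap \x kap)%E.

Lemma kap2E (A B : set D) : kap2 (A `*` B) = (kap A * kap B)%E.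
Proof. exact: product_measure1E. Qed.

Lemma measurableDD (A : set (D * D)) : measurable A.
Proof.
rewrite (_ : A = \bigcup_(c : D * D) (if `[< A c >] then [set c.1] `*` [set c.2] else set0)).
  by apply: countable_bigcupT_measurable => [|c]; [exact: countableP|case: ifP => // _; exact: measurableX].
apply/seteqP; split=> c.
  by move=> Ac; exists c => //; rewrite asboolT.
by case=> -[a b] _; case: asboolP => // h [/= c1 c2]; rewrite [c]surjective_pairing c1 c2.
Qed.

Lemma kap2_snd (y : D) : kap2 [set c | c.2 = y] = e%:E.
Proof.
rewrite (_ : [set c | _] = setT `*` [set y]); last by apply/seteqP; split=> c //= [].
by rewrite kap2E probability_setT mul1e uniform1.
Qed.

Lemma kap2_fst (y : D) : kap2 [set c | c.1 = y] = e%:E.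
Proof.
rewrite (_ : [set c | _] = [set y] `*` setT); last by apply/seteqP; split=> c //= [].
by rewrite kap2E probability_setT mule1 uniform1.
Qed.

Lemma kap2_fstN (y : D) : kap2 [set c | c.1 <> y] = (1 - e)%:E.
Proof.
rewrite (_ : [set c | _] = ~` [set c : D * D | c.1 = y]) //.
by rewrite probability_setC ?kap2_fst //; exact: measurableDD.
Qed.

Lemma kap2_1 (c : D * D) : kap2 [set c] = (e ^+ 2)%:E.
Proof.
rewrite (_ : [set c] = [set c.1] `*` [set c.2]) ?kap2E ?uniform1 //.
apply/seteqP; split=> x; first by move=> ->.
by case: x => a b [/= -> ->]; rewrite -surjective_pairing.
Qed.

Context (P0 : probability (pow_space nat (D * D)) R) (hP0 : is_pow_measure kap2 P0).

Lemma prod_fset_iota (f : nat -> \bar R) n :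
  (\prod_(i <- [fset i | i in iota 0 n]%fset) f i = \prod_(i < n) f i)%E.
Proof.
rewrite big_imfset //= undup_id ?iota_uniq // -(big_mkord xpredT f).
by rewrite /index_iota subn0.
Qed.

Lemma iid_prefix n (B : nat -> set (D * D)) :
  P0 [set x | forall i, (i < n)%N -> B i (x i)] = (\prod_(i < n) kap2 (B i))%E.
Proof.
have := hP0 [fset i | i in iota 0 n]%fset (B := B) (fun i => measurableDD _).
rewrite prod_fset_iota => <-.
congr (P0 _); apply/seteqP; split=> x h i.
  by move=> /imfsetP[j /= + ->]; rewrite mem_iota => /h.
by move=> iN; apply: h; apply/imfsetP; exists i => //=; rewrite mem_iota.
Qed.

Lemma measurable_iid n (B : nat -> set (D * D)) :
  measurable [set x : pow_space nat (D * D) | forall i, (i < n)%N -> B i (x i)].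
Proof.
apply: measurable_set_forall => i.
apply: measurable_set_imp => _.
by have := measurable_pow_proj i measurableT (measurableDD (B i)); rewrite setTI.
Qed.

(** Letter 0 opens the block and is skipped, so that [n] counts the letters following it in the
    block. *)
Definition hit (x : pow_space nat (D * D)) n :=
  (x n.+1).1 = k0 /\ forall i, (i < n)%N -> (x i.+1).1 <> k0.

(* The first coordinate of [x 0] is ignored: the first letter of a block has [k0]. *)
Definition first_block (x : pow_space nat (D * D)) : L :=
  ((x 0%N).2, mkseq (fun i => x i.+1) (xget 0%N (hit x))).

Lemma hit_uniq x n n' : hit x n -> hit x n' -> n = n'.
Proof. by move=> [h1 h2] [h1' h2']; case: (ltngtP n n') => // [/h2'|/h2]. Qed.

Lemma xget_hit x n : hit x n -> xget 0%N (hit x) = n.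
Proof. by move=> h; case: xgetP => [m _ hm|/(_ n)//]; exact: hit_uniq hm h. Qed.

Lemma xget_hitP x n : (n < xget 0%N (hit x))%N -> (x n.+1).1 <> k0.
Proof. by case: xgetP => // m -> [_ h] /h. Qed.

Lemma first_block_rest x : all (fun c => c.1 != k0) (first_block x).2.
Proof.
apply/allP => c /mapP[i]; rewrite mem_iota add0n /= => /xget_hitP h ->.
by apply/eqP.
Qed.

Definition nohit : set (pow_space nat (D * D)) := [set x | forall n, ~ hit x n].

Lemma nohitP x : nohit x -> forall i, (x i.+1).1 <> k0.
Proof.
move=> h; apply: contrapT => /existsNP[i /contrapT hi].
have ex : exists i, (x i.+1).1 == k0 by exists i; apply/eqP.
apply: (h (ex_minn ex)); case: ex_minnP => m /eqP mk mmin; split=> // j jm /eqP/mmin.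
by rewrite leqNgt jm.
Qed.

Lemma measurable_proj (i : nat) (B : set (D * D)) :
  measurable [set x : pow_space nat (D * D) | B (x i)].
Proof. by have := measurable_pow_proj i measurableT (measurableDD B); rewrite setTI. Qed.

Lemma measurable_hit n : measurable [set x | hit x n].
Proof.
rewrite /hit; apply: measurable_set_and; first exact: (measurable_proj _ [set c | c.1 = k0]).
apply: measurable_set_forall => i.
apply: measurable_set_imp => _; exact: (measurable_proj _ [set c | c.1 <> k0]).
Qed.

Lemma measurable_nohit : measurable nohit.
Proof.
apply: measurable_set_forall => n.
by apply: measurable_set_not; exact: measurable_hit.
Qed.

Lemma e_gt0 : 0 < e. Proof. by rewrite invr_gt0; exact: qgt0. Qed.
Lemma e_lt1 : e < 1.
Proof. by rewrite invf_lt1 ?ltr1n //; exact: qgt0. Qed.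

Lemma iid_nohit n : P0 [set x | forall i, (i < n)%N -> (x i.+1).1 <> k0] = ((1 - e) ^+ n)%:E.
Proof.
pose B i : set (D * D) := if i is i'.+1 then [set c | c.1 <> k0] else setT.
rewrite (_ : [set x | _] = [set x | forall i, (i < n.+1)%N -> B i (x i)]); last first.
  apply/seteqP; split=> x h i; first by case: i => // i; rewrite ltnS => /h.
  by move=> iN; have := h i.+1 iN.
rewrite iid_prefix big_ord_recl probability_setT mul1e.
rewrite (eq_bigr (fun=> (1 - e)%:E)); last by move=> i _; rewrite kap2_fstN.
rewrite big_const_ord; elim: n => //= n ->.
by rewrite -EFinM exprS.
Qed.

Lemma nohit0 : P0 nohit = 0%E.
Proof.
have e0 := e_gt0; have e1 := e_lt1.
apply/eqP; rewrite eq_le measure_ge0 andbT; apply/lee_addgt0Pr => eps eps0.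
have : (fun n => (1 - e) ^+ n) @ \oo --> (0 : R).
  by apply: cvg_expr; rewrite ger0_norm; lra.
move=> /cvgrPdist_lt /(_ eps eps0) [n _ /(_ n (leqnn n))] /=.
rewrite sub0r normrN ger0_norm; last by apply: exprn_ge0; lra.
move=> h; rewrite add0e; apply: (@le_trans _ _ ((1 - e) ^+ n)%:E); last by rewrite lee_fin ltW.
rewrite -iid_nohit; apply: le_measure; rewrite ?inE.
- exact: measurable_nohit.
- apply: measurable_set_forall => i.
  apply: measurable_set_imp => _; exact: (measurable_proj _ [set c | c.1 <> k0]).
- by move=> x /nohitP h' i _; exact: h'.
Qed.

Lemma cmeasurable_first_block : cmeasurable first_block.
Proof.
move=> -[y v]; rewrite (_ : [set x | _] = [set x | (x 0%N).2 = y /\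
   mkseq (fun i => x i.+1) (xget 0%N (hit x)) = v]); last first.
  by apply/seteqP; split=> x; [case|move=> [<- <-]].
apply: measurable_set_and; first exact: (measurable_proj _ [set c | c.2 = y]).
have mhit : cmeasurable (fun x : pow_space nat (D * D) => xget 0%N (hit x)).
  move=> n.
  apply: (@measurable_set_ext _ _ (fun x => hit x n \/ n = 0%N /\ nohit x)).
    move=> x; split=> [[/xget_hit //|[-> h]]|].
      by case: xgetP => // m _ hm; case: (h m).
    case: xgetP => [m _ hm <-|h <-]; first by left.
    by right.
  apply: measurable_set_or; first exact: measurable_hit.
  apply: measurable_set_and; [exact: measurable_set_prop|exact: measurable_nohit].
apply: (cmeasurable_bind (g := fun n (x : pow_space nat (D * D)) => mkseq (fun i => x i.+1) n)
  mhit) => n.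
move=> s; apply: (@measurable_set_ext _ _ (fun x : pow_space nat (D * D) => size s = n /\
    forall i, (i < n)%N -> x i.+1 = nth (k0, k0) s i)).
  move=> x; split=> [[sn h]|<-].
    apply: (@eq_from_nth _ (k0, k0)); rewrite size_mkseq // => i iN.
    by rewrite nth_mkseq // h.
  by rewrite size_mkseq; split=> // i iN; rewrite nth_mkseq.
apply: measurable_set_and; first exact: measurable_set_prop.
apply: measurable_set_forall => i.
apply: measurable_set_imp => _; exact: (measurable_proj _ [set c | c = nth (k0, k0) s i]).
Qed.

Lemma measurable_first_block : measurable_fun setT first_block.
Proof. by move=> _ A _; rewrite setTI; exact: (cmeasurable_pre A cmeasurable_first_block). Qed.

Definition block_law : probability L R := prob_image P0 measurable_first_block.

Lemma prod_ite n (v : seq (D * D)) : size v = n ->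
  (\prod_(i < n) kap2 [set nth (k0, k0) v i])%E = (e ^+ (2 * n))%:E.
Proof.
move=> _; rewrite (eq_bigr (fun=> (e ^+ 2)%:E)); last by move=> i _; rewrite kap2_1.
rewrite big_const_ord mulnC; elim: n => [|n IH]; first by rewrite mul0n expr0.
by rewrite /= IH -EFinM -exprD.
Qed.

(** One factor [e] for [y], two for each letter of [v], and one for the coordinate [k0] of the
    letter that ends the block. *)
Lemma block_law_single y (v : seq (K * K)) : all (fun c => c.1 != k0) v ->
  block_law [set (y, v) : L] = (e ^+ (2 + 2 * size v))%:E.
Proof.
move=> vk; rewrite prob_imageE.
pose B i : set (D * D) := if i is i'.+1 then
  (if (i' < size v)%N then [set nth (k0, k0) v i'] else [set c | c.1 = k0])
  else [set c | c.2 = y].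
rewrite (measure_eq_mod_null (N := nohit) (B := [set x | forall i, (i < (size v).+2)%N -> B i (x i)])).
- rewrite iid_prefix big_ord_recl big_ord_recr /= ltnn kap2_snd kap2_fst.
  rewrite (eq_bigr (fun i : 'I_(size v) => kap2 [set nth (k0, k0) v i])).
    by rewrite prod_ite // -!EFinM; congr EFin; rewrite !exprD expr2; ring.
  by move=> i _; rewrite /B /= ltn_ord.
- exact: measurable_nohit.
- exact: (cmeasurable_first_block (y, v)).
- exact: measurable_iid.
- exact: nohit0.
- move=> x /existsNP[n /contrapT hn]; rewrite /= /first_block (xget_hit hn); split.
    move=> [y0 vE]; have sv : size v = n by rewrite -vE size_mkseq.
    move=> [_|i]; first exact: y0.
    rewrite !ltnS leq_eqVlt sv /B => /orP[/eqP ->|iN]; first by rewrite sv ltnn; case: hn.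
    by rewrite sv iN /= -vE nth_mkseq.
  move=> h; have y0 := h 0%N isT; have hv i : (i < size v)%N -> x i.+1 = nth (k0, k0) v i.
    by move=> iv; have := h i.+1 (ltnW iv); rewrite /B iv.
  have hs : (x (size v).+1).1 = k0 by have := h (size v).+1 (leqnn _); rewrite /B ltnn.
  have <- : size v = n.
    apply: (hit_uniq _ hn); split=> // i iv; rewrite hv //.
    by apply/eqP; exact: (all_nthP (k0, k0) vk).
  congr pair => //; apply: (@eq_from_nth _ (k0, k0)); rewrite size_mkseq // => i iv.
  by rewrite nth_mkseq // hv.
Qed.

(** Compared with [block_law_single], the factor for the end of the block is absent. *)
Lemma block_law_prefix y (v : seq (K * K)) : all (fun c => c.1 != k0) v ->
  block_law [set l : L | l.1 = y /\ prefix v l.2] = (e ^+ (1 + 2 * size v))%:E.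
Proof.
move=> vk; rewrite prob_imageE.
pose B i : set (D * D) := if i is i'.+1 then [set nth (k0, k0) v i']
  else [set c | c.2 = y].
rewrite (measure_eq_mod_null (N := nohit) (B := [set x | forall i, (i < (size v).+1)%N -> B i (x i)])).
- rewrite iid_prefix big_ord_recl /= kap2_snd prod_ite // -!EFinM; congr EFin.
  by rewrite exprD.
- exact: measurable_nohit.
- exact: (cmeasurable_pre (fun l : L => l.1 = y /\ prefix v l.2) cmeasurable_first_block).
- exact: measurable_iid.
- exact: nohit0.
- move=> x /existsNP[n /contrapT hn]; rewrite /= /first_block (xget_hit hn) /=; split.
    move=> [y0 pv] [_|i iv]; first exact: y0.
    rewrite /B /=.
    have {}iv : (i < size v)%N := iv; have iN : (i < n)%N.
      by rewrite (leq_trans iv) //; have /prefixP[s' /(congr1 size)] := pv; rewrite size_mkseq size_cat => ->; exact: leq_addr.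
    by have := pv; rewrite prefixE => /eqP <-; rewrite nth_take // nth_mkseq.
  move=> h; have y0 := h 0%N isT; have hv i : (i < size v)%N -> x i.+1 = nth (k0, k0) v i.
    by move=> iv; exact: h i.+1 iv.
  split=> //; have vn : (size v <= n)%N.
    rewrite leqNgt; apply/negP => /[dup] nv /hv xn; case: hn => + _; rewrite xn.
    by apply/eqP; exact: (all_nthP (k0, k0) vk).
  rewrite prefixE; apply/eqP; apply: (@eq_from_nth _ (k0, k0)).
    by rewrite size_takel // size_mkseq.
  rewrite size_takel ?size_mkseq // => i iv.
  by rewrite nth_take // nth_mkseq ?hv // (leq_trans iv).
Qed.

Lemma block_law_tail j : block_law [set l : L | (j <= size l.2)%N] = ((1 - e) ^+ j)%:E.
Proof.
rewrite prob_imageE -iid_nohit; apply: (measure_eq_mod_null (N := nohit)).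
- exact: measurable_nohit.
- exact: (cmeasurable_pre (fun l : L => (j <= size l.2)%N) cmeasurable_first_block).
- apply: measurable_set_forall => i.
  apply: measurable_set_imp => _; exact: (measurable_proj _ [set c | c.1 <> k0]).
- exact: nohit0.
- move=> x /existsNP[n /contrapT hn]; rewrite /= /first_block (xget_hit hn) /= size_mkseq; split.
    by move=> jn i ij; case: hn => _; apply; exact: leq_trans jn.
  by move=> h; rewrite leqNgt; apply/negP => /h; case: hn.
Qed.

Lemma block_law_rest : block_law [set l : L | ~~ all (fun c => c.1 != k0) l.2] = 0%E.
Proof.
rewrite prob_imageE (_ : _ @^-1` _ = set0) ?measure0 //.
by apply/seteqP; split=> x //=; rewrite first_block_rest.
Qed.

End BlockLaw.

(** * Almost every line is good *)

Section LineMore.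
Variables (K : finType) (k0 : K).
Local Notation block := (K * seq (K * K))%type.
Implicit Types (w : int -> block).

Lemma rdS w p i : rd k0 w p i.+1 = rd k0 w (succ w p) i.
Proof. by rewrite /rd iterSr. Qed.

Lemma rd_ge w w' m j : (forall m', m <= m' -> w m' = w' m') ->
  rd k0 w (m, j) = rd k0 w' (m, j).
Proof.
move=> ww'; apply/funext => i; suff [e h] :
    iter i (succ w) (m, j) = iter i (succ w') (m, j) /\ m <= (iter i (succ w) (m, j)).1.
  by rewrite /rd -e /lbl ww'.
elim: i => [//|i [e h]]; rewrite /= -e /succ ww' //; split=> //.
by case: ifP => _ //=; apply: le_trans h _; rewrite lerDl.
Qed.

Lemma az_inj : injective (@az K).
Proof.
move=> m n h; apply/eqP; rewrite -subr_eq0; apply/negP => /negP mn.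
have az1 : az K (m - n) = 1%g.
  by apply: (mulIg (az K n)); rewrite -azD subrK mul1g.
have [//|e st] := @starts_az K (m - n) 1%g mn.
by rewrite mulg1 az1 in st.
Qed.

End LineMore.

(** * The letters read from a block start *)

Section Forward.
Context (R : realType) (K : finType) (K_gt1 : (1 < #|K|)%N) (k0 : K).
Local Notation L := (block K_gt1).
Local Notation e := (#|K|%:R^-1 : R).
Local Notation F := (free_group #|K|.+1).
Local Notation W := (pow_space F L).
Context (lam : probability L R) (P : probability W R).
Hypothesis hP : is_pow_measure lam P.
Hypothesis lam1 : forall y (v : seq (K * K)), all (fun c => c.1 != k0) v ->
  lam [set (y, v) : L] = (e ^+ (2 + 2 * size v))%:E.
Hypothesis lamp : forall y (v : seq (K * K)), all (fun c => c.1 != k0) v ->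
  lam [set l : L | l.1 = y /\ prefix v l.2] = (e ^+ (1 + 2 * size v))%:E.
Hypothesis lam0 : lam [set l : L | ~~ all (fun c => c.1 != k0) l.2] = 0%E.

Lemma cmeasurable_at (g : F) : cmeasurable (fun w : W => w g).
Proof.
move=> c; have /(_ measurableT [set c] I) := @measurable_pow_proj F _ L g.
by rewrite setTI.
Qed.

Lemma cmeasurable_line m : cmeasurable (fun w : W => line w m).
Proof. exact: cmeasurable_at. Qed.

Lemma cmeasurable_succ p : cmeasurable (fun w : W => succ (line w) p).
Proof.
exact: (cmeasurable_comp (C := L) (fun l : L => if (p.2.+1 < sz l)%N then (p.1, p.2.+1)
  else (p.1 + 1, 0%N)) (@cmeasurable_line p.1)).
Qed.

Lemma cmeasurable_iter_succ p i : cmeasurable (fun w : W => iter i (succ (line w)) p).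
Proof.
elim: i => [|i IH]; first exact: cmeasurable_cst.
exact: (cmeasurable_bind (g := fun p (w : W) => succ (line w) p) IH cmeasurable_succ).
Qed.

Lemma cmeasurable_lbl p : cmeasurable (fun w : W => lbl k0 (line w) p).
Proof.
exact: (cmeasurable_comp (C := L) (fun l : L => lab k0 l p.2) (@cmeasurable_line p.1)).
Qed.

Lemma cmeasurable_rd p i : cmeasurable (fun w : W => rd k0 (line w) p i).
Proof.
exact: (cmeasurable_bind (g := fun p (w : W) => lbl k0 (line w) p)
  (cmeasurable_iter_succ p i) cmeasurable_lbl).
Qed.

Lemma P_at (g : F) (B : set L) : P [set w : W | B (w g)] = lam B.
Proof.
have := hP [fset g]%fset (B := fun=> B) (fun=> I); rewrite big_seq_fset1 => <-.
congr (P _); apply/seteqP; split=> w; first by move=> h g' /fset1P ->.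
by move=> h; apply: h; rewrite inE.
Qed.

(* Block [m] starts with [(k0, y)] and [v], which are followed by the letters [u]. *)
Definition ev m y (v u : seq (K * K)) : set W := [set w |
  (line w m).1 = y /\ prefix v (line w m).2 /\
  forall i, (i < size u)%N -> rd k0 (line w) (m, size v) i.+1 = nth (k0, k0) u i].

Lemma measurable_ev m y v u : measurable (ev m y v u).
Proof.
apply: measurable_set_and.
  exact: (cmeasurable_pre (fun l : L => l.1 = y) (@cmeasurable_line m)).
apply: measurable_set_and.
  exact: (cmeasurable_pre (fun l : L => prefix v l.2) (@cmeasurable_line m)).
apply: measurable_set_forall => i; apply: measurable_set_imp => _.
exact: cmeasurable_rd.
Qed.

Lemma ev_local m y v u (w w' : W) : (forall m', m <= m' -> line w m' = line w' m') ->
  ev m y v u w -> ev m y v u w'.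
Proof.
by move=> h; rewrite /ev /= h // => -[-> [-> e]]; split=> //; split=> // i /e; rewrite (rd_ge _ _ h).
Qed.

(** A letter without [k0] prolongs [v] inside block [m]; a letter with [k0] ends this block and
    opens the next one, which is independent of it. Generalising over [v] makes both cases instances
    of the induction hypothesis. *)
Lemma P_ev u m y v : all (fun c => c.1 != k0) v ->
  P (ev m y v u) = (e ^+ (1 + 2 * size v + 2 * size u))%:E.
Proof.
elim: u m y v => [|c u IH] m y v vk.
  rewrite muln0 addn0 -(lamp y vk) -(P_at (az K m)); congr (P _).
  by apply/seteqP; split=> w /= [h1]; [case=> h2 _|move=> h2; split].
have [ck|ck] := eqVneq c.1 k0; last first.
  have vck : all (fun c => c.1 != k0) (rcons v c) by rewrite all_rcons ck.
  have -> : ev m y v (c :: u) = ev m y (rcons v c) u.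
    apply/seteqP; split=> w [wy [pv h]]; split=> //.
      have := h 0%N isT; rewrite rdS /rd /= /succ /=.
      case: ltnP => [lt' nc|_ /(congr1 fst)/= kc]; last by rewrite -kc eqxx in ck.
      have pv' : prefix (rcons v c) (line w m).2.
        have /prefixP[s sE] := pv; move: nc lt'; rewrite /lbl /lab /sz /= sE.
        case: s sE => [|c' s] sE; first by rewrite cats0 ltnn.
        by rewrite nth_cat ltnn subnn /= => -> _; apply/prefixP; exists s; rewrite cat_rcons.
      split=> // i iu; have := h i.+1 iu; rewrite rdS /succ /= lt'.
      by rewrite size_rcons.
    have /prefixP[s sE] := pv.
    have lt' : ((size v).+1 < sz (line w m))%N by rewrite /sz sE size_cat size_rcons ltnS leq_addr.
    split; first by rewrite sE cat_rcons; apply/prefixP; exists (c :: s).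
    move=> [_|i iu].
      rewrite rdS /rd /= /succ /= lt' /lbl /lab /= sE cat_rcons nth_cat ltnn subnn //.
    by rewrite rdS /succ /= lt' -(size_rcons v c); exact: h.
  by rewrite IH // size_rcons /=; congr ((_ ^+ _)%:E); lia.
(* Outside this null set no block contains [k0] after its first letter, so reading [c] means that
   block [m] ends right after [v]. *)
pose N : set W := [set w | ~~ all (fun c => c.1 != k0) (line w m).2].
rewrite (measure_eq_mod_null (N := N)
   (B := [set w | line w m = (y, v)] `&` ev (m + 1) c.2 [::] u)).
- rewrite (pow_indep hP (S := [set az K m])).
  + rewrite (P_at (az K m) [set (y, v)]) lam1 // IH // -EFinM -exprD.
    by congr ((_ ^+ _)%:E); rewrite /=; lia.
  + exact: cmeasurable_line.
  + exact: measurable_ev.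
  + by move=> w w' h; rewrite /line /= h.
  + move=> w w' h; apply: ev_local => m' mm'; apply: h => /= /az_inj.
    by lia.
- exact: (cmeasurable_pre (fun l : L => ~~ all (fun c => c.1 != k0) l.2) (@cmeasurable_line m)).
- exact: measurable_ev.
- apply: measurableI; [exact: cmeasurable_line|exact: measurable_ev].
- by rewrite (P_at (az K m) [set l : L | ~~ all (fun c => c.1 != k0) l.2]).
- move=> w /negP; rewrite negbK => wk; split.
    move=> [wy [pv h]]; have := h 0%N isT; rewrite rdS /rd /=.
    have /prefixP[s sE] := pv.
    have [s0|s0] := eqVneq s [::]; last first.
      rewrite /succ /= /sz sE size_cat ltnS -ltn_subLR // subnn lt0n size_eq0 s0 /lbl /lab /=.
      rewrite sE nth_cat ltnn subnn; case: s s0 sE => //= c' s _ sE cE.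
      by move: wk; rewrite sE all_cat /= -cE cE ck eqxx andbF.
    rewrite /succ /= /sz sE s0 cats0 ltnn => -[/= cE].
    split; first by rewrite [LHS]surjective_pairing wy sE s0 cats0.
    split; first by rewrite -cE.
    split; first exact: prefix0s.
    by move=> i iu; have := h i.+1 iu; rewrite rdS /succ /= /sz sE s0 cats0 ltnn.
  move=> [wE [cE [_ h]]]; rewrite /= in wE; split; first by rewrite wE.
  split; first by rewrite wE /= prefix_refl.
  have sE : succ (line w) (m, size v) = (m + 1, 0%N) by rewrite /succ /sz wE /= ltnn.
  move=> [_|i iu]; rewrite rdS sE; last exact: h.
  by rewrite /rd /= /lbl /lab /= cE -ck -surjective_pairing.
Qed.

Definition reads (u : seq (K * K)) : set W := [set w |
  forall i, (i < size u)%N -> rd k0 (line w) (0, 0%N) i = nth (k0, k0) u i].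

Lemma measurable_reads u : measurable (reads u).
Proof.
apply: measurable_set_forall => i; apply: measurable_set_imp => _.
exact: cmeasurable_rd.
Qed.

(** The first coordinate of [c] is certain, which accounts for the exponent 1 instead of 2. *)
Lemma P_reads c u : c.1 = k0 -> P (reads (c :: u)) = (e ^+ (1 + 2 * size u))%:E.
Proof.
move=> ck; suff -> : reads (c :: u) = ev 0 c.2 [::] u by rewrite P_ev.
apply/esym/seteqP; split=> w.
  move=> [wc [_ h]] [_|i iu] /=; last exact: h.
  by rewrite /rd /lbl /lab /= wc -ck -surjective_pairing.
move=> h; split; first by have := h 0%N isT; rewrite /rd /lbl /lab /= => <-.
by split; [exact: prefix0s|move=> i iu; exact: (h i.+1 iu)].
Qed.

End Forward.

(** * Recurrence of the parenthesis walk *)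

Section Surv.
Context (R : realType) (K : finType) (K_gt1 : (1 < #|K|)%N) (k0 k : K).
Hypothesis kk0 : k != k0.
Local Notation e := (#|K|%:R^-1 : R).
Local Notation q := (#|K|%:R : R).

(* The probability that the walk with steps [sgn k0 k c], for [c] uniform, started at [s],
   is positive up to time [N]. *)
Fixpoint surv N (s : int) : R :=
  if 0 < s then
    if N is N'.+1 then e ^+ 2 * \sum_(c : K * K) surv N' (s + sgn k0 k c.1) else 1
  else 0.

Lemma qne0 : q != 0. Proof. by rewrite pnatr_eq0 -lt0n; apply: leq_trans K_gt1. Qed.

Lemma surv_neg N s : s <= 0 -> surv N s = 0.
Proof. by rewrite leNgt => /negbTE h; case: N => [|N] /=; rewrite h. Qed.

Lemma sum_pairs (f : K -> R) : \sum_(c : K * K) f c.1 = q * \sum_x f x.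
Proof.
rewrite -(pair_bigA _ (fun x _ => f x)) /= mulr_sumr; apply: eq_bigr => x _.
by rewrite sumr_const mulr_natl.
Qed.

Lemma surv_bound N s : 0 <= surv N s <= 1.
Proof.
have H : e ^+ 2 * (\sum_(c : K * K) 1) = 1 :> R.
  rewrite sumr_const card_prod natrM expr2; have := qne0; move: (#|K|%:R : R) => z z0.
  by field.
have e0 : 0 <= e ^+ 2 by rewrite exprn_ge0 // invr_ge0 ler0n.
elim: N s => [|N IH] s /=; case: ifP => _; rewrite ?lexx ?ler01 //.
rewrite mulr_ge0 //=; last by apply: sumr_ge0 => c _; case/andP: (IH (s + sgn k0 k c.1)).
rewrite -[leRHS]H ler_wpM2l //; apply: ler_sum => c _.
by case/andP: (IH (s + sgn k0 k c.1)).
Qed.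

Lemma surv_noninc N s : surv N.+1 s <= surv N s.
Proof.
elim: N s => [|N IH] s.
  have [s0|s0] := ltP 0 s; last by rewrite !surv_neg.
  by rewrite [surv 0 s]/= s0; case/andP: (surv_bound 1 s).
have [s0|s0] := ltP 0 s; last by rewrite !surv_neg.
rewrite /= s0 ler_wpM2l ?exprn_ge0 ?invr_ge0 //; apply: ler_sum => c _.
exact: IH.
Qed.

(** Of the q possible first coordinates, [k0] steps up, [k] steps down and the q - 2 others stay. *)
Lemma surv_rec N s : 0 < s ->
  q * surv N.+1 s = surv N (s + 1) + surv N (s - 1) + (q - 2) * surv N s.
Proof.
move=> s0; rewrite [surv N.+1 s]/= s0 (sum_pairs (fun x => surv N (s + sgn k0 k x))).
have -> : \sum_x surv N (s + sgn k0 k x) = surv N (s + 1) + surv N (s - 1) + (q - 2) * surv N s.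
  rewrite (bigD1 k0) //= (bigD1 k) //= addrA; congr (_ + _ + _).
  - by rewrite sgnk0 kk0.
  - by rewrite /sgn eqxx (negbTE kk0) sub0r.
  rewrite (eq_bigr (fun=> surv N s)); last first.
    by move=> x /andP[/negbTE h1 /negbTE h2]; rewrite /sgn h1 h2 subrr addr0.
  rewrite sumr_const -[LHS]mulr_natl; congr (_ * _).
  have -> : #|[pred x | (x != k0) && (x != k)]| = (#|K| - 2)%N.
    have := cardC [pred x | (x == k0) || (x == k)].
    rewrite (_ : #|[pred x | (x == k0) || (x == k)]| = 2%N); last first.
      have := card2 k0 k; rewrite eq_sym kk0 => <-; apply: eq_card => x.
      by rewrite !inE.
    move=> <-; rewrite addKn; apply: eq_card => x.
    by rewrite !inE negb_or.
  by rewrite natrB.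
by have := qne0; move: (#|K|%:R : R) => z z0; field.
Qed.

Lemma surv_cvg s : cvgn (surv^~ s).
Proof.
apply: nonincreasing_is_cvgn.
  by apply/nonincreasing_seqP => n; exact: surv_noninc.
by exists 0 => _ [n _ <-]; case/andP: (surv_bound n s).
Qed.

(* The limit [h] is bounded, vanishes at 0 and satisfies [h (s + 1) + h (s - 1) = 2 h s]
   for [s > 0], hence it is 0. *)
Lemma surv_lim : (surv^~ 1) @ \oo --> (0 : R).
Proof.
pose h s := limn (surv^~ s).
have hc s : (surv^~ s) @ \oo --> h s by exact: surv_cvg.
have h0 : h 0 = 0.
  rewrite /h (_ : surv^~ 0 = fun=> 0); first by rewrite lim_cst.
  by apply/funext => n; rewrite surv_neg.
have hrec s : 0 < s -> h (s + 1) + h (s - 1) = 2 * h s.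
  move=> s0; have : (fun N => q * surv N.+1 s) @ \oo --> q * h s.
    by apply: cvgMl_tmp; rewrite (cvg_shiftS (surv^~ s)).
  have : (fun N => q * surv N.+1 s) @ \oo --> h (s + 1) + h (s - 1) + (q - 2) * h s.
    rewrite (_ : (fun N => _) = fun N => surv N (s + 1) + surv N (s - 1) + (q - 2) * surv N s).
      by apply: cvgD; [exact: cvgD|exact: cvgMl_tmp].
    by apply/funext => N; rewrite surv_rec.
  move=> c1 c2; have := cvg_unique (@Rhausdorff R) c1 c2; rewrite mulrBl.
  by move=> /(_ _); move: (q * h s) => z; lra.
(* The recurrence makes [h] linear on the naturals, and boundedness by 1 then forces [h 1 = 0]. *)
have hn n : h n%:Z = n%:R * h 1.
  suff [] : h n%:Z = n%:R * h 1 /\ h n.+1%:Z = n.+1%:R * h 1 by [].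
  elim: n => [|n [IH1 IH2]]; first by rewrite h0 mul0r mul1r.
  split=> //; have := hrec n.+1%:Z isT.
  have -> : n.+1%:Z + 1 = n.+2%:Z by lia.
  have -> : n.+1%:Z - 1 = n%:Z by lia.
  rewrite IH1 IH2 -!natr1; lra.
have h_ge0 s : 0 <= h s.
  by apply: limr_ge; [exact: surv_cvg|near=> n; case/andP: (surv_bound n s)].
have h_le1 s : h s <= 1.
  by apply: limr_le; [exact: surv_cvg|near=> n; case/andP: (surv_bound n s)].
suff h1 : h 1 = 0 by rewrite -h1.
apply/eqP; rewrite eq_le h_ge0 andbT leNgt; apply/negP => h1.
have [n hn'] : exists n : nat, (h 1)^-1 < n%:R.
  have h1' : 0 <= (h 1)^-1 by rewrite invr_ge0 ltW.
  by exists (Num.trunc (h 1)^-1).+1; have /andP[] := truncn_itv h1'.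
have := h_le1 n%:Z; rewrite hn leNgt => /negP; apply.
by rewrite -ltr_pdivrMr // div1r.
Unshelve. all: by end_near.
Qed.

End Surv.

(** * Every parenthesis is closed; mass transport along lines *)

Section Good.
Context (R : realType) (K : finType) (K_gt1 : (1 < #|K|)%N) (k0 : K).
Local Notation L := (block K_gt1).
Local Notation e := (#|K|%:R^-1 : R).
Local Notation q := (#|K|%:R : R).
Local Notation F := (free_group #|K|.+1).
Local Notation W := (pow_space F L).
Context (lam : probability L R) (P : probability W R).
Hypothesis hP : is_pow_measure lam P.
Hypothesis P_reads : forall c u, c.1 = k0 ->
  P (reads k0 (c :: u)) = (e ^+ (1 + 2 * size u))%:E.
Hypothesis lam_tail : forall j, lam [set l : L | (j <= size l.2)%N] = ((1 - e) ^+ j)%:E.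

Lemma cmeasurable_rd' p i : cmeasurable (fun w : W => (rd k0 (line w) p i).1).
Proof. exact: (cmeasurable_comp (@fst K K) (@cmeasurable_rd _ K_gt1 k0 p i)). Qed.

Definition X0 (w : W) i := (rd k0 (line w) (0, 0%N) i).1.

Definition wsum k (u : seq (K * K)) : int := \sum_(c <- u) sgn k0 k c.1.

Lemma reads_psum k u w : reads k0 u w -> psum k0 k (X0 w) (size u) = wsum k u.
Proof.
move=> h; rewrite /psum /wsum (big_nth (k0, k0)) big_mkord.
by apply: eq_bigr => i _; rewrite /X0 h.
Qed.

Definition alive k u N : set W := [set w | reads k0 u w /\
  forall j, (size u <= j <= size u + N)%N -> 0 < psum k0 k (X0 w) j].

Lemma measurable_alive k u N : measurable (alive k u N).
Proof.
apply: measurable_set_and; first exact: measurable_reads.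
apply: measurable_set_forall => i; apply: measurable_set_imp => _.
exact: (cmeasurable_pre (fun s : int => 0 < s) (cmeasurable_psum k0 k (cmeasurable_rd' (0, 0%N)) i)).
Qed.

(** Splitting according to the next letter reproduces the recursion that defines [surv]. *)
Lemma P_alive k c u N : c.1 = k0 ->
  P (alive k (c :: u) N) = (e ^+ (1 + 2 * size u) * surv R k0 k N (wsum k (c :: u)))%:E.
Proof.
move=> ck; elim: N u => [|N IH] u.
  have [s0|s0] := ltP 0 (wsum k (c :: u)).
    rewrite /= s0 mulr1 -(P_reads u ck); congr (P _); apply/seteqP; split=> w; first by case.
    move=> h; split=> // j; rewrite addn0 -eqn_leq => /eqP <-.
    by rewrite (reads_psum k h).
  rewrite surv_neg // mulr0 (_ : alive _ _ _ = set0) ?measure0 //.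
  apply/seteqP; split=> // w [h /(_ (size (c :: u)))].
  by rewrite leqnn addn0 leqnn (reads_psum k h) ltNge s0 => /(_ isT).
have [s0|s0] := ltP 0 (wsum k (c :: u)); last first.
  rewrite surv_neg // mulr0 (_ : alive _ _ _ = set0) ?measure0 //.
  apply/seteqP; split=> // w [h /(_ (size (c :: u)))].
  by rewrite leqnn leq_addr (reads_psum k h) ltNge s0 => /(_ isT).
rewrite (measure_fin_partition P (@cmeasurable_rd _ K_gt1 k0 (0, 0%N) (size (c :: u))) (measurable_alive _ _ _)).
rewrite (eq_bigr (fun d : K * K => P (alive k (c :: rcons u d) N))).
  rewrite (eq_bigr (fun d : K * K => (e ^+ (1 + 2 * (size u).+1) *
     surv R k0 k N (wsum k (c :: u) + sgn k0 k d.1))%:E)); last first.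
    move=> d _; rewrite IH size_rcons; congr ((_ * surv _ _ _ _ _)%:E).
    by rewrite -rcons_cons /wsum -cats1 big_cat big_seq1.
  rewrite sumEFin -mulr_sumr /= s0 mulrA -exprD; congr ((_ ^+ _ * _)%:E); lia.
move=> d _; rewrite -rcons_cons; congr (P _); apply/seteqP; split=> w.
  move=> [[h hs] hd]; split=> [i|j].
    rewrite size_rcons ltnS leq_eqVlt nth_rcons => /orP[/eqP ->|iu].
      by rewrite ltnn eqxx; exact: hd.
    by rewrite iu h.
  rewrite size_rcons => /andP[h1 h2]; apply: hs; rewrite (ltnW h1) /=.
  by rewrite addnS -addSn.
move=> [h hs]; have hd : rd k0 (line w) (0, 0%N) (size (c :: u)) = d.
  by rewrite h ?size_rcons // nth_rcons ltnn eqxx.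
have hr : reads k0 (c :: u) w.
  by move=> i iu; rewrite h ?size_rcons ?ltnS ?(ltnW iu) // nth_rcons iu.
split=> //; split=> // j /andP[]; rewrite leq_eqVlt => /orP[/eqP <- _|h1 h2].
  by rewrite (reads_psum k hr).
by apply: hs; rewrite size_rcons h1 /= addSn -addnS.
Qed.

Definition nomatch k : set W := [set w | forall n, ~ match_at k0 (line w) k n (0, 0%N)].

Lemma measurable_match k n p : measurable [set w : W | match_at k0 (line w) k n p].
Proof.
exact: (@measurable_matched _ W K k0 k (fun w i => (rd k0 (line w) p i).1) (cmeasurable_rd' p)).
Qed.

Lemma measurable_nomatch k : measurable (nomatch k).
Proof.
by apply: measurable_set_forall => n; apply: measurable_set_not; exact: measurable_match.
Qed.

(** The steps are at most 1 in absolute value, so the walk cannot become negative without vanishing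
    first, and its first zero would be a match. *)
Lemma nomatch_psum k w : nomatch k w -> forall j, 0 < psum k0 k (X0 w) j.+1.
Proof.
move=> h; have kk0 : k != k0.
  apply/eqP => kk; apply: (h 0%N); rewrite kk; split => //.
  by rewrite psumS /psum big_ord0 add0r sgnk0r.
suff H j : forall i, (i <= j)%N -> 0 < psum k0 k (X0 w) i.+1 by move=> j; exact: (H j).
elim: j => [|j IH] i.
  by rewrite leqn0 => /eqP ->; rewrite psumS /psum big_ord0 add0r /X0 rd0 sgnk0 kk0.
rewrite leq_eqVlt => /orP[/eqP ->|]; last exact: IH.
have hj := IH j (leqnn j); have : psum k0 k (X0 w) j.+2 <> 0.
  by move=> h0; apply: (h j.+1); split=> // i' hi'; exact: IH.
by rewrite psumS /sgn; case: (_ == k0); case: (_ == k); lia.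
Qed.

Lemma P_nomatch k : P (nomatch k) = 0%E.
Proof.
have [->|kk0] := eqVneq k k0.
  rewrite (_ : nomatch k0 = set0) ?measure0 //; apply/seteqP; split=> // w /(_ 0%N).
  apply; split=> //; by rewrite psumS /psum big_ord0 add0r sgnk0r.
rewrite (measure_fin_partition P (@cmeasurable_rd _ K_gt1 k0 (0, 0%N) 0) (measurable_nomatch _)).
apply: big1 => c _; have mI : measurable (nomatch k `&` [set w : W | rd k0 (line w) (0, 0%N) 0 = c]).
  by apply: measurableI; [exact: measurable_nomatch|exact: cmeasurable_rd].
have [ck|ck] := eqVneq c.1 k0; last first.
  rewrite (_ : _ `&` _ = set0) ?measure0 //; apply/seteqP; split=> // w [_ /= h].
  by move: ck; rewrite -h rd0 eqxx.
apply/eqP; rewrite eq_le measure_ge0 andbT; apply/lee_addgt0Pr => eps eps0.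
have := @surv_lim R _ K_gt1 _ _ kk0; move=> /cvgrPdist_lt /(_ eps eps0) [n _ /(_ n (leqnn n))] /=.
have /andP[s0 _] := surv_bound R K_gt1 k0 k n 1 : (0 <= surv R k0 k n 1 <= 1).
rewrite sub0r normrN ger0_norm // add0e => hs.
(* As [c.1 = k0], the walk stands at 1 after the first letter. *)
apply: (@le_trans _ _ (P (alive k [:: c] n))).
  apply: le_measure; rewrite ?inE; [exact: mI|exact: measurable_alive|].
  move=> w [hw /= h]; split=> [[_|//] //|[|j] // _].
  exact: nomatch_psum.
rewrite P_alive // lee_fin /= /wsum big_seq1 ck sgnk0 kk0 /=.
apply: le_trans (ltW hs); rewrite ler_piMl // expr1.
by rewrite ltW // e_lt1.
Qed.

Lemma P_rmove (g : F) (A : set W) : measurable A -> P [set w | A (rmove g w)] = P A.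
Proof.
move=> mA; rewrite -[RHS](pow_reindex (mulgI g) hP hP mA).
congr (P _); apply/seteqP; split=> w /=;
  by have -> : rmove g w = (fun i => w (g * i)%g) by apply/funext => f; rewrite rmoveE.
Qed.

Lemma measurable_rmove (g : F) (A : set W) : measurable A -> measurable [set w : W | A (rmove g w)].
Proof.
move=> mA; have mf : measurable_fun setT (rmove g : W -> W).
  apply: measurable_fun_pow => i; rewrite (_ : (fun w => _) = fun w : W => w (g * i)%g).
    exact: measurable_pow_proj.
  by apply/funext => w; rewrite rmoveE.
by have := mf measurableT A mA; rewrite setTI.
Qed.

Section MTP.
Variables (X Y : countType) (D : W -> int * X -> int * Y -> Prop).
Hypothesis mD : forall x y, measurable [set w | D w x y].
Hypothesis DR : forall w m x y, D w (tr m x) (tr m y) <-> D (rmove (az K m) w) x y.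

(** Translating by the block index of the target turns mass sent out of block 0 into mass received
    by block 0. Source and target types differ because parentheses are sent to letters; [nu_stp]
    uses it with both equal to [K]. *)
Lemma mass_transport :
  (\esum_(x in [set: X]) \esum_(y in [set: int * Y]) P [set w | D w (0%R, x) y] =
   \esum_(y in [set: Y]) \esum_(x in [set: int * X]) P [set w | D w x (0%R, y)])%E.
Proof.
rewrite !esum_esum; try by move=> *; exact: measure_ge0.
rewrite (reindex_esum setT ([set: X] `*`` fun=> [set: int * Y])
  (fun p : Y * (int * X) => (p.2.2, (- p.2.1, p.1)))); last first.
  split=> //.
    by move=> [y [m x]] [y' [m' x']] _ _ [-> /oppr_inj -> ->].
  by move=> [x [m y]] _; exists (y, (- m, x)) => //=; rewrite opprK.
rewrite (_ : [set: Y] `*`` _ = setT); last by apply/seteqP; split.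
apply: eq_esum => -[y [m x]] _ /=.
rewrite -(P_rmove (az K m) (mD (0, x) (- m, y))); congr (P _).
apply/seteqP; split=> w /=.
  by move=> /DR; rewrite /tr /= addr0 subrr.
by move=> h; apply/DR; rewrite /tr /= addr0 subrr.
Qed.
End MTP.

End Good.

(** * Every letter is matched *)

Section GoodAS.
Context (R : realType) (K : finType) (K_gt1 : (1 < #|K|)%N) (k0 : K).
Local Notation L := (block K_gt1).
Local Notation e := (#|K|%:R^-1 : R).
Local Notation q := (#|K|%:R : R).
Local Notation F := (free_group #|K|.+1).
Local Notation W := (pow_space F L).
Context (lam : probability L R) (P : probability W R).
Hypothesis hP : is_pow_measure lam P.
Hypothesis P_nomatch : forall k, P (nomatch k0 k) = 0%E.
Hypothesis lam_tail : forall j, lam [set l : L | (j <= size l.2)%N] = ((1 - e) ^+ j)%:E.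

Lemma esum_disjoint (I : countType) (A : I -> W -> Prop) :
  (forall i, measurable [set w | A i w]) ->
  (forall w i j, A i w -> A j w -> i = j) ->
  \esum_(i in [set: I]) P [set w | A i w] = P [set w | exists i, A i w].
Proof.
move=> mA dA; rewrite -(measure_countable_bigcup P mA); last first.
  by move=> i j _ _ [w [Ai Aj]]; exact: dA Ai Aj.
by congr (P _); apply/seteqP; split=> w [i]; [exists i|exists i].
Qed.

Lemma measurable_closes x p : measurable [set w : W | closes k0 (line w) x p].
Proof.
apply: (@measurable_set_ext _ _ (fun w : W => exists n, iter n (succ (line w)) (x.1, 0%N) = p
   /\ match_at k0 (line w) x.2 n (x.1, 0%N))).
  by move=> w; split=> [[n [<- h]]|[n -> h]]; exists n.
apply: measurable_set_exists => n; apply: measurable_set_and; last exact: measurable_match.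
exact: cmeasurable_iter_succ.
Qed.

Lemma closes_rmove w m x p : closes k0 (line w) (tr m x) (tr m p) <-> closes k0 (line (rmove (az K m) w)) x p.
Proof. by rewrite line_rmove; exact: closes_tr. Qed.

Lemma P_unclosed x : P [set w | ~ exists p, closes k0 (line w) x p] = 0%E.
Proof.
case: x => m k; rewrite -(P_nomatch k) -(P_rmove hP (az K m) (@measurable_nomatch _ K_gt1 k0 k)).
congr (P _); apply/seteqP; split=> w /=.
  move=> h n hn; apply: h; exists (tr m (iter n (succ (line (rmove (az K m) w))) (0, 0%N))).
  have -> : (m, k) = tr m (0, k) by rewrite /tr /= addr0.
  by apply/closes_rmove; exists n.
move=> h [p]; have -> : (m, k) = tr m (0, k) by rewrite /tr /= addr0.
rewrite -(trNK m p) => /closes_rmove [n _]; exact: h.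
Qed.

Lemma P_valid j : P [set w : W | valid (line w) (0, j)] = ((1 - e) ^+ j)%:E.
Proof. by rewrite -lam_tail -(P_at hP (az K 0)). Qed.

Lemma measurable_valid p : measurable [set w : W | valid (line w) p].
Proof. exact: (cmeasurable_pre (fun l : L => (p.2 < sz l)%N) (@cmeasurable_line _ K_gt1 p.1)). Qed.

Lemma measurable_closed (p : int * nat) : measurable [set w : W | exists x, closes k0 (line w) x p].
Proof. by apply: measurable_set_exists => x; exact: measurable_closes. Qed.

Lemma measurable_opened x : measurable [set w : W | exists p, closes k0 (line w) x p].
Proof. by apply: measurable_set_exists => p; exact: measurable_closes. Qed.

(** Each of the q parentheses opened at block 0 sends mass one to its closing position; by mass
    transport block 0 receives q. *)
Lemma sum_closed : \esum_(j in [set: nat]) P [set w | exists x, closes k0 (line w) x (0, j)] = q%:E.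
Proof.
have := mass_transport hP measurable_closes closes_rmove.
rewrite (eq_esum (b := fun=> 1%E)); last first.
  move=> k _; rewrite esum_disjoint; last first.
  - by move=> w p p'; exact: closes_fun.
  - by move=> p; exact: measurable_closes.
  have mx := measurable_opened (0, k).
  rewrite -[X in P X]setCK probability_setC; last exact: measurableC.
  by have -> : P (~` [set w | exists p, closes k0 (line w) (0, k) p]) = 0%E := P_unclosed (0, k);
    rewrite sube0.
rewrite esum_fintype // sumEFin sumr_const => ->.
apply: eq_esum => j _; rewrite esum_disjoint //.
- by move=> x; exact: measurable_closes.
- by move=> w x x'; exact: closes_inj.
Qed.

(** A geometric sum of tail probabilities: the mean number of letters in a block. *)
Lemma sum_valid : \esum_(j in [set: nat]) P [set w : W | valid (line w) (0, j)] = q%:E.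
Proof.
have e0 := e_gt0 R K_gt1; have e1 := e_lt1 R K_gt1.
rewrite (eq_esum (b := fun j => ((1 - e) ^+ j)%:E)); last by move=> j _; rewrite P_valid.
rewrite -nneseries_esumT; last by move=> j; rewrite lee_fin exprn_ge0 //; lra.
rewrite (_ : (fun n => _) = EFin \o series (geometric 1 (1 - e))); last first.
  by apply/funext => n; rewrite /= sumEFin; congr EFin; apply: eq_bigr => i _; rewrite /= mul1r.
apply/cvg_lim => //; apply: cvg_EFin; first by near=> n.
have := @cvg_geometric_series R 1 (1 - e).
rewrite opprB addrCA subrr addr0 mul1r invrK; apply.
by rewrite ger0_norm; lra.
Unshelve. all: by end_near.
Qed.

(* The expected numbers of closing positions and of positions in block 0 are both [q]. *)
Lemma P_unmatched j : P [set w : W | valid (line w) (0, j) /\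
  ~ exists x, closes k0 (line w) x (0, j)] = 0%E.
Proof.
pose c j := P [set w : W | valid (line w) (0, j) /\ ~ exists x, closes k0 (line w) x (0, j)].
have mc i : measurable [set w : W | valid (line w) (0, i) /\ ~ exists x, closes k0 (line w) x (0, i)].
  apply: measurable_set_and; first exact: measurable_valid.
  by apply: measurable_set_not; exact: measurable_closed.
have H : \esum_(j in [set: nat]) c j = 0%E.
  have : (\esum_(j in [set: nat]) P [set w | exists x, closes k0 (line w) x (0%R, j)] +
     \esum_(j in [set: nat]) c j = q%:E)%E.
    rewrite -esumD; try by move=> *; exact: measure_ge0.
    rewrite -sum_valid; apply: eq_esum => i _.
    rewrite -measureU //; [| exact: measurable_closed |]; last first.
      by apply/seteqP; split=> // w [h [_ /(_ h)]].
    congr (P _); apply/seteqP; split=> w /=.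
      by move=> [[x /closes_valid]|[]].
    by move=> v; have [h|h] := pselect (exists x, closes k0 (line w) x (0, i)); [left|right].
  rewrite sum_closed; have : (0 <= \esum_(j in [set: nat]) c j)%E by apply: esum_ge0.
  case: (\esum_(j in _) _) => [r| |] //.
  rewrite -EFinD => _ [] /eqP; rewrite -[X in _ == X]addr0 => /eqP/addrI ->.
  by [].
have cj : \esum_(i in [set j]) c i = c j by apply: esum_set1; exact: measure_ge0.
apply/eqP; rewrite -/(c j) eq_le measure_ge0 andbT -H -cj esum_mkcond.
by apply: le_esum => i _; case: ifP => // _; exact: measure_ge0.
Qed.

Lemma measurable_good : measurable [set w : W | good k0 (line w)].
Proof.
apply: measurable_set_and.
  by apply: measurable_set_forall => x; exact: measurable_opened.
apply: (@measurable_set_ext _ _ (fun w : W => forall p : int * nat, ~ (valid (line w) p /\ ~ exists x, closes k0 (line w) x p))).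
  move=> w; split=> h p; first by move=> v; apply: contrapT => n; exact: (h p).
  by move=> [v]; apply; exact: h.
apply: measurable_set_forall => p; apply: measurable_set_not; apply: measurable_set_and.
  exact: measurable_valid.
by apply: measurable_set_not; exact: measurable_closed.
Qed.

Lemma countable_null (I : countType) (A : I -> W -> Prop) :
  (forall i, measurable [set w | A i w]) -> (forall i, P [set w | A i w] = 0%E) ->
  P [set w | exists i, A i w] = 0%E.
Proof.
move=> mA A0; have -> : [set w | exists i, A i w] =
    \bigcup_n (oapp (fun i => [set w | A i w]) set0 (choice.pickle_inv n : option I)).
  apply/seteqP; split=> w.
    by move=> [i Ai]; exists (choice.pickle i) => //; rewrite pickleK_inv.
  by move=> [n _]; case: choice.pickle_inv => //= i Ai; exists i.
have mF n : measurable (oapp (fun i => [set w | A i w]) set0 (choice.pickle_inv n : option I)).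
  by case: choice.pickle_inv => //= i; exact: mA.
apply/negligibleP; first exact: bigcupT_measurable.
apply: negligible_bigcup => n; apply/negligibleP; first exact: mF.
by case: choice.pickle_inv => [i|] /=; rewrite ?measure0 ?A0.
Qed.

Lemma good_as : P [set w : W | ~ good k0 (line w)] = 0%E.
Proof.
have -> : [set w : W | ~ good k0 (line w)] =
    [set w | exists x : int * K, ~ exists p, closes k0 (line w) x p] `|`
    [set w | exists p : int * nat, valid (line w) p /\ ~ exists x, closes k0 (line w) x p].
  apply/seteqP; split=> w /=.
    move=> /not_andP[/existsNP[x hx]|/existsNP[p /not_implyP[v h]]]; [left|right].
      by exists x.
    by exists p.
  move=> [[x h]|[p [v h]]] [h1 h2]; first exact: h.
  by apply: h; exact: h2.
have m1 : measurable [set w : W | exists x : int * K, ~ exists p, closes k0 (line w) x p].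
  apply: measurable_set_exists => x; apply: measurable_set_not; exact: measurable_opened.
have mc p : measurable [set w : W | valid (line w) p /\ ~ exists x, closes k0 (line w) x p].
  apply: measurable_set_and; first exact: measurable_valid.
  by apply: measurable_set_not; exact: measurable_closed.
have m2 : measurable [set w : W | exists p : int * nat, valid (line w) p /\ ~ exists x, closes k0 (line w) x p].
  by apply: measurable_set_exists => p; exact: mc.
apply/eqP; rewrite eq_le measure_ge0 andbT; apply: (le_trans (measureU2 _ m1 m2)).
have -> : (0 = 0 + 0 :> \bar R)%E by rewrite adde0.
apply: leeD.
  rewrite le_eqVlt; apply/orP; left; apply/eqP; apply: countable_null; last exact: P_unclosed.
  by move=> x; apply: measurable_set_not; exact: measurable_opened.
rewrite le_eqVlt; apply/orP; left; apply/eqP; apply: countable_null => // -[m j].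
rewrite -(P_unmatched j) -(P_rmove hP (az K m) (mc (0, j))).
have mj : (m, j) = tr m (0, j) by rewrite /tr /= addr0.
congr (P _); apply/seteqP; split=> w /=; rewrite line_rmove mj => -[v h]; split=> //.
  by move=> [x]; rewrite -line_rmove => /closes_rmove hx; apply: h; exists (tr m x).
by move=> [x]; rewrite -(trNK m x) => /closes_rmove; rewrite line_rmove => hx; apply: h; exists (tr (- m) x).
Qed.

End GoodAS.

(** * The law of the letters read from a state *)

Section Law.
Context (R : realType) (K : finType) (K_gt1 : (1 < #|K|)%N) (k0 : K).
Local Notation L := (block K_gt1).
Local Notation e := (#|K|%:R^-1 : R).
Local Notation q := (#|K|%:R : R).
Local Notation F := (free_group #|K|.+1).
Local Notation W := (pow_space F L).
Local Notation V := (W * K)%type.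
Context (lam : probability L R) (P : probability W R).
Hypothesis hP : is_pow_measure lam P.
Hypothesis P_reads : forall c u, c.1 = k0 ->
  P (reads k0 (c :: u)) = (e ^+ (1 + 2 * size u))%:E.
Hypothesis good_as : P [set w : W | ~ good k0 (line w)] = 0%E.

Lemma cmeasurable_Tl d x : cmeasurable (fun w : W => Tl k0 d (line w) x).
Proof.
have H x' y : measurable [set w : W | T k0 (line w) x' = y].
  apply: (@measurable_set_ext _ _ (fun w : W =>
    good k0 (line w) /\ (exists p, closes k0 (line w) x' p /\ closes k0 (line w) y (succ (line w) p)) \/
    ~ good k0 (line w) /\ (x'.1 + 1, x'.2) = y)).
    move=> w; split=> [[[g [p [h1 h2]]]|[g <-]]|<-].
    - exact: T_good g h1 h2.
    - exact: T_bad.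
    have [g|g] := pselect (good k0 (line w)); last by right; rewrite T_bad.
    left; split=> //; have [p hp] := g.1 x'; exists p; split=> //.
    have [z hz] := g.2 _ (succ_valid (line w) p).
    by rewrite (T_good g hp hz).
  apply: measurable_set_or; last first.
    apply: measurable_set_and; last exact: measurable_set_prop.
    by apply: measurable_set_not; exact: measurable_good.
  apply: measurable_set_and; first exact: measurable_good.
  apply: measurable_set_exists => p; apply: measurable_set_and; first exact: measurable_closes.
  apply: (cmeasurable_select (P := fun p' (w : W) => closes k0 (line w) y p')
    (@cmeasurable_succ _ K_gt1 p)) => p'; exact: measurable_closes.
case: d => y; first exact: H.
apply: (@measurable_set_ext _ _ (fun w : W => T k0 (line w) y = x)); last exact: H.
move=> w /=; split=> [<-|<-]; [exact: TK|exact: TinvK].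
Qed.

(** [K] is only a finite type here, so measurability on [W * K] is expressed slice by slice. *)
Definition slices (E : V -> Prop) := forall k, measurable [set w | E (w, k)].

Lemma slices_stp E l : slices E -> slices (fun v => E (stp k0 l v)).
Proof.
move=> mE k; rewrite /stp /=; case: (l.1 == ord0); last first.
  by have := measurable_rmove (gl (bl k l.2)) (mE k).
apply: (cmeasurable_select (P := fun y (w : W) => E (rmove (az K y.1) w, y.2))
  (cmeasurable_Tl l.2 (0, k))) => y.
by have := measurable_rmove (az K y.1) (mE y.2).
Qed.

Lemma slices_act E g : slices E -> slices (fun v => E (act (stp k0) g v)).
Proof.
rewrite /act; elim: (word g) E => //= l u IH E mE.
by have := slices_stp l (IH _ mE).
Qed.

(* The product of [P] and the counting measure of [K], on sets with measurable slices. *)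
Definition nu (E : V -> Prop) : \bar R := (\sum_(k : K) P [set w | E (w, k)])%E.

(** The letter b translates [w] within each slice. For a, mass transport applies with each pair sent
    to its image under [T] or [Tinv], bijections that commute with the shift of the line. *)
Lemma nu_stp E l : slices E -> nu (fun v => E (stp k0 l v)) = nu E.
Proof.
move=> mE; rewrite /nu /stp /=; case: (l.1 == ord0); last first.
  by apply: eq_bigr => k _; rewrite -(P_rmove hP (gl (bl k l.2)) (mE k)).
pose D (w : W) (x y : int * K) := Tl k0 l.2 (line w) x = y /\ E (rmove (az K y.1) w, y.2).
have mD x y : measurable [set w | D w x y].
  apply: measurable_set_and; first exact: cmeasurable_Tl.
  by have := measurable_rmove (az K y.1) (mE y.2).
have DR w m x y : D w (tr m x) (tr m y) <-> D (rmove (az K m) w) x y.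
  rewrite /D Tl_tr line_rmove -rmoveM -azD /=; split=> -[h ?]; split=> //.
    exact: (can_inj (@trK K m) h).
  by rewrite h.
have := mass_transport hP mD DR; rewrite !esum_fintype; try by
  move=> i; apply: esum_ge0 => *; exact: measure_ge0.
move=> h; transitivity (\sum_(x : K) \esum_(y in [set: int * K]) P [set w | D w (0%R, x) y])%E.
  apply: eq_bigr => k _; rewrite esum_disjoint //; last first.
    by move=> w i j [<- _] [<- _].
  congr (P _); apply/seteqP; split=> w /=; last by move=> [y [<-]].
  by move=> hE; eexists; split; first reflexivity.
rewrite h; apply: eq_bigr => k _; rewrite esum_disjoint //; last first.
  by move=> w i j [hi _] [hj _]; apply: (can_inj (Tl_cancel k0 l.2 (line w))); rewrite hi hj.
congr (P _); apply/seteqP; split=> w /=; first by move=> [x [_]]; rewrite rmove1.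
move=> hE; exists (Tl k0 (~~ l.2) (line w) (0, k)); split; last by rewrite rmove1.
by rewrite -{1}[l.2]negbK Tl_cancel.
Qed.

Lemma nu_act E g : slices E -> nu (fun v => E (act (stp k0) g v)) = nu E.
Proof.
rewrite /act; elim: (word g) E => //= l u IH E mE.
rewrite -(IH E mE); apply: (nu_stp (E := fun v => E (act_seq (stp k0) u v))).
move: (mE); clear; elim: u E => //= l u IH E mE.
exact: (slices_stp l (IH E mE)).
Qed.

Lemma obs_closes w x p : closes k0 (line w) x p -> obs k0 (rmove (az K x.1) w, x.2) = lbl k0 (line w) p.
Proof.
move=> h; rewrite /obs /= line_rmove.
have h' : closes k0 (sh x.1 (line w)) (0, x.2) (tr (- x.1) p).
  apply/closes_tr; rewrite trNK; have -> // : tr x.1 (0, x.2) = x.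
  by rewrite /tr /= addr0 -surjective_pairing.
case: xgetP => [p' _ hp'|/(_ _ h') //].
by rewrite (closes_fun hp' h') -lbl_tr trNK -(closes_lbl h) -surjective_pairing.
Qed.

(** On a good line [T] follows [succ], so moving by a reads consecutive letters from the closing
    position on. *)
Lemma obs_iter w k p i : good k0 (line w) -> closes k0 (line w) (0, k) p ->
  obs k0 (iter i (stp_a k0 true) (w, k)) = rd k0 (line w) p i.
Proof. by move=> g h; rewrite iter_stp_a /= (obs_closes (iterT_closes i g h)). Qed.

Lemma cmeasurable_obs k : cmeasurable (fun w : W => obs k0 (w, k)).
Proof.
move=> c; apply: (@measurable_set_ext _ _ (fun w : W => k = c.1 /\
   exists p, ((exists p', closes k0 (line w) (0, k) p') /\ closes k0 (line w) (0, k) p \/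
     ~ (exists p', closes k0 (line w) (0, k) p') /\ p = (0, 0%N)) /\ (lbl k0 (line w) p).2 = c.2)).
  move=> w; split.
    rewrite /obs /= => -[-> [p [hp hc]]]; rewrite [c]surjective_pairing -hc; congr (_, (lbl _ _ _).2).
    case: hp => [[_ hp]|[h ->]].
      by case: xgetP => [p' _ hp'|/(_ p) //]; exact: closes_fun hp' hp.
    by case: xgetP => // p' _ hp'; case: h; exists p'.
  move=> <-; split=> //; exists (xget (0, 0%N) [set p | closes k0 (line w) (0, k) p]); split=> //.
  case: xgetP => [p _ hp|h]; first by left; split=> //; exists p.
  by right; split=> // -[p /h].
apply: measurable_set_and; first exact: measurable_set_prop.
apply: measurable_set_exists => p; apply: measurable_set_and; last first.
  exact: (cmeasurable_pre (fun d : K * K => d.2 = c.2) (@cmeasurable_lbl _ K_gt1 k0 p)).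
apply: measurable_set_or; apply: measurable_set_and.
- exact: measurable_opened.
- exact: measurable_closes.
- by apply: measurable_set_not; exact: measurable_opened.
- exact: measurable_set_prop.
Qed.

Lemma slices_obs c : slices (fun v => obs k0 v = c).
Proof. by move=> k; exact: cmeasurable_obs. Qed.

Lemma slices_Theta g c : slices (fun v => Theta k0 v g = c).
Proof. exact: (slices_act g (slices_obs c)). Qed.

Lemma iter_stp_act d i v : iter i (stp_a k0 d) v = act (stp k0) (gl (la d) ^+ i)%g v.
Proof. by rewrite (actX (stpK k0)); apply: eq_iter. Qed.

Definition readT (u : seq (K * K)) (v : V) : Prop :=
  forall i, (i < size u)%N -> obs k0 (iter i (stp_a k0 true) v) = nth (k0, k0) u i.

Lemma slices_readT u : slices (readT u).
Proof.
move=> k; apply: measurable_set_forall => i; apply: measurable_set_imp => _.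
have := slices_act (gl (la true) ^+ i)%g (slices_obs (nth (k0, k0) u i)) k.
by congr measurable; apply/seteqP; split=> w /=; rewrite iter_stp_act.
Qed.

(** Only the slice of [k0] contributes, and there reading begins at a block start. The factor q
    stands for the factor [e] that [P_reads] lacks. *)
Lemma nu_readT_k0 c u : c.1 = k0 -> nu (readT (c :: u)) = (q * e ^+ (2 * (size u).+1))%:E.
Proof.
move=> ck; have q0 := qne0 R K_gt1.
rewrite /nu (bigD1 k0) //= big1 ?adde0; last first.
  move=> k kk; rewrite (_ : [set _ | _] = set0) ?measure0 //.
  apply/seteqP; split=> // w /= /(_ 0%N isT) /(congr1 fst) /= h.
  by move: kk; rewrite h ck eqxx.
have -> : q * e ^+ (2 * (size u).+1) = e ^+ (1 + 2 * size u).
  by rewrite mulnS add2n exprS mulrA mulfV // mul1r add1n.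
rewrite -(P_reads u ck); apply: (measure_eq_mod_null (N := [set w : W | ~ good k0 (line w)])).
- by apply: measurable_set_not; exact: measurable_good.
- exact: slices_readT.
- exact: measurable_reads.
- exact: good_as.
move=> w /contrapT g; split=> h i iu; have := h i iu;
  by rewrite (obs_iter i g (closes00 _ _ _)).
Qed.

(** By invariance under a, the word may be read one step later; then split according to the letter
    before it. *)
Lemma nu_readT_cons u : nu (readT u) = (\sum_(c : K * K) nu (readT (c :: u)))%E.
Proof.
rewrite -(nu_stp (la true) (slices_readT u)) /nu exchange_big /=.
apply: eq_bigr => k _.
rewrite (measure_fin_partition P (cmeasurable_obs k)); last first.
  exact: (slices_stp (la true) (slices_readT u)).
apply: eq_bigr => c _; congr (P _); apply/seteqP; split=> w.
  move=> [h hc] [_|i iu] //=; have := h i iu; rewrite -iterSr //.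
move=> h; split; last exact: (h 0%N).
by move=> i iu; have := h i.+1 iu; rewrite iterSr.
Qed.

Lemma nu_ge0 E : (0 <= nu E)%E.
Proof. by apply: sume_ge0 => k _; exact: measure_ge0. Qed.

(* Extend [u] to the left, using [nu_readT_cons], until a letter with [k0] appears. *)
Lemma nu_readT_ge j u : ((q * e ^+ (2 * size u) * (1 - (1 - e) ^+ j))%:E <= nu (readT u))%E.
Proof.
have q0 := qne0 R K_gt1; have qp := qgt0 R K_gt1.
elim: j u => [|j IH] u; first by rewrite expr0 subrr mulr0 nu_ge0.
rewrite nu_readT_cons.
(* The factor 1 - (1 - e)^j is the probability that [k0] occurs among j iid uniform letters: the
   first added letter either succeeds or leaves one attempt fewer. *)
pose B (c : K * K) := q * e ^+ (2 * (size u).+1) * (if c.1 == k0 then 1 else 1 - (1 - e) ^+ j).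
apply: (@le_trans _ _ (\sum_(c : K * K) (B c)%:E)%E); last first.
  apply: lee_sum => c _; rewrite /B; case: eqP => ck; last exact: (IH (c :: u)).
  by rewrite mulr1 nu_readT_k0.
rewrite sumEFin lee_fin -mulr_sumr.
rewrite (sum_pairs (fun x : K => if x == k0 then 1 else 1 - (1 - e) ^+ j : R)).
rewrite (bigD1 k0) //= eqxx (eq_bigr (fun=> 1 - (1 - e) ^+ j)); last by move=> k /negbTE ->.
rewrite sumr_const cardC1 -(mulr_natl (1 - (1 - e) ^+ j)) -subn1 natrB ?(ltnW K_gt1) //.
rewrite mulnS exprD !exprS; move: (e ^+ (2 * size u)) ((1 - e) ^+ j) => x y.
rewrite le_eqVlt; apply/orP; left; apply/eqP.
by move: (#|K|%:R : R) q0 => z z0; field.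
Qed.

(* Both sides have the same sum over the words of a given length, so that the lower
   bounds of [nu_readT_ge] are equalities. *)
Lemma nu_readT u : nu (readT u) = (q * e ^+ (2 * size u))%:E.
Proof.
have q0 := qne0 R K_gt1; have qp := qgt0 R K_gt1.
have e0 := e_gt0 R K_gt1; have e1 := e_lt1 R K_gt1.
have nuge u' : ((q * e ^+ (2 * size u'))%:E <= nu (readT u'))%E.
  set x := q * _.
  have : (fun j => x * (1 - (1 - e) ^+ j)) @ \oo --> (x * (1 - 0) : R).
    apply: cvgMl_tmp; apply: cvgB; first exact: cvg_cst.
    by apply: cvg_expr; rewrite ger0_norm; lra.
  rewrite subr0 mulr1 => hx; have [nuoo|nufin] := eqVneq (nu (readT u')) +oo%E.
    by rewrite nuoo leey.
  have nuE : nu (readT u') = (fine (nu (readT u')))%:E.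
    by rewrite fineK // ge0_fin_numE ?nu_ge0 // lt_neqAle nufin leey.
  rewrite nuE lee_fin; apply: (@cvgr_to_le _ _ _ _ _ _ _ hx).
  by near=> j; rewrite -lee_fin -nuE; exact: nu_readT_ge.
elim: u => [|c u IH].
  rewrite /nu (eq_bigr (fun=> 1%E)); last first.
    move=> k _; rewrite (_ : [set w | _] = setT) ?probability_setT //.
    by apply/seteqP; split.
  by rewrite sumEFin sumr_const muln0 expr0 mulr1.
have fin c' : nu (readT (c' :: u)) \is a fin_num.
  rewrite ge0_fin_numE ?nu_ge0 //; apply: (@le_lt_trans _ _ (nu (readT u))); last by rewrite IH ltry.
  by rewrite [leRHS]nu_readT_cons (bigD1 c') //= leeDl //; apply: sume_ge0 => *; exact: nu_ge0.
have : \sum_(c' : K * K) (fine (nu (readT (c' :: u))) - q * e ^+ (2 * (size u).+1)) = 0.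
  rewrite sumrB sumr_const card_prod.
  have -> : \sum_(c' : K * K) fine (nu (readT (c' :: u))) = q * e ^+ (2 * size u).
    apply: EFin_inj; rewrite -IH nu_readT_cons -sumEFin; apply: eq_bigr => c' _.
    by rewrite fineK.
  rewrite -[X in _ - X]mulr_natr natrM mulnS exprD; move: (e ^+ (2 * size u)) => x.
  by move: (#|K|%:R : R) q0 => z z0; field.
move/eqP; rewrite psumr_eq0; last first.
  by move=> c' _; rewrite subr_ge0 -lee_fin fineK //; exact: (nuge (c' :: u)).
move=> /allP /(_ c (mem_index_enum _)) /=; rewrite subr_eq0 => /eqP h.
by rewrite -(fineK (fin c)) h.
Unshelve. all: by end_near.
Qed.

(** Entry [n] of the window is the letter at the state itself, so that its first coordinate selects
    the slice: all of [nu_readT] is carried by [k]. *)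
Lemma P_line_window n k (u : seq (K * K)) : (n < size u)%N -> (nth (k0, k0) u n).1 = k ->
  P [set w | readT u (iter n (stp_a k0 false) (w, k))] = (q * e ^+ (2 * size u))%:E.
Proof.
move=> nu' uk; rewrite -nu_readT.
rewrite -(nu_act (gl (la false) ^+ n)%g (slices_readT u)) /nu (bigD1 k) //= big1 ?adde0.
  by congr (P _); apply/seteqP; split=> w /=; rewrite iter_stp_act.
move=> k' kk'; rewrite (_ : [set _ | _] = set0) ?measure0 //.
apply/seteqP; split=> // w /= /(_ n nu'); rewrite -iter_stp_act.
rewrite iter_stp_aK => /(congr1 fst) /= h; move: kk'; rewrite h uk eqxx //.
Qed.

End Law.

(** * Windows in the free group of rank 2 *)

Lemma nseq_rcons (T : Type) c (x : T) : nseq c.+1 x = rcons (nseq c x) x.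
Proof. by elim: c => //= c <-. Qed.

Section Words.
Local Open Scope nat_scope.
Variable n : nat.
Implicit Types (l m : letter n) (g h : free_group n).

Lemma reduced_nseq c l : reduced (nseq c l).
Proof.
case: c => //= c; elim: c => //= c ->; rewrite andbT.
by rewrite eq_sym letter_inv_neq.
Qed.

Lemma word_glX l c : word (gl l ^+ c)%g = nseq c l.
Proof.
elim: c => // c IH; rewrite expgS word_glM IH push_id //.
exact: (reduced_nseq c.+1 l).
Qed.

Lemma reduced_cat (u v : seq (letter n)) : reduced (u ++ v) -> reduced u /\ reduced v.
Proof. by move=> /cat_sorted2[]. Qed.

Lemma reduced_rcons2 u (l m : letter n) : reduced (rcons (rcons u l) m) = reduced (rcons u l) && (m != letter_inv l).
Proof.
rewrite /reduced; case: u => [|x u] /=; first by rewrite andbT.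
by rewrite rcons_path last_rcons.
Qed.

Lemma reduced_cat_rcons u (l : letter n) v : reduced (rcons u l) -> reduced (l :: v) ->
  reduced (u ++ l :: v).
Proof.
rewrite /reduced; case: u => [|x u] //=.
by rewrite rcons_path cat_path /= => /andP[-> ->].
Qed.

Lemma word_cat g h : reduced (word g ++ word h) -> word (g * h)%g = word g ++ word h.
Proof. exact: word_mul_cat. Qed.

End Words.

Section Windows.
Local Open Scope nat_scope.
Local Notation F2 := (free_group 2).
Implicit Types (g h : F2) (J : seq F2) (u v : seq (letter 2)).
Variable n : nat.

(* [lz i] is a^(i - n), so that [lin h] is the part [h a^-n, .., h a^n] of a line. *)
Definition lz (i : nat) : F2 := (gl (la false) ^+ n * gl (la true) ^+ i)%g.
Definition lin h : seq F2 := [seq (h * lz i)%g | i <- iota 0 (n + n).+1].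

Lemma gl_la_cancel c d : (gl (la d) ^+ c * gl (la (~~ d)) ^+ c)%g = 1%g.
Proof.
elim: c => [|c IH]; first by rewrite mulg1.
rewrite expgSr expgS -mulgA (mulgA (gl (la d))) (_ : (gl (la d) * _)%g = 1%g) ?mul1g //.
by have := gl_inv (la d); rewrite /letter_inv /= => ->; rewrite mulgV.
Qed.

Lemma lzl i : (i <= n)%N -> lz i = (gl (la false) ^+ (n - i))%g.
Proof.
by move=> h; rewrite /lz -{1}(subnK h) expgnDr -mulgA (gl_la_cancel i false) mulg1.
Qed.

Lemma lzr i : (n <= i)%N -> lz i = (gl (la true) ^+ (i - n))%g.
Proof.
by move=> h; rewrite /lz -{1}(subnKC h) expgnDr mulgA (gl_la_cancel n false) mul1g.
Qed.

Lemma lzn : lz n = 1%g. Proof. by rewrite lzl // subnn. Qed.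

Lemma word_lz i : exists c d, (c <= maxn n (i - n))%N /\ word (lz i) = nseq c (la d) /\ ((c == 0) = (i == n)).
Proof.
case: (leqP i n) => h.
  exists (n - i), false; rewrite lzl // word_glX; split; first by rewrite leq_max leq_subr.
  by split=> //; rewrite subn_eq0 eqn_leq h.
exists (i - n), true; rewrite lzr ?word_glX; last exact: ltnW.
by split; [rewrite leq_max leqnn orbT|split=> //; rewrite subn_eq0 [RHS]eqn_leq (ltnW h) andbT].
Qed.

Lemma lz_ex c d : (c <= n)%N -> exists2 i, (i < (n + n).+1)%N & word (lz i) = nseq c (la d).
Proof.
move=> cn; case: d.
  exists (n + c); first by rewrite ltnS leq_add2l.
  by rewrite lzr ?leq_addr // addKn word_glX.
exists (n - c); first by rewrite ltnS (leq_trans (leq_subr _ _)) ?leq_addr.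
by rewrite lzl ?leq_subr // subKn // word_glX.
Qed.

Lemma mem_lin h g : g \in lin h <-> exists2 i, (i < (n + n).+1)%N & g = (h * lz i)%g.
Proof.
split; first by move=> /mapP[i]; rewrite mem_iota => hi ->; exists i.
by move=> [i hi ->]; apply/mapP; exists i => //; rewrite mem_iota.
Qed.

Lemma lin_self h : h \in lin h.
Proof. by apply/mem_lin; exists n; rewrite ?lzn ?mulg1 // ltnS leq_addr. Qed.

Lemma lz_inj i j : lz i = lz j -> i = j.
Proof.
move=> /mulgI /(congr1 (@word 2)); rewrite !word_glX => /(congr1 size).
by rewrite !size_nseq.
Qed.

(* A window grows by adding a line entered through an edge labelled b^d which none of the
   previous elements lies behind. *)
Inductive win : seq F2 -> Prop :=
| win0 : win (lin 1%g)
| winS J h d : win J -> h \in J ->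
    (forall g, g \in J -> ~~ starts (lb d) (h^-1 * g)%g) ->
    win (lin (h * gl (lb d))%g ++ J).

Lemma win_nonempty J : win J -> exists g, g \in J.
Proof.
case=> [|J' h d _ _ _]; first by exists 1%g; exact: lin_self.
by exists (h * gl (lb d))%g; rewrite mem_cat lin_self.
Qed.

(** The words of entry points of lines, to which powers of a can be appended without
    cancellation. *)
Definition bend u := u = [::] \/ exists u' d, u = rcons u' (lb d).

Lemma bend_cat u c d : reduced u -> bend u -> reduced (u ++ nseq c (la d)).
Proof.
move=> ru [->|[u' [d' uE]]]; first exact: reduced_nseq.
rewrite uE in ru *; case: c => [|c]; first by rewrite cats0.
by rewrite cat_rcons; apply: reduced_cat_rcons => //=; exact: (reduced_nseq c.+1).
Qed.

Lemma word_lin h i : bend (word h) -> word (h * lz i)%g = word h ++ word (lz i).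
Proof.
move=> bh; apply: word_cat; have [c [d [_ [-> _]]]] := word_lz i.
by apply: bend_cat => //; exact: word_reduced.
Qed.

(** The invariant of the exhaustion. Prefix closure ensures that nothing lies behind an edge whose
    far end is missing; the last condition says that each line is present up to distance [n] from
    its entry point. *)
Definition winv J := [/\ win J,
  forall u v, u ++ v \in map (@word 2) J -> u \in map (@word 2) J &
  forall u c d, bend u -> u \in map (@word 2) J -> (c <= n)%N ->
    u ++ nseq c (la d) \in map (@word 2) J].

Lemma mem_words J g : (word g \in map (@word 2) J) = (g \in J).
Proof. by rewrite mem_map //; exact: val_inj. Qed.

Lemma words_lin h u : bend (word h) -> u \in map (@word 2) (lin h) <->
  exists c d, (c <= n)%N /\ u = word h ++ nseq c (la d).
Proof.
move=> bh; split.
  move=> /mapP[g /mem_lin[i hi ->] ->]; rewrite word_lin //.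
  have [c [d [hc [-> _]]]] := word_lz i; exists c, d; split=> //.
  by apply: leq_trans hc _; rewrite geq_max leqnn; lia.
move=> [c [d [cn ->]]]; have [i hi <-] := lz_ex d cn.
by rewrite -word_lin // mem_words; apply/mem_lin; exists i.
Qed.

Lemma cat_nseq_split (u v w : seq (letter 2)) c l : u ++ v = w ++ nseq c l ->
  (exists v', w = u ++ v') \/ exists2 c', (c' <= c)%N & u = w ++ nseq c' l.
Proof.
move=> e; case: (leqP (size u) (size w)) => h.
  left; exists (drop (size u) w).
  have := congr1 (take (size u)) e; rewrite take_size_cat // takel_cat // => ->.
  by rewrite size_takel // cat_take_drop.
right; exists (size u - size w).
  have := congr1 size e; rewrite !size_cat size_nseq; lia.
have := congr1 (take (size u)) e; rewrite take_size_cat // take_cat ltnNge (ltnW h) /= => {1}->.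
congr (_ ++ _); rewrite take_nseq //.
by have := congr1 size e; rewrite !size_cat size_nseq; lia.
Qed.

Lemma bend_nseq u c d : bend (u ++ nseq c (la d)) -> c = 0.
Proof.
case: c => // c; rewrite nseq_rcons -rcons_cat => -[|[u' [d']]].
  by case: (u ++ _).
by move=> /eqP; rewrite eqseq_rcons => /andP[_ /eqP].
Qed.

Lemma winv0 : winv (lin 1%g).
Proof.
have b1 : bend (word (1%g : F2)) by left.
split=> [|u v|u c d bu]; first exact: win0.
  move=> /(words_lin _ b1)[c [d [cn /=]]]; rewrite -[nseq c _]cat0s => /cat_nseq_split.
  case=> [[v' e]|[c' c'c ->]].
    by apply/(words_lin _ b1); exists 0, true; split=> //; case: u e.
  by apply/(words_lin _ b1); exists c', d; split=> //; exact: leq_trans cn.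
move=> /(words_lin _ b1)[c' [d' [c'n e]]] cn.
have : c' = 0 by apply: (@bend_nseq [::] _ d'); rewrite -e.
move: e => /[swap] -> /= ->.
by apply/(words_lin _ b1); exists c, d.
Qed.

(** By prefix closure, an element of [J] behind the new edge would have brought the far end of that
    edge into [J]. *)
Lemma winvS J h d : winv J -> h \in J -> reduced (rcons (word h) (lb d)) ->
  rcons (word h) (lb d) \notin map (@word 2) J ->
  winv (lin (h * gl (lb d))%g ++ J).
Proof.
move=> [wJ I1 I2] hJ rh hN.
have wh : word (h * gl (lb d))%g = rcons (word h) (lb d) by rewrite word_cat /= cats1.
have bh : bend (word (h * gl (lb d))%g) by right; exists (word h), d.
have cond g : g \in J -> ~~ starts (lb d) (h^-1 * g)%g.
  move=> gJ; apply/negP => /eqP st; apply: (negP hN).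
  have [v vE] : exists v, word (h^-1 * g)%g = lb d :: v.
    by case: (word _) st => //= x v [->]; exists v.
  have gE : word g = word h ++ lb d :: v.
    rewrite -(mulKg h^-1%g g) invgK -vE; apply: word_cat; rewrite vE.
    apply: reduced_cat_rcons => //; rewrite -vE; exact: word_reduced.
  by apply: (I1 _ v); rewrite cat_rcons -gE mem_words.
split=> [|u v|u c d' bu]; first exact: winS.
  rewrite map_cat !mem_cat => /orP[|/I1 ->]; last by rewrite orbT.
  move=> /(words_lin _ bh)[c [d' [cn]]] /cat_nseq_split[[v' e]|[c' c'c ->]].
    case: (lastP v') e => [|v'' x]; rewrite ?cats0 wh.
      move=> <-; apply/orP; left; apply/(words_lin _ bh); exists 0, true.
      by rewrite wh cats0.
    rewrite -rcons_cat => /eqP; rewrite eqseq_rcons => /andP[/eqP e _].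
    by apply/orP; right; apply: (I1 _ v''); rewrite -e mem_words.
  apply/orP; left; apply/(words_lin _ bh); exists c', d'; split=> //.
  exact: leq_trans cn.
rewrite map_cat !mem_cat => /orP[|uJ cn]; last by rewrite (I2 _ _ _ bu uJ cn) orbT.
move=> /(words_lin _ bh)[c' [d'' [c'n e]]] cn; apply/orP; left.
have c0 : c' = 0 by move: bu; rewrite e => /bend_nseq.
by apply/(words_lin _ bh); exists c, d'; rewrite e c0 cats0.
Qed.

Lemma bend_split u : reduced u -> exists u0 c d, u = u0 ++ nseq c (la d) /\ bend u0.
Proof.
elim/last_ind: u => [_|u l IH ru]; first by exists [::], 0, true; split=> //; left.
have ru' : reduced u by move: ru; rewrite -cats1 => /reduced_cat[].
case: (letter2P l) => -[d lE]; last first.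
  by exists (rcons u l), 0, true; rewrite cats0; split=> //; right; exists u, d; rewrite lE.
have [u0 [c [d' [uE bu0]]]] := IH ru'.
exists u0, c.+1, d; split=> //.
have : c = 0 \/ d' = d.
  case: (c) uE => [|c'] uE; [by left|right].
  move: ru; rewrite uE lE nseq_rcons -rcons_cat reduced_rcons2 => /andP[_].
  by rewrite /letter_inv /=; case: d' d {uE lE} => -[].
move=> h; rewrite uE lE nseq_rcons -rcons_cat.
by have -> : nseq c (la d') = nseq c (la d) by case: h => ->.
Qed.

(** Write [u] as a word [u1], a letter b^d' and a power of a. Once [u1] is in the window, attaching
    the line entered by b^d' reaches [u], as the power is at most [n]. *)
Lemma winv_exhaust m u J : (size u <= m)%N -> (m <= n)%N -> reduced u -> winv J ->
  exists2 J', winv J' & {subset J <= J'} /\ u \in map (@word 2) J'.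
Proof.
elim: m u J => [|m IH] u J um mn ru wJ.
  move: um; rewrite leqn0 size_eq0 => /eqP ->; exists J => //; split=> //.
  have [wJ' I1 _] := wJ; have [g gJ] := win_nonempty wJ'.
  by apply: (I1 _ (word g)); rewrite mem_words.
have [u0 [c [d [uE bu0]]]] := bend_split ru.
have cn : (c <= n)%N by apply: leq_trans mn; apply: leq_trans um; rewrite uE size_cat size_nseq leq_addl.
suff [J' wJ' [JJ' uJ']] : exists2 J', winv J' & {subset J <= J'} /\ u0 \in map (@word 2) J'.
  by exists J' => //; split=> //; have [_ _ I2] := wJ'; rewrite uE; exact: I2.
case: (bu0) => [u00|[u1 [d' u0E]]].
  have [J' wJ' H] := IH [::] J isT (ltnW mn) isT wJ.
  by exists J' => //; rewrite u00.
have ru0 : reduced u0 by move: ru; rewrite uE => /reduced_cat[].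
have ru1 : reduced u1 by move: ru0; rewrite u0E -cats1 => /reduced_cat[].
have um1 : (size u1 <= m)%N.
  by rewrite -ltnS (leq_trans _ um) // uE size_cat u0E size_rcons leq_addr.
have [J1 wJ1 [JJ1 u1J1]] := IH u1 J um1 (ltnW mn) ru1 wJ.
have [u0J1|u0J1] := boolP (u0 \in map (@word 2) J1); first by exists J1.
have /mapP[h hJ1 u1h] := u1J1.
exists (lin (h * gl (lb d'))%g ++ J1).
  by apply: winvS => //; rewrite -u1h -u0E.
split; first by move=> g /JJ1 gJ; rewrite mem_cat gJ orbT.
rewrite map_cat mem_cat u0E u1h -cats1; apply/orP; left.
have -> : word h ++ [:: lb d'] = word (h * gl (lb d'))%g.
  by rewrite word_cat //= cats1 -u1h -u0E.
by rewrite mem_words lin_self.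
Qed.

End Windows.

Lemma win_exhaust (G : seq (free_group 2)) :
  exists n J, win n J /\ {subset G <= J}.
Proof.
(* All lines of a window share one radius; the largest word length bounds every power of a that
   occurs. *)
pose n := (\max_(g <- G) size (word g))%N; exists n.
have Gn g : g \in G -> (size (word g) <= n)%N.
  by move=> gG; rewrite /n (big_rem g) //= leq_maxl.
suff [J [wJ _ _] GJ] : exists2 J, winv n J & {subset G <= J} by exists J.
elim: (G) Gn => [|g G' IH] Gn; first by exists (lin n 1%g) => //; exact: winv0.
have [|J wJ GJ] := IH; first by move=> g' hg'; apply: Gn; rewrite inE hg' orbT.
have [J' wJ' [JJ' gJ']] := winv_exhaust (Gn g (mem_head _ _)) (leqnn n) (word_reduced g) wJ.
exists J' => // g'; rewrite inE => /orP[/eqP ->|/GJ/JJ' //].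
by rewrite -mem_words.
Qed.

(** * The law of Theta *)

Section WindowLaw.
Context (R : realType) (K : finType) (K_gt1 : (1 < #|K|)%N) (k0 : K).
Local Notation L := (block K_gt1).
Local Notation e := (#|K|%:R^-1 : R).
Local Notation q := (#|K|%:R : R).
Local Notation F := (free_group #|K|.+1).
Local Notation W := (pow_space F L).
Local Notation V := (W * K)%type.
Local Notation F2 := (free_group 2).
Context (lam : probability L R) (P : probability W R).
Hypothesis hP : is_pow_measure lam P.
Hypothesis P_reads : forall c u, c.1 = k0 ->
  P (reads k0 (c :: u)) = (e ^+ (1 + 2 * size u))%:E.
Hypothesis good_as : P [set w : W | ~ good k0 (line w)] = 0%E.

Definition Zv (J : seq F2) (val : F2 -> K * K) (v : V) : Prop :=
  forall g, g \in J -> Theta k0 v g = val g.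

Lemma slices_Zv J val : slices (Zv J val).
Proof.
move=> k; apply: measurable_set_forall => g; apply: measurable_set_imp => _.
exact: slices_Theta.
Qed.

Lemma Theta_lz v h n i : Theta k0 v (h * lz n i)%g =
  obs k0 (iter i (stp_a k0 true) (iter n (stp_a k0 false) (act (stp k0) h v))).
Proof. by rewrite /Theta /lz !(actM (stpK k0)) !iter_stp_act. Qed.

Lemma iter_line d i (w w' : W) k : line w = line w' ->
  line (iter i (stp_a k0 d) (w, k)).1 = line (iter i (stp_a k0 d) (w', k)).1 /\
  (iter i (stp_a k0 d) (w, k)).2 = (iter i (stp_a k0 d) (w', k)).2.
Proof. by move=> h; rewrite !iter_stp_a /= !line_rmove h. Qed.

Lemma Theta_line v v' h n i :
  line (act (stp k0) h v).1 = line (act (stp k0) h v').1 ->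
  (act (stp k0) h v).2 = (act (stp k0) h v').2 ->
  Theta k0 v (h * lz n i)%g = Theta k0 v' (h * lz n i)%g.
Proof.
rewrite !Theta_lz; case: (act _ _ v) => w k; case: (act _ _ v') => w' k' /= hl <-.
have [] := iter_line false n k hl.
case: (iter n _ _) => w1 k1; case: (iter n _ _) => w1' k1' /= hl1 <-.
have [] := iter_line true i k1 hl1.
case: (iter i _ _) => w2 k2; case: (iter i _ _) => w2' k2' /= hl2 <-.
exact: obs_line.
Qed.

Definition vals n (h : F2) (val : F2 -> K * K) :=
  [seq val (h * lz n i)%g | i <- iota 0 (n + n).+1].

Lemma Zv_lin n h val v : Zv (lin n h) val v <->
  @readT K K_gt1 k0 (vals n h val) (iter n (stp_a k0 false) (act (stp k0) h v)).
Proof.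
rewrite /readT /vals size_map size_iota; split=> [hz i ilt|hr g /mem_lin[i ilt ->]].
  rewrite (nth_map 0%N) ?size_iota // nth_iota // add0n -Theta_lz; apply: hz.
  by apply/mem_lin; exists i.
by rewrite Theta_lz hr // (nth_map 0%N) ?size_iota // nth_iota.
Qed.

Lemma nu_base n val : nu P (Zv (lin n 1%g) val) = (q * e ^+ (2 * (n + n).+1))%:E.
Proof.
have -> : Zv (lin n 1%g) val = fun v => @readT K K_gt1 k0 (vals n 1%g val) (act (stp k0) (gl (la false) ^+ n)%g v).
  by apply/funext => v; apply/propext; rewrite Zv_lin iter_stp_act.
rewrite (nu_act k0 hP) ?(nu_readT hP P_reads good_as) //; last exact: slices_readT.
by rewrite /vals size_map size_iota.
Qed.

(** Invariance moves the observer to [h], where the next line is attached. *)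
Lemma nu_shift h J val :
  nu P (Zv J val) = nu P (fun v => forall g, g \in J -> Theta k0 v (h^-1 * g)%g = val g).
Proof.
rewrite -(nu_act k0 hP h^-1%g (slices_Zv J val)); congr nu.
apply/funext => v; apply/propext; rewrite /Zv /Theta.
by split=> H g gJ; have := H g gJ; rewrite (actM (stpK k0)).
Qed.

(** The 2n + 1 letters of the new line have 4n + 2 coordinates, one of which is shared with [h]
    across the edge b^d: hence the exponent 4n + 1. *)
Lemma nu_step n J h d val : h \in J ->
  (forall g, g \in J -> ~~ starts (lb d) (h^-1 * g)%g) ->
  nu P (Zv (lin n (h * gl (lb d))%g ++ J) val) =
  if (val (h * gl (lb d))%g).1 == (val h).1
  then ((e ^+ (4 * n + 1))%:E * nu P (Zv J val))%E else 0%E.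
Proof.
move=> hJ cond; rewrite !(nu_shift h) /nu.
pose k := (val h).1.
(* The value at [h] fixes the state, so a single slice contributes. *)
have Z (J' : seq F2) : h \in J' ->
    (\sum_(k' : K) P [set w | forall g, g \in J' -> Theta k0 (w, k') (h^-1 * g)%g = val g] =
    P [set w : W | forall g, g \in J' -> Theta k0 (w, k) (h^-1 * g)%g = val g])%E.
  move=> hJ'; rewrite (bigD1 k) //= big1 ?adde0 // => k' kk'.
  rewrite (_ : [set _ | _] = set0) ?measure0 //; apply/seteqP; split=> // w /= /(_ h hJ').
  rewrite mulVg => /(congr1 fst) /= h1; move: kk'; by rewrite /k -h1 eqxx.
rewrite !Z ?mem_cat ?hJ ?orbT // -/k.
pose g0 := gl (bl k d) : F.
pose u := vals n (h * gl (lb d))%g val.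
pose A := [set w : W | forall g, g \in J -> Theta k0 (w, k) (h^-1 * g)%g = val g].
pose B := [set w : W | Zv (lin n (gl (lb d))) (fun g => val (h * g)%g) (w, k)].
have mA : measurable A.
  apply: measurable_set_forall => g; apply: measurable_set_imp => _; exact: slices_Theta.
have mB : measurable B by exact: slices_Zv.
have -> : [set w : W | forall g, g \in lin n (h * gl (lb d))%g ++ J ->
    Theta k0 (w, k) (h^-1 * g)%g = val g] = B `&` A.
  apply/seteqP; split=> w.
    move=> H; split=> g.
      move=> /mem_lin[i ilt ->]; have := H (h * (gl (lb d) * lz n i))%g.
      rewrite mulKg => ->; rewrite // mem_cat; apply/orP; left.
      by apply/mem_lin; exists i; rewrite // mulgA.
    by move=> gJ; apply: H; rewrite mem_cat gJ orbT.
  move=> [HB HA] g; rewrite mem_cat => /orP[/mem_lin[i ilt ->]|]; last exact: HA.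
  rewrite -mulgA mulKg HB //; apply/mem_lin; by exists i.
have PB : P B = if (val (h * gl (lb d))%g).1 == k then (q * e ^+ (2 * (n + n).+1))%:E else 0%E.
  have su : size u = (n + n).+1 by rewrite size_map size_iota.
  have un : nth (k0, k0) u n = val (h * gl (lb d))%g.
    rewrite (nth_map 0%N) ?size_iota ?nth_iota; try by rewrite ltnS leq_addr.
    by rewrite add0n lzn mulg1.
  have vE : vals n (gl (lb d)) (fun g => val (h * g)%g) = u.
    by apply: eq_map => i; rewrite mulgA.
  pose B0 := [set w : W | @readT K K_gt1 k0 u (iter n (stp_a k0 false) (w, k))].
  have mB0 : measurable B0.
    have := @slices_act K K_gt1 k0 _ (gl (la false) ^+ n)%g (@slices_readT K K_gt1 k0 u) k.
    by congr measurable; apply/seteqP; split=> w /=; rewrite /B0 /= iter_stp_act.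
  have BE : B = [set w | B0 (rmove g0 w)].
    by apply/seteqP; split=> w; rewrite /B /= Zv_lin act_gl vE.
  have -> : P B = P B0 by rewrite -(P_rmove hP g0 mB0) BE.
  rewrite /B0.
  case: eqP => vk.
    by rewrite (P_line_window hP P_reads good_as) ?su // ?un // ltnS leq_addr.
  rewrite (_ : [set _ | _] = set0) ?measure0 //; apply/seteqP; split=> // w /= hr.
  apply: vk; rewrite -un -hr ?su ?ltnS ?leq_addr //.
  by rewrite iter_stp_aK.
(* The new line depends on [w] only behind the edge beta_k^d and, by [Theta_local], the old window
   only in front of it. *)
rewrite (pow_indep hP (S := [set f | starts (bl k d) f])) //.
- rewrite PB; case: eqP => _; last by rewrite mul0e.
  congr (_%:E * _)%E.
  have q0 := qne0 R K_gt1.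
  have -> : (2 * (n + n).+1 = (4 * n + 1).+1)%N by lia.
  by rewrite exprS mulrA mulfV // mul1r.
- move=> w w' ww'; rewrite /B /= /Zv => H g /[dup] gl' /mem_lin[i ilt gE].
  rewrite -H // gE; apply/esym; apply: Theta_line; rewrite !act_gl //=.
  apply/funext => m; rewrite /line !rmoveE; apply: ww'; rewrite /= starts_gl.
  exact: az_nostart.
- move=> w w' ww'; rewrite /A /= => H g gJ; rewrite -H //.
  apply/esym; apply: (@Theta_local K k0 _ w w' k d (cond g gJ)) => f hf.
  by apply: ww'; apply/negP.
Qed.

End WindowLaw.

(** * Cosets of the subgroup generated by b, along lines *)

Section Cosets.
Local Notation F2 := (free_group 2).
Local Notation b := (free_gen (ord_max : 'I_2)).
Local Notation coset := (to_lcoset b).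
Implicit Types g h : F2.

Lemma cyclic_glb e k : cyclic_subgroup b (gl (lb e) ^+ k)%g.
Proof.
exists k; case: e; first by left.
by right; have := gl_inv (lb true); rewrite /letter_inv /= => ->; rewrite expVgn.
Qed.

Lemma cyclic_glbP h : cyclic_subgroup b h -> exists e k, h = (gl (lb e) ^+ k)%g.
Proof.
move=> [k [->|->]]; first by exists true, k.
exists false, k; have := gl_inv (lb true); rewrite /letter_inv /= => ->.
by rewrite expVgn.
Qed.

Lemma glb_cancel e k : (gl (lb e) * gl (lb (~~ e)) ^+ k.+1 = gl (lb (~~ e)) ^+ k)%g.
Proof.
by rewrite expgS mulgA (_ : (gl (lb e) * _)%g = 1%g) ?mul1g //;
  have := gl_inv (lb e); rewrite /letter_inv /= => ->; rewrite mulgV.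
Qed.

Lemma cyclic_mul e h : cyclic_subgroup b h -> cyclic_subgroup b (gl (lb e) * h)%g.
Proof.
move=> /cyclic_glbP[e' [k ->]]; case: (e =P e') => [->|].
  by rewrite -expgS; exact: cyclic_glb.
move=> ee'; have -> : e' = ~~ e by case: e e' ee' => -[].
case: k => [|k]; first by rewrite mulg1; exact: (cyclic_glb e 1).
by rewrite glb_cancel; exact: cyclic_glb.
Qed.

Lemma coset_glb g e : coset (g * gl (lb e))%g = coset g.
Proof.
have sub g' e' : lcoset_cyclic b (g' * gl (lb e'))%g `<=` lcoset_cyclic b g'.
  by move=> _ [h hc <-]; exists (gl (lb e') * h)%g; [exact: cyclic_mul|rewrite mulgA].
apply: val_inj; apply/seteqP; split; first exact: sub.
have := sub (g * gl (lb e))%g (~~ e); congr (lcoset_cyclic b _ `<=` _).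
rewrite -mulgA (_ : (gl (lb e) * _)%g = 1%g) ?mulg1 //.
by have := glb_cancel e 0; rewrite expg1.
Qed.

Lemma coset_eqP g g' : coset g = coset g' -> exists e k, g' = (g * gl (lb e) ^+ k)%g.
Proof.
move=> /(congr1 val) /= E.
have : lcoset_cyclic b g' g' by exists 1%g; rewrite ?mulg1 //; exists 0%N; left.
by rewrite -E => -[h /cyclic_glbP[e [k ->]] <-]; exists e, k.
Qed.

Lemma word_lz_glb n i e k : exists c d,
  word (lz n i * gl (lb e) ^+ k)%g = nseq c (la d) ++ nseq k (lb e) /\ ((c == 0%N) = (i == n)).
Proof.
have [c [d [_ [wE c0]]]] := word_lz n i; exists c, d; split=> //.
rewrite word_cat wE word_glX //.
case: c {wE c0} => [|c]; first exact: reduced_nseq.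
case: k => [|k]; first by rewrite cats0; exact: (reduced_nseq c.+1).
rewrite nseq_rcons cat_rcons; apply: reduced_cat_rcons.
  by rewrite -nseq_rcons; exact: (reduced_nseq c.+1).
by apply: (@reduced_cat_rcons 2 [::]) => //; exact: (reduced_nseq k.+1).
Qed.

Lemma coset_lz_inj n x i j : coset (x * lz n i)%g = coset (x * lz n j)%g -> i = j.
Proof.
move=> /coset_eqP[e [k]]; rewrite -mulgA => /mulgI E; apply: (@lz_inj n).
case: k E => [|k] E; first by rewrite E mulg1.
have [c [d [w1 _]]] := word_lz_glb n i e k.+1.
have [c' [d' [_ [w2 _]]]] := word_lz n j.
have : lb e \in nseq c' (la d') by rewrite -w2 E w1 mem_cat orbC mem_nseq /= (introT eqP erefl).
by rewrite mem_nseq andbC.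
Qed.

(** Otherwise [h^-1 * g] would be b^d, a nontrivial power of a and a power of b, and thus start with
    b^d. The excluded index [n] is the entry point, which does share the coset of [h]. *)
Lemma coset_new n h d g j : ~~ starts (lb d) (h^-1 * g)%g -> j != n ->
  coset (h * gl (lb d) * lz n j)%g <> coset g.
Proof.
move=> st jn /coset_eqP[e [k gE]]; move: st; rewrite gE.
have [c [d' [wE c0]]] := word_lz_glb n j e k; move: wE; move: (lz n j) => y wE.
rewrite -!mulgA mulKg starts_gl negbK /starts wE.
by move: c0; rewrite (negbTE jn); case: c {wE}.
Qed.

Lemma lin_new n h d g : ~~ starts (lb d) (h^-1 * g)%g -> g \notin lin n (h * gl (lb d))%g.
Proof.
move=> st; apply/negP => /mem_lin[i _ gE]; move: st.
have [c [d' [_ [wE _]]]] := word_lz n i; move: wE; rewrite gE; move: (lz n i) => y wE.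
rewrite -!mulgA mulKg starts_gl negbK /starts wE.
by case: c {wE}.
Qed.

Lemma countable_cosets : countable [set: lcosets_cyclic b].
Proof.
rewrite (_ : [set: _] = range coset); last first.
  apply/seteqP; split=> // -[A hA] _; have := set_mem hA => -[g _ gA].
  by exists g => //; apply: val_inj.
exact: card_le_trans (card_image_le _ _) (countableP _).
Qed.

End Cosets.

Section PowDistinct.
Context (R : realType) (K : finType) (K_gt1 : (1 < #|K|)%N).
Local Notation kap := (uniform_measure K_gt1 R).
Local Notation D := (discrete_space K_gt1).
Local Notation e := (#|K|%:R^-1 : R).
Context (I : choiceType) (P : probability (pow_space I D) R) (hP : is_pow_measure kap P).

Lemma measurable_ev1 i (d : D) : measurable [set x : pow_space I D | x i = d].
Proof. by have := measurable_pow_proj i measurableT (Logic.I : measurable [set d]); rewrite setTI. Qed.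

Lemma measurable_evs (T : choiceType) (s : seq T) (c : T -> I) (v : T -> D) :
  measurable [set x : pow_space I D | forall t, t \in s -> x (c t) = v t].
Proof.
elim: s => [|t s IH].
  by rewrite (_ : [set x | _] = setT) //; apply/seteqP; split.
rewrite (_ : [set x | _] = [set x | x (c t) = v t] `&` [set x | forall t, t \in s -> x (c t) = v t]).
  by apply: measurableI => //; exact: measurable_ev1.
apply/seteqP; split=> x.
  move=> h; split=> [|t' ts]; first by apply: h; rewrite inE eqxx.
  by apply: h; rewrite inE ts orbT.
by move=> [h h'] j; rewrite inE => /orP[/eqP ->|/h'].
Qed.

Lemma P_distinct (T : choiceType) (s : seq T) (c : T -> I) (v : T -> D) (A : set (pow_space I D)) :
  measurable A -> uniq (map c s) ->
  (forall x y, (forall i, i \notin map c s -> x i = y i) -> A x -> A y) ->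
  P ([set x | forall t, t \in s -> x (c t) = v t] `&` A) = ((e ^+ size s)%:E * P A)%E.
Proof.
move=> mA; elim: s => [_ _|t s IH /= /andP[tN us] hA].
  by rewrite expr0 mul1e (_ : [set x | _] = setT) ?setTI //; apply/seteqP; split.
have -> : [set x : pow_space I D | forall t', t' \in t :: s -> x (c t') = v t'] `&` A =
   [set x | x (c t) = v t] `&` ([set x | forall t, t \in s -> x (c t) = v t] `&` A).
  apply/seteqP; split=> x.
    move=> [h Ax]; split; first by apply: h; rewrite inE eqxx.
    by split=> // t' ts; apply: h; rewrite inE ts orbT.
  by move=> [h [h' Ax]]; split=> // j; rewrite inE => /orP[/eqP ->|/h'].
rewrite (pow_indep hP (S := [set c t])).
- rewrite IH //; last first.
    move=> x y xy; apply: hA => i; rewrite inE negb_or => /andP[_]; exact: xy.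
  have -> : P [set x | x (c t) = v t] = e%:E.
    have := hP [fset c t]%fset (B := fun=> [set v t]) (fun=> Logic.I).
    rewrite big_seq_fset1 uniform1 => <-; congr (P _); apply/seteqP; split=> x.
      by move=> h i /fset1P ->.
    by move=> h; apply: h; rewrite inE.
  by rewrite exprS EFinM muleA.
- exact: measurable_ev1.
- by apply: measurableI => //; exact: measurable_evs.
- by move=> x y h /= <-; rewrite h.
- move=> x y h [h1 Ax]; split.
    move=> t' ts; rewrite -h ?h1 // => ct; move: tN; rewrite -ct => /negP; apply.
    exact: map_f.
  by apply: hA Ax => i; rewrite inE negb_or => /andP[/eqP it _]; apply: h.
Qed.

End PowDistinct.

(** * The coset measure on windows *)

Section CosetLaw.
Context (R : realType) (K : finType) (K_gt1 : (1 < #|K|)%N).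
Local Notation kap := (uniform_measure K_gt1 R).
Local Notation D := (discrete_space K_gt1).
Local Notation e := (#|K|%:R^-1 : R).
Local Notation q := (#|K|%:R : R).
Local Notation F2 := (free_group 2).
Local Notation b := (free_gen (ord_max : 'I_2)).
Local Notation coset := (to_lcoset b).
Local Notation X1 := (pow_space F2 (D * D)%type).
Local Notation Px := (pow_measure (lcosets_cyclic b) kap).
Local Notation Py := (pow_measure F2 kap).
Hypothesis hPx : is_pow_measure kap Px.
Hypothesis hPy : is_pow_measure kap Py.
Local Notation mu1 := (coset_measure b kap).

Definition Zx (J : seq F2) (val : F2 -> D * D) : set X1 := [set z | forall g, g \in J -> z g = val g].
Definition Ex (J : seq F2) (val : F2 -> D * D) : set (pow_space (lcosets_cyclic b) D) :=
  [set x | forall g, g \in J -> x (coset g) = (val g).1].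
Definition Ey (J : seq F2) (val : F2 -> D * D) : set (pow_space F2 D) :=
  [set y | forall g, g \in J -> y g = (val g).2].

Lemma measurable_at1 (g : F2) (B : set (D * D)) : measurable [set z : X1 | B (z g)].
Proof. by have := measurable_pow_proj g measurableT (measurableDD B); rewrite setTI. Qed.

Lemma measurable_Zx J val : measurable (Zx J val).
Proof.
apply: measurable_set_forall => g; apply: measurable_set_imp => _.
exact: (measurable_at1 g [set val g]).
Qed.

Lemma mu1_Zx J val : mu1 (Zx J val) = (Px (Ex J val) * Py (Ey J val))%E.
Proof.
rewrite -product_measure1E; [|exact: measurable_evs|exact: measurable_evs].
rewrite /coset_measure /distribution /pushforward /=; congr (product_measure1 _ _ _).
apply/seteqP; split=> -[x y] /=.
  by move=> h; split=> g gJ /=; have := h g gJ; rewrite /coset_pair => <-.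
by move=> [h h'] g gJ; rewrite /coset_pair /= h // h' // -surjective_pairing.
Qed.

Lemma uniq_coset_lin n h : uniq (map coset (lin n h)).
Proof.
rewrite /lin -map_comp map_inj_uniq ?iota_uniq // => i j; exact: coset_lz_inj.
Qed.

Lemma uniq_lin n h : uniq (lin n h).
Proof. exact: map_uniq (uniq_coset_lin n h). Qed.

Lemma size_lin n h : size (lin n h) = (n + n).+1.
Proof. by rewrite size_map size_iota. Qed.

Lemma mu1_base n val : mu1 (Zx (lin n 1%g) val) = (e ^+ (2 * (n + n).+1))%:E.
Proof.
have hx := P_distinct hPx (fun g => (val g).1) measurableT (uniq_coset_lin n 1%g) (fun _ _ _ h => h).
have uy : uniq (map id (lin n 1%g)) by rewrite map_id uniq_lin.
have hy := P_distinct hPy (fun g => (val g).2) measurableT uy (fun _ _ _ h => h).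
rewrite mu1_Zx; move: hx hy; rewrite !setIT !probability_setT !mule1 !size_lin => -> ->.
by rewrite -EFinM -exprD addnn mul2n.
Qed.

(** The line brings 2n + 1 new values of y but only 2n of x, since its entry point is in the coset
    of [h]: the factor is that of [nu_step]. *)
Lemma mu1_step n J h d val : h \in J ->
  (forall g, g \in J -> ~~ starts (lb d) (h^-1 * g)%g) ->
  mu1 (Zx (lin n (h * gl (lb d))%g ++ J) val) =
  if (val (h * gl (lb d))%g).1 == (val h).1
  then ((e ^+ (4 * n + 1))%:E * mu1 (Zx J val))%E else 0%E.
Proof.
move=> hJ cond; pose h' := (h * gl (lb d))%g; rewrite -/h'.
have h'lin : h' \in lin n h' by exact: lin_self.
have ch : coset h' = coset h by exact: coset_glb.
case: eqP => vh; last first.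
  rewrite mu1_Zx (_ : Ex _ _ = set0) ?measure0 ?mul0e //.
  apply/seteqP; split=> // x hx; apply: vh.
  by rewrite -(hx h') ?mem_cat ?h'lin // ch hx // mem_cat hJ orbT.
(* The entry point is left out because its coset is already constrained by [h]. *)
pose s := [seq g <- lin n h' | g != h'].
have ss : size s = (n + n)%N.
  have := count_predC (pred1 h') (lin n h'); rewrite size_lin size_filter.
  by rewrite (count_uniq_mem h' (uniq_lin n h')) h'lin add1n => -[].
have us : uniq (map coset s).
  exact: (subseq_uniq (map_subseq _ (filter_subseq _ _)) (uniq_coset_lin n h')).
have snew g : g \in J -> coset g \notin map coset s.
  move=> gJ; apply/negP => /mapP[g']; rewrite mem_filter => /andP[g'h' /mem_lin[i ilt gE]] cE.
  apply: (@coset_new n h d g i (cond g gJ)); last by rewrite cE gE.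
  by apply: contra g'h' => /eqP iE; rewrite gE iE lzn mulg1.
have ynew g : g \in J -> g \notin lin n h' by move=> /cond; exact: lin_new.
have hx : Px (Ex (lin n h' ++ J) val) = ((e ^+ (n + n))%:E * Px (Ex J val))%E.
  rewrite -ss -(P_distinct hPx (fun g => (val g).1) (measurable_evs _ _ _) us).
    congr (Px _); apply/seteqP; split=> x.
      move=> H; split=> g; last by move=> gJ; apply: H; rewrite mem_cat gJ orbT.
      by rewrite mem_filter => /andP[_ gl']; apply: H; rewrite mem_cat gl'.
    move=> [H HJ] g; rewrite mem_cat => /orP[gl'|]; last exact: HJ.
    have [->|gh'] := eqVneq g h'; first by rewrite ch vh HJ.
    by apply: H; rewrite mem_filter gh'.
  by move=> x y xy H g gJ; rewrite -xy ?H //; exact: snew.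
have hy : Py (Ey (lin n h' ++ J) val) = ((e ^+ (n + n).+1)%:E * Py (Ey J val))%E.
  have uy : uniq (map id (lin n h')) by rewrite map_id uniq_lin.
  rewrite -(size_lin n h') -(P_distinct hPy (fun g => (val g).2) (measurable_evs _ _ _) uy).
    congr (Py _); apply/seteqP; split=> y.
      by move=> H; split=> g gJ; apply: H; rewrite mem_cat gJ ?orbT.
    by move=> [H HJ] g; rewrite mem_cat => /orP[]; [exact: H|exact: HJ].
  by move=> x y xy H g gJ; rewrite -xy ?H // map_id; exact: ynew.
rewrite !mu1_Zx hx hy muleACA -EFinM -exprD; congr ((_ ^+ _)%:E * _)%E; lia.
Qed.

End CosetLaw.

(** * Equality of the two laws *)

Section LawEq.
Context (R : realType) (K : finType) (K_gt1 : (1 < #|K|)%N) (k0 : K).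
Local Notation kap := (uniform_measure K_gt1 R).
Local Notation D := (discrete_space K_gt1).
Local Notation L := (block K_gt1).
Local Notation e := (#|K|%:R^-1 : R).
Local Notation q := (#|K|%:R : R).
Local Notation F := (free_group #|K|.+1).
Local Notation W := (pow_space F L).
Local Notation F2 := (free_group 2).
Local Notation b := (free_gen (ord_max : 'I_2)).
Local Notation X1 := (pow_space F2 (D * D)%type).
Context (lam : probability L R) (P : probability W R).
Hypothesis hP : is_pow_measure lam P.
Hypothesis P_reads : forall c u, c.1 = k0 ->
  P (reads k0 (c :: u)) = (e ^+ (1 + 2 * size u))%:E.
Hypothesis good_as : P [set w : W | ~ good k0 (line w)] = 0%E.
Hypothesis hPx : is_pow_measure kap (pow_measure (lcosets_cyclic b) kap).
Hypothesis hPy : is_pow_measure kap (pow_measure F2 kap).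
Local Notation mu1 := (coset_measure b kap).
Local Notation Th w := (Theta k0 (w, k0) : X1).

(* The laws agree on the coordinates in [J]; both satisfy the same recursion on windows. *)
Definition EqJ (J : seq F2) := forall val : F2 -> K * K,
  nu P (@Zv K K_gt1 k0 J val) = (q%:E * mu1 (Zx (K_gt1 := K_gt1) J val))%E.

Lemma EqJ_win n J : win n J -> EqJ J.
Proof.
elim=> [|J' h d wJ' IH hJ' cond] val.
  by rewrite (nu_base hP P_reads good_as) mu1_base // EFinM.
rewrite (nu_step hP P_reads good_as) // mu1_step //.
by case: ifP => _; rewrite ?mule0 // IH muleCA.
Qed.

Lemma slices_nu_partition (E : W * K -> Prop) (g : F2) : slices E ->
  nu P E = (\sum_(c : K * K) nu P (fun v => E v /\ Theta k0 v g = c))%E.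
Proof.
move=> mE; rewrite /nu exchange_big /=; apply: eq_bigr => k _.
rewrite (measure_fin_partition P (fun c => @slices_Theta _ K_gt1 k0 g c k) (mE k)).
by [].
Qed.

Lemma EqJ_ext J J' : J =i J' -> EqJ J -> EqJ J'.
Proof.
move=> JJ' H val; transitivity (nu P (@Zv K K_gt1 k0 J val)).
  congr (nu P _); apply/funext => v; apply/propext.
  by split=> h g; rewrite ?JJ' -?JJ'; [rewrite JJ'|]; exact: h.
rewrite H; congr (_ * mu1 _)%E.
by apply/seteqP; split=> z h g; [rewrite -JJ'|rewrite JJ']; exact: h.
Qed.

Lemma EqJ_cons g J : EqJ (g :: J) -> EqJ J.
Proof.
move=> H; have [gJ|gJ] := boolP (g \in J).
  apply: EqJ_ext H => g'; rewrite inE; case: eqP => // ->; by rewrite gJ.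
move=> val; rewrite (slices_nu_partition g (slices_Zv k0 J val)).
pose upd c (g' : F2) : K * K := if g' == g then c else val g'.
have updJ c g' : g' \in J -> upd c g' = val g'.
  by move=> g'J; rewrite /upd; case: eqP => // e'; rewrite -e' g'J in gJ.
rewrite (eq_bigr (fun c => nu P (@Zv K K_gt1 k0 (g :: J) (upd c)))); last first.
  move=> c _; congr nu; apply/funext => v; apply/propext; split.
    move=> [h hc] g'; rewrite inE => /orP[/eqP ->|g'J]; first by rewrite /upd eqxx.
    by rewrite updJ // h.
  move=> h; split; last by rewrite h ?mem_head // /upd eqxx.
  by move=> g' g'J; rewrite h ?updJ // inE g'J orbT.
rewrite (eq_bigr (fun c => q%:E * mu1 (Zx (K_gt1 := K_gt1) (g :: J) (upd c)))%E); last first.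
  by move=> c _; exact: H.
rewrite -ge0_sume_distrr; last by move=> c _; exact: measure_ge0.
congr (_ * _)%E.
have mg : cmeasurable (fun z : X1 => (z g : (K * K)%type)) by move=> c; exact: (measurable_at1 g [set c]).
rewrite (measure_fin_partition mu1 mg (measurable_Zx J val)); apply: eq_bigr => c _.
congr (mu1 _); apply/seteqP; split=> z.
  move=> h; split; last by rewrite /= h ?mem_head // /upd eqxx.
  by move=> g' g'J; rewrite h ?updJ // inE g'J orbT.
move=> [h hc] g'; rewrite inE => /orP[/eqP ->|g'J]; first by rewrite /upd eqxx.
by rewrite updJ // h.
Qed.

(** Every finite set lies in a window, whose further elements are discarded one at a time by summing
    over their values. *)
Lemma EqJ_all J : EqJ J.
Proof.
have [n [J' [wJ' JJ']]] := win_exhaust J.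
have : EqJ (J' ++ J).
  apply: EqJ_ext (EqJ_win wJ') => g; rewrite mem_cat.
  by have [/JJ' ->|_] := boolP (g \in J); rewrite ?orbT ?orbF.
by elim: (J') => //= g J1 IH /EqJ_cons.
Qed.

Lemma Theta1 v : (Theta k0 v 1%g).1 = v.2. Proof. by []. Qed.

Lemma measurable_Th : measurable_fun setT (fun w : W => Th w).
Proof.
apply: measurable_fun_pow => g _ A _; rewrite setTI.
exact: (cmeasurable_pre A (fun c => @slices_Theta _ K_gt1 k0 g c k0)).
Qed.

Definition A1 : set X1 := [set z | (z 1%g).1 = k0].

Lemma measurable_A1 : measurable A1.
Proof. exact: (measurable_at1 1%g [set c | c.1 = k0]). Qed.

(** With 1 in [J], the cylinder determines the state, which reduces [nu] to the slice of [k0] and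
    decides membership in [A1]. *)
Lemma P_Th_cyl J (val : F2 -> K * K) : 1%g \in J ->
  P [set w | Zx (K_gt1 := K_gt1) J val (Th w)] = (q%:E * mu1 (Zx J val `&` A1))%E.
Proof.
move=> J1; have [v1|v1] := eqVneq (val 1%g).1 k0; last first.
  rewrite (_ : _ `&` _ = set0) ?measure0 ?mule0; last first.
    apply/seteqP; split=> // z [/(_ 1%g J1) h]; rewrite /A1 /= h => /eqP h'.
    by rewrite h' in v1.
  rewrite (_ : [set w | _] = set0) ?measure0 //; apply/seteqP; split=> // w /= /(_ 1%g J1) h.
  by move: v1; rewrite -h Theta1 /= eqxx.
rewrite (_ : Zx J val `&` A1 = Zx J val); last first.
  by apply/seteqP; split=> z; [case|move=> h; split=> //; rewrite /A1 /= h].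
rewrite -(EqJ_all J val) /nu (bigD1 k0) //= big1 ?adde0 // => k kk.
rewrite (_ : [set _ | _] = set0) ?measure0 //; apply/seteqP; split=> // w /= /(_ 1%g J1) h.
by move: kk; rewrite -v1 -h Theta1 /= eqxx.
Qed.

(* Cylinders over sets containing 1, on which [A1] has a constant value. *)
Definition windows : set (set X1) :=
  [set A | A = set0 \/ exists J val, 1%g \in J /\ A = Zx (K_gt1 := K_gt1) J val].

Lemma windows_setI : setI_closed windows.
Proof.
move=> A B [->|[J [val [J1 ->]]]]; first by rewrite set0I; left.
move=> [->|[J' [val' [J1' ->]]]]; first by rewrite setI0; left.
have [c|/existsNP[g /not_implyP[gJ /not_implyP[gJ' nc]]]] :=
    pselect (forall g, g \in J -> g \in J' -> val g = val' g); last first.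
  left; apply/seteqP; split=> // z [h h']; apply: nc.
  by rewrite -(h g gJ) -(h' g gJ').
right; exists (J ++ J'), (fun g => if g \in J then val g else val' g).
split; first by rewrite mem_cat J1.
apply/seteqP; split=> z.
  by move=> [h h'] g; rewrite mem_cat; case: ifP => [gJ _|_ /= gJ']; [exact: h|exact: h'].
move=> h; split=> g gJ; first by rewrite h ?mem_cat gJ.
rewrite h ?mem_cat ?gJ ?orbT //; case: ifP => // gJ'; exact: c.
Qed.

Lemma windows_gen : measurable = <<s windows >>.
Proof.
apply/seteqP; split; last first.
  apply: smallest_sub; first exact: sigma_algebra_measurable.
  by move=> _ [->|[J [val [_ ->]]]]; [exact: measurable0|exact: measurable_Zx].
rewrite -[measurable]/(<<s @pow_cylinders F2 _ (D * D)%type >>).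
apply: smallest_sub; first exact: smallest_sigma_algebra.
move=> _ [g _ [A mA <-]]; rewrite setTI.
pose GT := g_sigma_algebraType windows.
(* The value at 1 is recorded too, because the sets in [windows] must constrain it. *)
have -> : (fun x : X1 => x g) @^-1` A = \bigcup_(c : (K * K) * (K * K))
    [set z : X1 | A c.2 /\ z 1%g = c.1 /\ z g = c.2].
  apply/seteqP; split=> z; last by move=> [c _ [Ac [_ /= ->]]].
  by move=> Az; exists (z 1%g, z g).
apply: (@countable_bigcupT_measurable _ GT); first exact: countableP.
move=> [c1 c2] /=; apply: sub_sigma_algebra.
have [[h1 h2]|h] := pselect (A c2 /\ (g = 1%g -> c1 = c2)); last first.
  left; apply/seteqP; split=> // z [Ac [z1 z2]]; apply: h; split=> // g1.
  by rewrite -z1 -z2 g1.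
right; exists [:: 1%g; g], (fun g' => if g' == 1%g then c1 else c2); split; first exact: mem_head.
apply/seteqP; split=> z.
  move=> [_ [z1 zg]] g'; rewrite !inE => /orP[/eqP ->|/eqP ->]; first by rewrite eqxx.
  by case: eqP => // g1; rewrite g1.
move=> h; split=> //; have z1 := h 1%g (mem_head _ _); rewrite eqxx in z1; split=> //.
rewrite h ?inE ?eqxx ?orbT //; by case: eqP => // /h2.
Qed.

Lemma mu1_A1 : (q%:E * mu1 A1 = 1)%E.
Proof.
have m1 : cmeasurable (fun z : X1 => (z 1%g : (K * K)%type)).
  by move=> c; exact: (measurable_at1 1%g [set c]).
rewrite (measure_fin_partition mu1 m1 measurable_A1) ge0_sume_distrr; last first.
  by move=> c _; exact: measure_ge0.
rewrite -(probability_setT P).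
have mT : cmeasurable (fun w : W => Theta k0 (w, k0) 1%g) by move=> c; exact: slices_Theta.
rewrite (measure_fin_partition P mT measurableT); apply: eq_bigr => c _.
rewrite setTI setIC; have := P_Th_cyl (fun=> c) (mem_head 1%g [::]).
have H (z : X1) : Zx (K_gt1 := K_gt1) [:: 1%g] (fun=> c) z <-> z 1%g = c.
  split; first by move=> /(_ 1%g (mem_head _ _)).
  by move=> zc g; rewrite inE => /eqP ->.
rewrite (_ : Zx _ _ = [set z : X1 | z 1%g = c]); last by apply/seteqP; split=> z /H.
by move=> <-.
Qed.

Lemma mu1_A1E : mu1 A1 = e%:E.
Proof.
have q0 := qne0 R K_gt1; have := mu1_A1; have : mu1 A1 \is a fin_num by exact: fin_num_measure measurable_A1.
case: (mu1 A1) => // r _; rewrite -EFinM => -[h]; congr EFin.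
by apply: (mulfI q0); rewrite h mulfV.
Qed.

(** Since [A1] has measure 1/q, the right side is the conditional measure on [A1], a probability; it
    suffices to compare on [windows]. *)
Lemma P_Th A : measurable A -> P [set w | A (Th w)] = (q%:E * mu1 (A `&` A1))%E.
Proof.
move=> mA; have q0 := qne0 R K_gt1; have qp := qgt0 R K_gt1.
pose mr : {measure set X1 -> \bar R} := mrestr mu1 measurable_A1.
pose m2 : probability X1 R := mnormalize mr mu1.
have mrT : mr setT = e%:E by rewrite /mr /= /mrestr setTI mu1_A1E.
have m2E B : m2 B = (q%:E * mu1 (B `&` A1))%E.
  have -> : m2 B = if (mr setT == 0%E) || (mr setT == +oo%E) then mu1 B
     else (mr B * (fine (mr setT))^-1%:E)%E.
    by rewrite /m2 /= /mnormalize; case: ifP.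
  by rewrite mrT !eqe invr_eq0 (gt_eqF qp) /= invrK muleC.
rewrite -m2E -(prob_imageE P measurable_Th).
apply: (prob_unique windows_gen windows_setI) mA => B [->|[J [val [J1 ->]]]].
  by rewrite !measure0.
by rewrite m2E prob_imageE -P_Th_cyl.
Qed.

End LawEq.

(** * The inverse of Theta *)

Section Inverse.
Context (K : finType) (K_gt1 : (1 < #|K|)%N) (k0 : K).
Local Notation D := (discrete_space K_gt1).
Local Notation L := (block K_gt1).
Local Notation F := (free_group #|K|.+1).
Local Notation W := (pow_space F L).
Local Notation F2 := (free_group 2).
Local Notation X1 := (pow_space F2 (D * D)%type).
Local Notation Th w := (Theta k0 (w, k0) : X1).
Local Notation act := (act (stp k0)).
Local Notation at_ i := (gl (la true) ^+ i)%g.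

(** Asking for good lines through every element makes the set invariant, so that inductions on words
    of F stay inside it. *)
Definition B2 : set W := [set w | forall g, good k0 (line (rmove g w))].

Lemma B2_rmove g w : B2 w -> B2 (rmove g w).
Proof. by move=> h g'; rewrite -rmoveM; exact: h. Qed.

Lemma B2_good w : B2 w -> good k0 (line w).
Proof. by move=> /(_ 1%g); rewrite rmove1. Qed.

Lemma stp_rmove l (v : W * K) : exists g, (stp k0 l v).1 = rmove g v.1.
Proof. by rewrite /stp; case: ifP => _; eexists. Qed.

Lemma act_rmove h (v : W * K) : exists g, (act h v).1 = rmove g v.1.
Proof.
have -> : act h v = act_seq (stp k0) (word h) v by [].
elim: (word h) v => [|l u IH] v /=; first by exists 1%g; rewrite rmove1.
have [g hg] := IH (stp k0 l v); have [g' hg'] := stp_rmove l v.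
by exists (g' * g)%g; rewrite rmoveM -hg' -hg.
Qed.

Definition shift2 (h : F2) (z : X1) : X1 := shift_action F2 (D * D)%type h^-1%g z.

Lemma shift2E h z f : shift2 h z f = z (h * f)%g.
Proof. by rewrite /shift2 /shift_action invgK. Qed.

Lemma Theta_shift2 h v : Theta k0 (act h v) = shift2 h (Theta k0 v).
Proof. exact: Theta_act. Qed.

Lemma Theta_shift2_k0 h w w' : act h (w, k0) = (w', k0) -> Th w' = shift2 h (Th w).
Proof. by move=> <-; exact: Theta_shift2. Qed.

Lemma Theta_at w i : good k0 (line w) -> Theta k0 (w, k0) (at_ i) = rd k0 (line w) (0, 0%N) i.
Proof.
by move=> g; rewrite /Theta -iter_stp_act (obs_iter i g (closes00 k0 (line w) 0)).
Qed.

Definition mt k n (z : X1) := matched k0 k n (fun i => (z (at_ i)).1).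

Lemma mt_Th w k n : good k0 (line w) -> mt k n (Th w) <-> match_at k0 (line w) k n (0, 0%N).
Proof.
move=> g; rewrite /mt /match_at.
by rewrite (_ : (fun i => _) = fun i => (rd k0 (line w) (0, 0%N) i).1) //; apply/funext => i; rewrite Theta_at.
Qed.

(** [T] carries [(0, k0)], closed by the start of block 0, in [n] steps to the pair closed [n]
    letters later, which is [(0, k)]. *)
Lemma mt_act w k n : good k0 (line w) -> mt k n (Th w) -> act (at_ n) (w, k0) = (w, k).
Proof.
move=> g /(mt_Th _ _ g) h; rewrite -iter_stp_act iter_stp_a.
rewrite (iterT_good (y := (0, k)) g (closes00 k0 (line w) 0)) /=; first by rewrite rmove1.
by exists n.
Qed.

Lemma mt_ex w k : good k0 (line w) -> exists n, mt k n (Th w).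
Proof.
by move=> g; have [p [n _ h]] := g.1 (0, k); exists n; apply/mt_Th.
Qed.

(* For [w] in [B2], [codeP i h (Theta k0 (w, k0))] holds for some [h] and implies that [h] moves
   [(w, k0)] to the translate of [w] by the generator [i].  For alpha, [h] leads to the
   next letter with first coordinate [k0]; for beta_k, it leads from [(w, k0)] to [(w, k)],
   then to [(beta_k w, k)] and finally to [(beta_k w, k0)]. *)
Definition codeA (h : F2) (z : X1) := exists n, h = at_ n.+1 /\ (z h).1 = k0 /\
  forall i, (i < n)%N -> (z (at_ i.+1)).1 <> k0.

Definition codeB k (h : F2) (z : X1) := exists n n',
  h = (at_ n * (gl (lb true) * gl (la false) ^+ n'))%g /\ (z h).1 = k0 /\
  mt k n z /\ mt k n' (shift2 h z).

Definition codeP (i : 'I_#|K|.+1) h z :=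
  if unlift ord0 i is Some j then codeB (enum_val j) h z else codeA h z.

(** For an inverse letter the generator is coded at the target, by [h^-1]. The condition on [z h]
    makes the target a state with [k0], as [codeP_act] requires. *)
Definition code (l : letter #|K|.+1) h (z : X1) :=
  if l.2 then codeP l.1 h z else (z h).1 = k0 /\ codeP l.1 h^-1%g (shift2 h z).

Lemma rd_block w i : good k0 (line w) -> (i < sz (line w 0))%N ->
  ((rd k0 (line w) (0, 0%N) i).1 == k0) = (i == 0%N).
Proof.
move=> g isz; rewrite /rd iter_succ_block // /lbl /=.
case: i isz => [|i] isz; first by rewrite /lab /= !eqxx.
by apply/negbTE/(all_nthP (k0, (line w 0).1) (good_rest 0 g)).
Qed.

Lemma rd_sz w : (rd k0 (line w) (0, 0%N) (sz (line w 0))).1 = k0.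
Proof. by rewrite /rd iter_succ_sz. Qed.

Lemma codeA_act w h : good k0 (line w) -> codeA h (Th w) -> act h (w, k0) = (rmove (gl (al K true)) w, k0).
Proof.
move=> g [n [-> [hk hn]]].
(* On a good line the next letter with [k0] is the start of the next block. *)
have n1 : n.+1 = sz (line w 0).
  move: hk; rewrite Theta_at // => hk.
  case: (ltngtP n.+1 (sz (line w 0))) => // lt.
    by have := rd_block g lt; rewrite hk eqxx.
  by have := hn (size (line w 0).2) lt; rewrite Theta_at // rd_sz.
rewrite -iter_stp_act iter_stp_a n1 (iterT_good (y := (1, k0)) g (closes00 k0 (line w) 0)) //.
by rewrite iter_succ_sz add0r; exact: closes00.
Qed.

Lemma codeA_ex w : good k0 (line w) -> exists h, codeA h (Th w).
Proof.
move=> g; exists (at_ (sz (line w 0))), (size (line w 0).2); split=> //.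
split; first by rewrite Theta_at // rd_sz.
by move=> i ilt; rewrite Theta_at // => /eqP; rewrite rd_block.
Qed.

Lemma act_at_cancel n v : act (at_ n) (act (gl (la false) ^+ n)%g v) = v.
Proof. by rewrite -(actM (stpK k0)) (gl_la_cancel n false) act1. Qed.

Lemma act_at_cancel' n v : act (gl (la false) ^+ n)%g (act (at_ n) v) = v.
Proof. by rewrite -(actM (stpK k0)) (gl_la_cancel n true) act1. Qed.

Lemma codeB_act w k h : B2 w -> codeB k h (Th w) ->
  act h (w, k0) = (rmove (gl (bl k true)) w, k0).
Proof.
move=> bw [n [n' [hE [hk [m m']]]]].
have e1 := mt_act (B2_good bw) m.
pose w1 := rmove (gl (bl k true)) w.
have e2 : act h (w, k0) = act (gl (la false) ^+ n')%g (w1, k).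
  by rewrite hE !(actM (stpK k0)) e1.
case e3 : (act h (w, k0)) => [w2 k2].
have k20 : k2 = k0 by move: hk; rewrite /Theta e3.
rewrite k20 in e3 *; have bw2 : B2 w2.
  by have [g] := act_rmove h (w, k0); rewrite e3 /= => ->; exact: B2_rmove.
move: m'; rewrite -(Theta_shift2_k0 e3) => /(mt_act (B2_good bw2)) e4.
(* From the target, the n' steps forward lead to [(w2, k)] by matching, and to [(w1, k)] because
   they undo the end of [h]. *)
by move: e4; rewrite -{1}e3 e2 act_at_cancel => -[<-].
Qed.

Lemma codeB_ex w k : B2 w -> exists h, codeB k h (Th w).
Proof.
move=> bw; pose w1 := rmove (gl (bl k true)) w.
have bw1 : B2 w1 by exact: B2_rmove.
have [n m] := mt_ex k (B2_good bw); have [n' m'] := mt_ex k (B2_good bw1).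
exists (at_ n * (gl (lb true) * gl (la false) ^+ n'))%g, n, n'; split=> //.
have e : act (at_ n * (gl (lb true) * gl (la false) ^+ n'))%g (w, k0) = (w1, k0).
  rewrite !(actM (stpK k0)) (mt_act (B2_good bw) m).
  have -> : act (gl (lb true)) (w, k) = (w1, k) by [].
  by rewrite -(mt_act (B2_good bw1) m') act_at_cancel'.
by split; [rewrite /Theta e|rewrite -(Theta_shift2_k0 e)].
Qed.

Lemma codeP_act w i h : B2 w -> codeP i h (Th w) -> act h (w, k0) = (rmove (gl (i, true)) w, k0).
Proof.
move=> bw; rewrite /codeP; case: unliftP => [j ->|->].
  by move=> /(codeB_act bw); rewrite /bl enum_valK.
exact: codeA_act (B2_good bw).
Qed.

Lemma codeP_ex w i : B2 w -> exists h, codeP i h (Th w).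
Proof.
move=> bw; rewrite /codeP; case: unliftP => [j _|_]; first exact: codeB_ex.
exact: codeA_ex (B2_good bw).
Qed.

Lemma code_act w l h : B2 w -> code l h (Th w) -> act h (w, k0) = (rmove (gl l) w, k0).
Proof.
case: l => i [] bw; rewrite /code /=; first exact: codeP_act.
move=> [hk hc]; case e : (act h (w, k0)) => [w' k'].
have k'0 : k' = k0 by move: hk; rewrite /Theta e.
rewrite k'0 in e *; have bw' : B2 w'.
  by have [g] := act_rmove h (w, k0); rewrite e /= => ->; exact: B2_rmove.
move: hc; rewrite -(Theta_shift2_k0 e) => /(codeP_act bw') e'.
move: e'; rewrite -{1}e (actK (stpK k0)) => -[->]; rewrite -rmoveM.
by have := gl_inv (i, true); rewrite /letter_inv /= => ->; rewrite mulgV rmove1.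
Qed.

Lemma code_ex w l : B2 w -> exists h, code l h (Th w).
Proof.
case: l => i [] bw; rewrite /code /=; first exact: codeP_ex.
pose w' := rmove (gl (i, false)) w; have bw' : B2 w' by exact: B2_rmove.
have [h' hc] := codeP_ex i bw'; have := codeP_act bw' hc.
rewrite /w' -rmoveM; have := gl_inv (i, true); rewrite /letter_inv /= => giE.
rewrite giE mulVg rmove1 -giE -/w' => e'.
have e : act h'^-1%g (w, k0) = (w', k0) by rewrite -e' (actK (stpK k0)).
exists h'^-1%g; split; first by rewrite /Theta e.
by rewrite invgK -(Theta_shift2_k0 e).
Qed.

Lemma reach_ex g w : B2 w -> exists h, act h (w, k0) = (rmove g w, k0).
Proof.
have gE : g = foldr (fun l g => (gl l * g)%g) 1%g (word g).
  by apply: val_inj; rewrite /= -[LHS](word_mul1 (word_reduced g)); elim: (word g) => //= l u <-.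
rewrite {}gE; elim: (word g) w => [|l u IH] w bw /=; first by exists 1%g; rewrite rmove1.
have [h hc] := code_ex l bw; have e := code_act bw hc.
have [h' e'] := IH _ (B2_rmove (gl l) bw).
by exists (h * h')%g; rewrite (actM (stpK k0)) e e' rmoveM.
Qed.

(* Reads the value [l] of [w] at the element with word [u] from [z = Theta k0 (w, k0)]. *)
Fixpoint decode (u : seq (letter #|K|.+1)) (l : L) (z : X1) : Prop :=
  if u is s :: u' then exists h, code s h z /\ decode u' l (shift2 h z)
  else (z 1%g).2 = l.1 /\ (forall i, (i < size l.2)%N -> z (at_ i.+1) = nth (k0, k0) l.2 i) /\
    (z (at_ (sz l))).1 = k0 /\ all (fun c => c.1 != k0) l.2.

(** A block is recognised by its end: it stops at the first later letter with [k0], so neither a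
    shorter nor a longer [l] can fit. *)
Lemma decode_nil w l : good k0 (line w) -> decode [::] l (Th w) <-> l = line w 0.
Proof.
move=> g; have E : (Th w 1%g).2 = (line w 0).1 := congr1 snd (Theta_at 0 g).
split=> [[h0 [h1 [h2 h3]]]|->].
  have sE : size l.2 = size (line w 0).2.
    apply/eqP; rewrite -eqSS -/(sz l) -/(sz (line w 0)); move: h2; rewrite Theta_at // => h2.
    case: (ltngtP (sz l) (sz (line w 0))) => // h.
      by have := rd_block g h; rewrite h2 eqxx.
    have := h1 (size (line w 0).2) h; rewrite Theta_at // => /(congr1 fst).
    by rewrite rd_sz => /esym/eqP; rewrite (negbTE (all_nthP (k0, k0) h3 _ h)).
  rewrite [l]surjective_pairing [RHS]surjective_pairing; congr pair; first by rewrite -E; exact/esym/h0.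
  apply: (@eq_from_nth _ (k0, k0)) => // i il; rewrite -h1 // Theta_at //.
  rewrite /rd iter_succ_block ?ltnS -?sE // /lbl /lab /=.
  by apply: set_nth_default; rewrite -sE.
split; first exact: E.
split=> [i il|].
  rewrite Theta_at // /rd iter_succ_block // /lbl /lab /=.
  exact: set_nth_default.
by split; [rewrite Theta_at // rd_sz|exact: good_rest].
Qed.

Lemma decodeP g w l : B2 w -> decode (word g) l (Th w) <-> l = w g.
Proof.
have gE : g = foldr (fun l g => (gl l * g)%g) 1%g (word g).
  by apply: val_inj; rewrite /= -[LHS](word_mul1 (word_reduced g)); elim: (word g) => //= s u <-.
rewrite {2}gE; elim: (word g) w => [|s u IH] w bw.
  exact: (decode_nil l (B2_good bw)).
split=> [[h [hc hd]]|/= lE].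
  have e := code_act bw hc; move: hd; rewrite -(Theta_shift2_k0 e) => hd.
  have := (IH (rmove (gl s) w) (B2_rmove (gl s) bw)).1 hd; by rewrite rmoveE.
have [h hc] := code_ex s bw; exists h; split=> //.
have e := code_act bw hc; rewrite -(Theta_shift2_k0 e).
by apply: (IH (rmove (gl s) w) (B2_rmove (gl s) bw)).2; rewrite rmoveE.
Qed.

(** Requiring uniqueness makes this measurable everywhere: where several values decode, [xget]
    returns the fixed default instead of an uncontrolled choice. *)
Definition inverse (z : X1) : W := fun g =>
  xget point [set l | decode (word g) l z /\ forall l', decode (word g) l' z -> l' = l].

Lemma inverseK w : B2 w -> inverse (Th w) = w.
Proof.
move=> bw; apply/funext => g; rewrite /inverse; case: xgetP => [l _ [h _]|/(_ (w g)) []].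
  by apply/(decodeP g l bw).
split; first exact/(decodeP g _ bw).
by move=> l' /(decodeP g _ bw).
Qed.

Lemma measurable_shift2 h (A : set X1) : measurable A -> measurable [set z | A (shift2 h z)].
Proof.
move=> mA; have mf : measurable_fun setT (shift2 h).
  apply: measurable_fun_pow => g; rewrite (_ : (fun z => _) = fun z : X1 => z (h * g)%g).
    exact: measurable_pow_proj.
  by apply/funext => z; rewrite shift2E.
by have := mf measurableT A mA; rewrite setTI.
Qed.

Lemma measurable_mt k n : measurable [set z | mt k n z].
Proof.
by apply: measurable_matched => i c; exact: (measurable_at1 (at_ i) [set d | d.1 = c]).
Qed.

Lemma measurable_codeP i h : measurable [set z | codeP i h z].
Proof.
rewrite /codeP; case: (unlift ord0 i) => [j|].
  apply: measurable_set_exists => n; apply: measurable_set_exists => n'.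
  apply: measurable_set_and; first exact: measurable_set_prop.
  apply: measurable_set_and; first exact: (measurable_at1 h [set d | d.1 = k0]).
  apply: measurable_set_and; first exact: measurable_mt.
  exact: (measurable_shift2 h (measurable_mt _ _)).
apply: measurable_set_exists => n; apply: measurable_set_and; first exact: measurable_set_prop.
apply: measurable_set_and; first exact: (measurable_at1 h [set d | d.1 = k0]).
apply: measurable_set_forall => m; apply: measurable_set_imp => _.
exact: (measurable_at1 (at_ m.+1) [set d | d.1 <> k0]).
Qed.

Lemma measurable_code l h : measurable [set z | code l h z].
Proof.
rewrite /code; case: (l.2); first exact: measurable_codeP.
apply: measurable_set_and; first exact: (measurable_at1 h [set d | d.1 = k0]).
exact: (measurable_shift2 h (measurable_codeP _ _)).
Qed.

Lemma measurable_decode u l : measurable [set z | decode u l z].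
Proof.
elim: u => [|s u IH] /=.
  apply: measurable_set_and; first exact: (measurable_at1 1%g [set d | d.2 = l.1]).
  apply: measurable_set_and.
    apply: measurable_set_forall => i; apply: measurable_set_imp => _.
    exact: (measurable_at1 (at_ i.+1) [set nth (k0, k0) l.2 i]).
  apply: measurable_set_and; last exact: measurable_set_prop.
  exact: (measurable_at1 (at_ (sz l)) [set d | d.1 = k0]).
apply: measurable_set_exists => h; apply: measurable_set_and; first exact: measurable_code.
exact: (measurable_shift2 h IH).
Qed.

Lemma measurable_inverse : measurable_fun setT inverse.
Proof.
apply: measurable_fun_pow => g _ A _; rewrite setTI.
pose U l (z : X1) := decode (word g) l z /\ forall l', decode (word g) l' z -> l' = l.
have mU l : measurable [set z | U l z].
  apply: measurable_set_and; first exact: measurable_decode.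
  apply: measurable_set_forall => l'.
  apply: (@measurable_set_ext _ _ (fun z => ~ decode (word g) l' z \/ l' = l)).
    move=> z; split=> [[h /h //|-> //]|h].
    by have [/h|] := pselect (decode (word g) l' z); [right|left].
  apply: measurable_set_or; last exact: measurable_set_prop.
  by apply: measurable_set_not; exact: measurable_decode.
suff mI : cmeasurable (fun z => inverse z g) by exact: (cmeasurable_pre A mI).
move=> l; apply: (@measurable_set_ext _ _ (fun z => U l z \/ l = point /\ ~ exists l', U l' z)).
  move=> z; rewrite /inverse /=; case: xgetP => [l' _ Ul'|h]; split.
  - by move=> [[_ h]|[_ []]]; [exact: h Ul'.1|exists l'; exact: Ul'].
  - by move=> <-; left; exact: Ul'.
  - by move=> [/h []|[->]].
  - by move=> <-; right; split=> // -[l' /h].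
apply: measurable_set_or; first exact: mU.
apply: measurable_set_and; first exact: measurable_set_prop.
by apply: measurable_set_not; apply: measurable_set_exists => l'; exact: mU.
Qed.

Lemma measurable_B2 : measurable B2.
Proof.
apply: measurable_set_forall => g.
by have := measurable_rmove g (@measurable_good _ K_gt1 k0).
Qed.

End Inverse.

(** * The orbit equivalence *)

(* Unlike [discrete_topology], this copy is also a pointed topological space. *)
Definition discrete_copy (T : Type) : Type := T.

Section DiscreteCopy.
Context (T : pointedType).
Local Notation DT := (discrete_copy T).
HB.instance Definition _ := Pointed.copy DT T.
HB.instance Definition _ := hasNbhs.Build DT principal_filter.
HB.instance Definition _ := Discrete_ofNbhs.Build DT erefl.
HB.instance Definition _ := DiscreteUniform_ofNbhs.Build DT.
HB.instance Definition _ (R : numDomainType) := @DiscretePseudoMetric_ofUniform.Build R DT.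

Lemma discrete_complete (F : set_system DT) : ProperFilter F -> cauchy F -> cvg F.
Proof.
move=> PF /(_ [set p | p.1 = p.2]).
have ent : entourage [set p : DT * DT | p.1 = p.2] by move=> _ [x _ <-].
move=> /(_ ent)[[A B] /= [FA FB] AB].
have [x [Ax Bx]] := filter_ex (filterI FA FB).
have Fx : F [set x].
  by apply: filterS FB => y By; have := AB (x, y) (conj Ax By); move=> /= ->.
apply/cvg_ex; exists x => U Ux.
by apply: filterS Fx => y ->; exact: (nbhs_singleton Ux).
Qed.

HB.instance Definition _ := Uniform_isComplete.Build DT discrete_complete.
End DiscreteCopy.

Section Std.
Context (R : realType) (K : finType) (K_gt1 : (1 < #|K|)%N).
Local Notation L := (block K_gt1).

Lemma block_standard : standard_borel R L.
Proof.
exists (discrete_copy L : completePseudoMetricType R); split.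
- exact: discrete_hausdorff.
- exists setT; first exact: countableP.
  by move=> U U0 _; rewrite setIT.
exists id; first by exists id.
move=> A; split=> // _; exists A => //; apply: sub_sigma_algebra.
exact: discrete_open.
Qed.
End Std.

(** * Existence of the product measures in use *)

Section Exist.
Context (R : realType) (K : finType) (K_gt1 : (1 < #|K|)%N).
Local Notation kap := (uniform_measure K_gt1 R).
Local Notation D := (discrete_space K_gt1).

Lemma pow_kap_exists (I : choiceType) : countable [set: I] -> is_pow_measure kap (pow_measure I kap).
Proof.
move=> cI; apply: pow_measureP; have [P0 hP0] := pow_nat_exists R K_gt1.
apply: (pow_exists hP0 (f := fun x => x 0%N)) => // [|B mB].
  exact: measurable_pow_proj.
have := hP0 [fset 0%N]%fset (fun=> B) (fun=> mB).
rewrite big_seq_fset1 => <-; congr (P0 _).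
by apply/seteqP; split=> x; [move=> /(_ 0%N (fset11 _))|move=> h i /fset1P ->].
Qed.

Lemma iid_kap2 : exists P0 : probability (pow_space nat (D * D)) R, is_pow_measure (kap2 R K_gt1) P0.
Proof.
have [P0 hP0] := pow_nat_exists R K_gt1.
pose f (x : pow_space nat D) : D * D := (x 0%N, x 1%N).
have mf : measurable_fun setT f.
  by apply/measurable_fun_pairP; split; exact: measurable_pow_proj.
have cf : cmeasurable (f : pow_space nat D -> (K * K)%type).
  by move=> c; have := mf measurableT [set c] (measurableDD _); rewrite setTI.
have cid : cmeasurable ((fun c => c) : D * D -> (K * K)%type).
  by move=> c; exact: (measurableDD [set c]).
apply: (pow_exists hP0 mf); last exact: countableP.
move=> B mB; have mfB : measurable (f @^-1` B) by have := mf measurableT B mB; rewrite setTI.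
rewrite (measure_fin_partition (kap2 R K_gt1) cid mB) (measure_fin_partition P0 cf mfB).
apply: eq_bigr => c _; have [Bc|Bc] := pselect (B c); last first.
  rewrite (_ : _ `&` _ = set0); last by apply/seteqP; split=> // x [Bx /= xc]; apply: Bc; rewrite -xc.
  rewrite measure0 (_ : _ `&` _ = set0) ?measure0 //.
  by apply/seteqP; split=> // x [Bx xc]; apply: Bc; rewrite -xc.
transitivity (kap2 R K_gt1 [set c]).
  by congr (kap2 _ _ _); apply/seteqP; split=> x [] //= ->.
rewrite kap2_1.
pose Bi i : set D := if i == 0%N then [set c.1] else [set c.2].
have := hP0 [fset i | i in iota 0 2]%fset Bi (fun=> I); rewrite prod_fset_iota !big_ord_recl big_ord0 mule1.
rewrite /Bi /= !uniform1 -EFinM -expr2 => <- //.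
congr (P0 _); apply/seteqP; split=> x.
  move=> h; have h0 : x 0%N = c.1 by apply: (h 0%N); apply/imfsetP; exists 0%N.
  have h1 : x 1%N = c.2 by apply: (h 1%N); apply/imfsetP; exists 1%N.
  have e : f x = c by rewrite /f h0 h1 -surjective_pairing.
  by split=> //=; rewrite e.
move=> [_ <-] i /imfsetP[j /= + ->].
by rewrite !inE => /orP[/eqP ->|/eqP ->].
Qed.

End Exist.

(** * [inverse] as an orbit equivalence between conull sets *)

Section Main.
Context (R : realType) (K : finType) (K_gt1 : (1 < #|K|)%N) (k0 : K).
Local Notation kap := (uniform_measure K_gt1 R).
Local Notation D := (discrete_space K_gt1).
Local Notation L := (block K_gt1).
Local Notation e := (#|K|%:R^-1 : R).
Local Notation q := (#|K|%:R : R).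
Local Notation F := (free_group #|K|.+1).
Local Notation W := (pow_space F L).
Local Notation F2 := (free_group 2).
Local Notation b := (free_gen (ord_max : 'I_2)).
Local Notation X1 := (pow_space F2 (D * D)%type).
Context (lam : probability L R) (P : probability W R).
Hypothesis hP : is_pow_measure lam P.
Hypothesis P_reads : forall c u, c.1 = k0 ->
  P (reads k0 (c :: u)) = (e ^+ (1 + 2 * size u))%:E.
Hypothesis good_as : P [set w : W | ~ good k0 (line w)] = 0%E.
Hypothesis hPx : is_pow_measure kap (pow_measure (lcosets_cyclic b) kap).
Hypothesis hPy : is_pow_measure kap (pow_measure F2 kap).
Local Notation mu1 := (coset_measure b kap).
Local Notation Th w := (Theta k0 (w, k0) : X1).
Local Notation A1 := (@A1 K K_gt1 k0 : set X1).
Local Notation B2 := (@B2 K K_gt1 k0 : set W).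
Local Notation inverse := (@inverse K K_gt1 k0 : X1 -> W).

Lemma B2_null : P (~` B2) = 0%E.
Proof.
have -> : ~` B2 = [set w : W | exists g : F, ~ good k0 (line (rmove g w))].
  by apply/seteqP; split=> w; [move=> /existsNP|move=> h; apply/existsNP].
apply: countable_null => g.
  by apply: measurable_set_not; exact: (measurable_rmove g (@measurable_good _ K_gt1 k0)).
rewrite -[RHS]good_as; apply: (P_rmove hP g (A := [set w : W | ~ good k0 (line w)])).
by apply: measurable_set_not; exact: measurable_good.
Qed.

Definition B1 : set X1 := [set z | A1 z /\ B2 (inverse z) /\ Th (inverse z) = z].

Lemma measurable_Th_inverse : measurable_fun setT (fun z => Th (inverse z) : X1).
Proof. exact: (measurableT_comp (@measurable_Th _ K_gt1 k0) (@measurable_inverse _ K_gt1 k0)). Qed.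

Lemma measurable_B1 : measurable B1.
Proof.
apply: measurable_set_and; first exact: measurable_A1.
apply: measurable_set_and.
  by have := @measurable_inverse _ K_gt1 k0 measurableT _ (@measurable_B2 _ K_gt1 k0); rewrite setTI.
(* Equality of two points is expressed by countably many coordinates with finitely many values
   each. *)
apply: (@measurable_set_ext _ _ (fun z : X1 => forall g : F2, exists c : K * K,
    Th (inverse z) g = c /\ z g = c)).
  move=> z; split=> [h|h g]; first by apply/funext => g; have [c [-> ->]] := h g.
  by exists (z g); split=> //; rewrite h.
apply: measurable_set_forall => g; apply: measurable_set_exists => c.
apply: measurable_set_and; last exact: (measurable_at1 g [set c]).
have := measurable_Th_inverse measurableT (@measurable_at1 _ K_gt1 g [set c]).
by rewrite setTI.
Qed.

Lemma Th_B1 w : B2 w -> B1 (Th w).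
Proof. by move=> bw; split=> //; rewrite inverseK. Qed.

(** [P_Th] pulls the difference back to [W], where [Th_B1] confines it to the complement of [B2]. *)
Lemma conull_B1 : conull_in mu1 A1 B1.
Proof.
have mAB : measurable (A1 `\` B1).
  by apply: measurableD; [exact: measurable_A1|exact: measurable_B1].
split; [exact: measurable_B1|by move=> z []|].
have := P_Th hP P_reads good_as hPx hPy mAB.
rewrite (setIidl (@subDsetl _ A1 B1)).
have -> : P [set w | (A1 `\` B1) (Th w)] = 0%E.
  apply: (subset_measure0 _ _ _ B2_null).
  - by have := @measurable_Th _ K_gt1 k0 measurableT _ mAB; rewrite setTI.
  - by apply: measurableC; exact: measurable_B2.
  - by move=> w [_ nb] bw; apply: nb; exact: Th_B1.
move/esym/eqP; rewrite mule_eq0 => /orP[|/eqP //].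
by rewrite eqe (negbTE (qne0 R K_gt1)).
Qed.

Lemma B1_inj : {in B1 &, injective inverse}.
Proof. by move=> z z' /set_mem[_ [_ e]] /set_mem[_ [_ e']] h; rewrite -e -e' h. Qed.

Lemma image_inverse (E : set X1) : E `<=` B1 -> inverse @` E = B2 `&` [set w | E (Th w)].
Proof.
move=> EB; apply/seteqP; split=> w.
  by move=> [z Ez <-]; have [_ [h1 h2]] := EB z Ez; split=> //=; rewrite h2.
by move=> [bw Ew]; exists (Th w) => //; exact: inverseK.
Qed.

Lemma measurable_pre_Th (E : set X1) : measurable E -> measurable [set w : W | E (Th w)].
Proof. by move=> mE; have := @measurable_Th _ K_gt1 k0 measurableT _ mE; rewrite setTI. Qed.

Lemma iso_B1_B2 : measure_iso_on mu1 P A1 setT inverse B1 B2.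
Proof.
split.
- split; [|exact: B1_inj|by move=> w bw; exists (Th w); [exact: Th_B1|exact: inverseK]].
  by move=> z [_ []].
- move=> E mE; apply: measurableI; first exact: measurable_B1.
  by have := @measurable_inverse _ K_gt1 k0 measurableT _ mE; rewrite setTI.
- move=> E mE EB; rewrite image_inverse //.
  by apply: measurableI; [exact: measurable_B2|exact: measurable_pre_Th].
move=> E mE EB; rewrite /cond_measure image_inverse // setIT probability_setT invr1 mule1.
transitivity (P [set w | E (Th w)]).
  apply: (measure_eq_mod_null (N := ~` B2)); last 2 first.
  - exact: B2_null.
  - by move=> w /contrapT bw; split=> [[]|].
  - by apply: measurableC; exact: measurable_B2.
  - by apply: measurableI; [exact: measurable_B2|exact: measurable_pre_Th].
  - exact: measurable_pre_Th.
rewrite (P_Th hP P_reads good_as hPx hPy mE) muleC (mu1_A1E hP P_reads good_as hPx hPy).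
by rewrite /= invrK.
Qed.

(** An element of F2 always takes [w] to one of its translates, and the image is in [A1] only if the
    state is again [k0]. Conversely [reach_ex] realises every translate. *)
Lemma orbit_B1 z : B1 z -> inverse @` (action_orbit (shift_action F2 (D * D)%type) z `&` B1) =
  action_orbit (shift_action F L) (inverse z) `&` B2.
Proof.
move=> [_ [bz zE]]; rewrite image_inverse; last exact: subIsetr.
set w := inverse z; apply/seteqP; split=> w'.
  move=> [bw' [[g _ gE] _]]; split=> //.
  have e : Th w' = Theta k0 (act (stp k0) g^-1%g (w, k0)).
    by rewrite Theta_act invgK -/w in gE *; rewrite zE gE.
  have [g' g'E] := act_rmove (K_gt1 := K_gt1) k0 g^-1%g (w, k0).
  move: e g'E; case: (act _ _ _) => w2 k2 /= e w2E.
  have k20 : k2 = k0 by have := congr1 (fun x : X1 => (x 1%g).1) e.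
  exists g'^-1%g => //; move: e; rewrite k20 w2E => e.
  rewrite -(inverseK bw') e inverseK //.
  exact: B2_rmove.
move=> [[g _ gE] bw']; split=> //; split; last exact: Th_B1.
have [h hE] := reach_ex g^-1%g bz; exists h^-1%g => //.
have := @Theta_shift2_k0 _ K_gt1 k0 _ _ _ hE; rewrite /rmove invgK gE => ->.
by rewrite /shift2 zE.
Qed.

Lemma stable_oe : stably_orbit_equivalent (shift_action F2 (D * D)%type) mu1 (shift_action F L) P.
Proof.
exists A1, setT, inverse, B1, B2; split.
- split; [exact: measurable_A1|exact: measurableT| |by rewrite probability_setT lte01].
  by rewrite (mu1_A1E hP P_reads good_as hPx hPy) lte_fin e_gt0.
- by [].
- split; first exact: conull_B1.
  by split; [exact: measurable_B2|by []|rewrite setTD; exact: B2_null].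
- exact: iso_B1_B2.
by apply/aeW => z; exact: orbit_B1.
Qed.

End Main.

Lemma block_law_nontrivial (R : realType) (K : finType) (K_gt1 : (1 < #|K|)%N) (k0 : K)
  (P0 : probability (pow_space nat (discrete_space K_gt1 * discrete_space K_gt1)) R) :
  is_pow_measure (kap2 R K_gt1) P0 -> nontrivial_probability (block_law k0 P0).
Proof.
move=> hP0 [y v]; apply/eqP => l1.
have [y' yy'] : exists y', y' != y.
  have := K_gt1; rewrite (cardD1 y) inE /= ltnS => /card_gt0P[y']; rewrite !inE => /andP[h _].
  by exists y'.
have e0 := e_gt0 R K_gt1.
have : block_law k0 P0 (~` [set (y, v)]) = 0%E by rewrite probability_setC // l1 subee.
move=> h; have h0 : block_law k0 P0 [set l : block K_gt1 | l.1 = y' /\ prefix [::] l.2] = 0%E.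
  apply: (subset_measure0 _ _ _ h) => //.
  by move=> [z u] /= [-> _] [h' _]; rewrite h' eqxx in yy'.
have := etrans (esym h0) (block_law_prefix hP0 y' (v := [::]) isT).
by move=> [] /esym/eqP; rewrite muln0 addn0 expr1 gt_eqF.
Qed.

Theorem theorem1p4 (R : realType) (K : finType) (K_gt1 : (1 < #|K|)%N) :
  exists (d : measure_display) (L : measurableType d) (lambda : probability L R),
    [/\ standard_borel R L,
        nontrivial_probability lambda &
        stably_orbit_equivalent
          (shift_action (free_group 2) (discrete_space K_gt1 * discrete_space K_gt1))
          (coset_measure (free_gen (ord_max : 'I_2)) (uniform_measure K_gt1 R))
          (shift_action (free_group #|K|.+1) L)
          (pow_measure (free_group #|K|.+1) lambda)].
Proof.
pose k0 : K := enum_val (Ordinal (ltnW K_gt1)).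
have [P0 hP0] := iid_kap2 R K_gt1.
exists default_measure_display, (block K_gt1), (block_law k0 P0).
split; [exact: block_standard|exact: block_law_nontrivial|].
have hP : is_pow_measure (block_law k0 P0) (pow_measure (free_group #|K|.+1) (block_law k0 P0)).
  apply: pow_measureP; apply: (pow_exists hP0 (measurable_first_block k0)) => //.
  exact: countableP.
have P_reads := P_reads hP (block_law_single hP0) (block_law_prefix hP0) (block_law_rest k0 P0).
have good_as := good_as hP (P_nomatch P_reads) (block_law_tail k0 hP0).
apply: (stable_oe hP P_reads good_as); apply: pow_kap_exists; first exact: countable_cosets.
exact: countableP.
Qed.
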